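(* Let $(\mathbb{Q}_i)_{i=1}^d$ be a family of probability measures on $(\Omega,\mathcal F(T))$. Then there exists a valuation measure $\overline{\mathbb{Q}}\sim\sum_i\mathbb{Q}_i$ with respect to the basket if one of the following two conditions holds: (a) for each $i$, every component of $S_i=(S_{i,j})_j$ is a $\mathbb{Q}_i$-martingale; (b) all of the following hold: (i) for each $i$, every component of $S_i$ is a $\mathbb{Q}_i$-local martingale; (ii) $\mathbb P:=\sum_i\mathbb{Q}_i/d$ satisfies NOD; (iii) for each $i$, the restrictions of $\mathbb{Q}_i$ and of $\sum_k\mathbb{Q}_k$ to the trace $\sigma$-algebra $\{A\cap\{\sum_jS_{i,j}(T)<\infty\}:A\in\mathcal F(T)\}$ are equivalent; (iv) there exist $\varepsilon>0$, $N\in\mathbb N$ and predictable times $T_1,\dots,T_N$ such that, $\mathbb P$-almost surely, $$\bigcup_i\Big\{(t,\omega):\ \sum_jS_{i,j}(t)=\infty\ \text{and}\ \sum_jS_{i,j}(t-)\le d+\varepsilon\Big\}\subset\bigcup_{n=1}^N[\![T_n]\!],$$ where $[\![T_n]\!]=\{(t,\omega):T_n(\omega)=t\}$ is the graph of $T_n$.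
   Context: Fix $T>0$, $d\in\mathbb N$, and a filtered space $(\Omega,\mathcal{F}(T),(\mathcal{F}(t))_{t\in[0,T]})$ with right-continuous filtration and trivial $\mathcal{F}(0)$. For $x,y\in[0,\infty]$ the product $xy$ is defined except when one is $0$ and the other is $\infty$. An exchange matrix is $s=(s_{i,j})\in[0,\infty]^{d\times d}$ with $s_{i,i}=1$ and $s_{i,j}s_{j,k}=s_{i,k}$ for all $i,j,k$ whenever the product is defined. $S=(S_{i,j})_{i,j=1}^d$ is a right-continuous adapted $[0,\infty]^{d\times d}$-valued process such that $S(t)$ is an exchange matrix for every $t$; $S_i=(S_{i,j})_j$ is its $i$-th row. Active currencies: $\mathfrak{A}(t)=\{i:\sum_jS_{i,j}(t)<\infty\}$, with $\mathfrak A(0)=\{1,\dots,d\}$. Basket prices: $\overline S_i=1/\sum_jS_{i,j}\in[0,1]$. A valuation measure with respect to the basket is a probability measure $\overline{\mathbb{Q}}$ on $(\Omega,\mathcal{F}(T))$ under which $\overline S=(\overline S_i)_i$ is a (local) martingale. A probability measure $\mathbb P$ satisfies No Obvious Devaluations (NOD) if for every $i$ and every stopping time $\tau$ (possibly taking the value $\infty$), $\mathbb P(i\in\mathfrak A(T)\mid\mathcal F(\tau))>0$ holds $\mathbb P$-a.s. on $\{\tau<\infty\}\cap\{i\in\mathfrak A(\tau)\}$. *)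

(* Defs.v *)
From HB Require Import structures.
From mathcomp Require Import all_boot all_order all_algebra.
From mathcomp Require Import all_classical all_reals all_analysis measurable_realfun.
Set Implicit Arguments. Unset Strict Implicit. Unset Printing Implicit Defensive.
Import Order.TTheory GRing.Theory Num.Theory.
Import numFieldNormedType.Exports.
Local Open Scope classical_set_scope.
Local Open Scope ring_scope.

(* ---------- Filtered space on the time interval [0,T] ----------
   F t is the sigma-algebra F(t) for 0 <= t <= T.  For t >= T we use the usual
   convention F(t) := F(T) (only needed for stopping times taking values > T). *)

Definition Fx {R : realType} {dO} {Om : measurableType dO}
  (T : R) (F : R -> set (set Om)) (t : R) : set (set Om) := F (Num.min t T).

Definition filtration {R : realType} {dO} {Om : measurableType dO}
  (T : R) (F : R -> set (set Om)) : Prop :=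
  [/\ forall t, 0 <= t <= T -> sigma_algebra setT (F t),
      forall s t, 0 <= s -> s <= t -> t <= T -> F s `<=` F t &
      F T = measurable ].

Definition right_continuous_filtration {R : realType} {dO} {Om : measurableType dO}
  (T : R) (F : R -> set (set Om)) : Prop :=
  forall t, 0 <= t < T -> F t = [set A | forall u, t < u <= T -> F u A].

Definition trivial_F0 {R : realType} {dO} {Om : measurableType dO}
  (F : R -> set (set Om)) : Prop :=
  forall A, F 0 A -> A = set0 \/ A = setT.

Definition adapted {R : realType} {dO} {Om : measurableType dO}
  (T : R) (F : R -> set (set Om)) (X : R -> Om -> \bar R) : Prop :=
  forall t, 0 <= t <= T -> forall B : set (\bar R), measurable B -> F t (X t @^-1` B).

Definition stopping_time {R : realType} {dO} {Om : measurableType dO}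
  (T : R) (F : R -> set (set Om)) (tau : Om -> \bar R) : Prop :=
  (forall w, (0 <= tau w)%E) /\
  forall t : R, 0 <= t -> Fx T F t [set w | (tau w <= t%:E)%E].

Definition F_at {R : realType} {dO} {Om : measurableType dO}
  (T : R) (F : R -> set (set Om)) (tau : Om -> \bar R) : set (set Om) :=
  [set A | measurable A /\
     forall t : R, 0 <= t -> Fx T F t (A `&` [set w | (tau w <= t%:E)%E])].

Definition predictable_time {R : realType} {dO} {Om : measurableType dO}
  (T : R) (F : R -> set (set Om)) (tau : Om -> \bar R) : Prop :=
  stopping_time T F tau /\
  exists sig : nat -> Om -> \bar R,
    [/\ forall k, stopping_time T F (sig k),
        forall k w, (sig k w <= sig k.+1 w)%E,
        forall w, (fun k => sig k w) @ \oo --> tau w &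
        forall k w, (0 < tau w)%E -> (sig k w < tau w)%E ].

Definition martingale {R : realType} {dO} {Om : measurableType dO}
  (T : R) (F : R -> set (set Om)) (P : probability Om R) (X : R -> Om -> \bar R) : Prop :=
  [/\ adapted T F X,
      forall t, 0 <= t <= T -> P.-integrable setT (X t) &
      forall s t, 0 <= s -> s <= t -> t <= T -> forall A, F s A ->
        (\int[P]_(x in A) X t x = \int[P]_(x in A) X s x)%E ].

(* the time  t /\ tau(w)  (tau >= 0) *)
Definition tmin {R : realType} {Om : Type} (tau : Om -> \bar R) (w : Om) (t : R) : R :=
  if tau w is r%:E then Num.min r t else t.

Definition stopped {R : realType} {Om : Type} (tau : Om -> \bar R)
  (X : R -> Om -> \bar R) : R -> Om -> \bar R :=
  fun t w => X (tmin tau w t) w.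

Definition local_martingale {R : realType} {dO} {Om : measurableType dO}
  (T : R) (F : R -> set (set Om)) (P : probability Om R) (X : R -> Om -> \bar R) : Prop :=
  exists tau : nat -> Om -> \bar R,
    [/\ forall k, stopping_time T F (tau k),
        forall k w, (tau k w <= tau k.+1 w)%E,
        {ae P, forall w, (fun k => tau k w) @ \oo --> +oo%E} &
        forall k, martingale T F P (stopped (tau k) X) ].

Definition prod_defined {R : realType} (x y : \bar R) : Prop :=
  ~ (x = 0%E /\ y = +oo%E) /\ ~ (x = +oo%E /\ y = 0%E).

Definition exchange_matrix {R : realType} {d : nat} (s : 'I_d -> 'I_d -> \bar R) : Prop :=
  [/\ forall i j, (0 <= s i j)%E,
      forall i, s i i = 1%E &
      forall i j k, prod_defined (s i j) (s j k) -> (s i j * s j k)%E = s i k ].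

Definition row_sum {R : realType} {d : nat} (s : 'I_d -> 'I_d -> \bar R) (i : 'I_d) : \bar R :=
  (\sum_(j < d) s i j)%E.

Definition active {R : realType} {d : nat} (s : 'I_d -> 'I_d -> \bar R) (i : 'I_d) : Prop :=
  (row_sum s i < +oo)%E.

Definition basket {R : realType} {d : nat} (s : 'I_d -> 'I_d -> \bar R) (i : 'I_d) : \bar R :=
  if row_sum s i is r%:E then (r^-1)%:E else 0%E.

Definition exchange_process {R : realType} {dO} {Om : measurableType dO} {d : nat}
  (T : R) (F : R -> set (set Om)) (S : R -> Om -> 'I_d -> 'I_d -> \bar R) : Prop :=
  [/\ forall i j, adapted T F (fun t w => S t w i j),
      forall i j w t, 0 <= t < T -> (fun u => S u w i j) @ t^'+ --> S t w i j,
      forall t w, 0 <= t <= T -> exchange_matrix (S t w) &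
      forall w i, active (S 0 w) i ].

Definition Qseq {R : realType} {dO} {Om : measurableType dO} {d : nat}
  (Q : 'I_d -> probability Om R) : {measure set Om -> \bar R}^nat :=
  fun k => match insub k with
           | Some i => (Q i : {measure set Om -> \bar R})
           | None => (@mzero _ Om R : {measure set Om -> \bar R}) end.

Definition Qsum {R : realType} {dO} {Om : measurableType dO} {d : nat}
  (Q : 'I_d -> probability Om R) : {measure set Om -> \bar R} :=
  msum (Qseq Q) d.

Definition inv_nat_nng {R : realType} (d : nat) : {nonneg R} :=
  @NngNum _ (d%:R^-1) (ltac:(by rewrite invr_ge0 ler0n)).

Definition Pmix {R : realType} {dO} {Om : measurableType dO} {d : nat}
  (Q : 'I_d -> probability Om R) : {measure set Om -> \bar R} :=
  mscale (@inv_nat_nng R d) (Qsum Q).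

Definition equiv_measures {R : realType} {dO} {Om : measurableType dO}
  (mu nu : set Om -> \bar R) : Prop :=
  forall A, measurable A -> (mu A = 0%E <-> nu A = 0%E).

Definition cond_prob {R : realType} {dO} {Om : measurableType dO}
  (mu : {measure set Om -> \bar R}) (G : set (set Om)) (C : set Om)
  (g : Om -> \bar R) : Prop :=
  [/\ forall B : set (\bar R), measurable B -> G (g @^-1` B),
      mu.-integrable setT g &
      forall A, G A -> (\int[mu]_(x in A) g x = mu (A `&` C))%E ].

(* S evaluated at the (finite) time tau(w), with S(t) := S(T) for t >= T *)
Definition S_at {R : realType} {Om : Type} {d : nat} (T : R)
  (S : R -> Om -> 'I_d -> 'I_d -> \bar R) (tau : Om -> \bar R) (w : Om) :=
  S (Num.min (fine (tau w)) T) w.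

Definition NOD {R : realType} {dO} {Om : measurableType dO} {d : nat}
  (T : R) (F : R -> set (set Om)) (S : R -> Om -> 'I_d -> 'I_d -> \bar R)
  (P : {measure set Om -> \bar R}) : Prop :=
  forall (i : 'I_d) (tau : Om -> \bar R), stopping_time T F tau ->
  forall g : Om -> \bar R,
    cond_prob P (F_at T F tau) [set w | active (S T w) i] g ->
    {ae P, forall w, (tau w < +oo)%E -> active (S_at T S tau w) i -> (0 < g w)%E}.

Definition left_row_sum_le {R : realType} {Om : Type} {d : nat}
  (S : R -> Om -> 'I_d -> 'I_d -> \bar R) (w : Om) (i : 'I_d) (t : R) (c : R) : Prop :=
  0 < t /\ exists l : 'I_d -> \bar R,
    (forall j, (fun u => S u w i j) @ t^'- --> l j) /\ (\sum_(j < d) l j <= c%:E)%E.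

Definition condition_a {R : realType} {dO} {Om : measurableType dO} {d : nat}
  (T : R) (F : R -> set (set Om)) (S : R -> Om -> 'I_d -> 'I_d -> \bar R)
  (Q : 'I_d -> probability Om R) : Prop :=
  forall i j : 'I_d, martingale T F (Q i) (fun t w => S t w i j).

Definition condition_b {R : realType} {dO} {Om : measurableType dO} {d : nat}
  (T : R) (F : R -> set (set Om)) (S : R -> Om -> 'I_d -> 'I_d -> \bar R)
  (Q : 'I_d -> probability Om R) : Prop :=
  [/\ (* (i) *) forall i j : 'I_d, local_martingale T F (Q i) (fun t w => S t w i j),
      (* (ii) *) NOD T F S (Pmix Q),
      (* (iii) *) forall i : 'I_d, forall A, measurable A ->
         (Q i (A `&` [set w | active (S T w) i]) = 0%E <->
          Qsum Q (A `&` [set w | active (S T w) i]) = 0%E) &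
      (* (iv) *) exists (eps : R) (N : nat) (Tn : nat -> Om -> \bar R),
         [/\ 0 < eps,
             forall n, (n < N)%N -> predictable_time T F (Tn n) &
             {ae Pmix Q, forall w, forall t : R, 0 <= t <= T ->
                (exists i : 'I_d, row_sum (S t w) i = +oo%E /\
                    left_row_sum_le S w i t (d%:R + eps)) ->
                exists2 n, (n < N)%N & Tn n w = t%:E}] ].

Definition valuation_measure {R : realType} {dO} {Om : measurableType dO} {d : nat}
  (T : R) (F : R -> set (set Om)) (S : R -> Om -> 'I_d -> 'I_d -> \bar R)
  (Qb : probability Om R) : Prop :=
  forall i : 'I_d, martingale T F Qb (fun t w => basket (S t w) i).

(* Main.v *)
Require Import Defs.
From HB Require Import structures.
From mathcomp Require Import all_boot all_order all_algebra.
From mathcomp Require Import all_classical all_reals all_analysis measurable_realfun.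
From mathcomp Require Import ring lra.
Import Order.TTheory GRing.Theory Num.Theory.
Import numFieldNormedType.Exports.
Local Open Scope classical_set_scope.
Local Open Scope ring_scope.
Set Implicit Arguments. Unset Strict Implicit. Unset Printing Implicit Defensive.

(** In case (a), the probabilities with densities [Y_i(T) / Y_i(0)] with respect to [Q_i], where
[Y_i] is the [i]-th row sum, make the basket prices [Z_k] martingales because [Z_k Y_i = S_(i,k)];
martingale measures are stable under mixtures, so their average is the required measure.

In case (b), mixtures also reduce equivalence to the following: for every [i] and every integer [m],
find a martingale measure, absolutely continuous with respect to the sum of the [Q_j], which charges
every part, not null for [Q_i], of the event that [Y_i] stays below [m].  Start with currency [i] and the density
[Y_i / Y_i(0)] with respect to [Q_i], up to the first passage of [Y_i] above [m].  From then on,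
whenever the current row sum has exceeded its threshold, switch to the strongest currency [j], for
which [Y_j <= d], and use it until [Y_j] exceeds [2d].  By NOD and (iii), all the measures are
absolutely continuous with respect to [Q_j] on the events of the switching time where [j] is active,
so that the pieces can be pasted together.  Stopped at its passage time, a nonnegative local
martingale is a true martingale, so each pasting preserves the martingale property of the [Z_k].
Each switch costs a fixed amount of quadratic variation of the bounded martingales [Z_k], so the mass
on which infinitely many switches occur vanishes and the limit is a probability. *)

(** * Densities and sub-sigma-algebras *)

(** The obstacle in case (b) is that [Y_i] is only a local martingale under [Q_i]: used as a density
    up to time [T] it may lose mass. Switching replaces it in time by a currency that is still
    strong, and the mass must then be shown not to disappear through infinitely many switches. Two
    facts about prices carry this. First, the [Z_k] sum to 1, so an identity valid for every [Z_k]
    also controls total mass; each pasting therefore yields a probability again and agrees with its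
    predecessor on the past of the switching time. Second, the sum of the [Z_k^2] is at most 1 and
    its expectation grows by at least [(1/(2d))^2] times the mass that switches again, because [Z_j]
    falls from at least [1/d] to at most [1/(2d)]. After [n] switches the mass not yet at [T] is at
    most [4d^2/n]. The overshoot of [Y_j] at its passage time is not bounded, so optional stopping
    combines the bound before passage with monotone convergence at passage. Martingale properties
    are kept as equalities of integrals at stopping times, with weights measurable at the earlier
    time, because the reference measure changes at each step. *)

Section density.
Context {R : realType} {d} {Om : measurableType d}.
Local Open Scope ereal_scope.
Implicit Types (mu nu : {measure set Om -> \bar R}) (f g h : Om -> \bar R).

(** When [c] is infinite, multiplication by [c] is discontinuous at 0, and monotonicity repairs
    this: either all terms vanish, or some term is positive and the products are [+oo] from there
    on. *)
Lemma cvgeMr_nondecreasing (a : nat -> \bar R) (l c : \bar R) :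
  (forall n, 0 <= a n) -> {homo a : m n / (m <= n)%N >-> m <= n} ->
  a @ \oo --> l -> 0 <= c -> (fun n => a n * c) @ \oo --> l * c.
Proof.
move=> a0 ndm al c0.
have [cfin|] := boolP (c \is a fin_num); first exact: cvgeZr.
rewrite ge0_fin_numE// -leNgt leye_eq => /eqP ->.
have al' n : a n <= l.
  have := ereal_nondecreasing_cvgn ndm; move=> /cvg_lim lE.
  rewrite -(cvg_lim (@ereal_hausdorff _) al) lE//.
  by apply: ereal_sup_ubound; exists n.
have l0 : 0 <= l by apply: le_trans (al' 0%N).
have [/eqP le0|ln0] := boolP (l == 0).
  rewrite le0 mul0e; apply: cvg_near_cst; apply: nearW => n.
  have -> : a n = 0 by apply/eqP; rewrite eq_le a0 -le0 al'.
  by rewrite mul0e.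
have lp : 0 < l by rewrite lt_neqAle eq_sym ln0.
have [n an] : exists n, 0 < a n.
  apply: contrapT => /forallNP an0.
  have a00 n : a n = 0 by apply/eqP; rewrite eq_le a0 andbT leNgt; apply/negP.
  have : a @ \oo --> (0 : \bar R) by apply: cvg_near_cst; apply: nearW => n; rewrite a00.
  by move=> /cvg_lim => /(_ (@ereal_hausdorff _)); rewrite (cvg_lim _ al)// => e; rewrite e ltxx in lp.
rewrite gt0_muley//; apply: cvg_near_cst; exists n => // m /= nm.
by rewrite gt0_muley// (lt_le_trans an)// ndm.
Qed.

Import HBNNSimple.

(** The density may take the value [+oo], as row totals do, so the change of variables is proved for
    simple functions and extended by monotone convergence. *)
Lemma density_measure_exists mu h : measurable_fun setT h -> (forall x, 0 <= h x) ->
  exists nu, (forall A, nu A = \int[mu]_(x in A) h x) /\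
   (forall f, measurable_fun setT f -> (forall x, 0 <= f x) ->
      \int[nu]_x f x = \int[mu]_x (f x * h x)).
Proof.
move=> mh h0.
pose nu0 (A : set Om) := \int[mu]_(x in A) h x.
have nu00 : nu0 set0 = 0 by rewrite /nu0 integral_set0.
have nu0_ge0 A : 0 <= nu0 A by apply: integral_ge0.
have snu : semi_sigma_additive nu0 by exact: semi_sigma_additive_nng_induced.
pose M := isMeasure.Build _ _ _ nu0 nu00 nu0_ge0 snu.
pose nu : {measure set Om -> \bar R} := HB.pack nu0 M.
exists nu; split => // f mf f0.
pose k := nnsfun_approx (@measurableT _ Om) mf.
have fE x : (fun n => (k n x)%:E) @ \oo --> f x.
  by apply: cvg_nnsfun_approx.
have kh (n : nat) (x : Om) : 0 <= (k n x)%:E by rewrite lee_fin.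
have knd x : {homo (fun n => (k n x)%:E) : m n / (m <= n)%N >-> m <= n}.
  by move=> a b ab; rewrite lee_fin; exact/lefP/nd_nnsfun_approx.
have mk n : measurable_fun setT (fun x => (k n x)%:E).
  by apply/measurable_EFinP; exact/measurable_funP.
have -> : \int[nu]_x f x = limn (fun n => \int[nu]_x (k n x)%:E).
  rewrite -monotone_convergence//.
  by apply: eq_integral => x _; apply/esym/cvg_lim.
have -> : \int[mu]_x (f x * h x) = limn (fun n => \int[mu]_x ((k n x)%:E * h x)).
  rewrite -monotone_convergence//.
  - apply: eq_integral => x _; apply/esym/cvg_lim => //.
    exact: cvgeMr_nondecreasing.
  - by move=> n; apply: emeasurable_funM.
  - by move=> n x _; apply: mule_ge0.
  - by move=> x _ a b ab; apply: lee_wpmul2r => //; exact: knd.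
congr (limn _); apply/funext => n.
under eq_integral do rewrite fimfunE -fsumEFin//.
under [RHS]eq_integral => x _.
  rewrite fimfunE -fsumEFin// ge0_mule_fsuml; last by move=> y; exact: nnfun_muleindic_ge0.
  over.
rewrite ge0_integral_fsum//; last 2 first.
- by move=> y; apply/measurable_EFinP; exact: measurable_funM.
- by move=> y x _; exact: nnfun_muleindic_ge0.
rewrite ge0_integral_fsum//; last 2 first.
- by move=> y; apply: emeasurable_funM => //; apply/measurable_EFinP; exact: measurable_funM.
- by move=> y x _; apply: mule_ge0 => //; exact: nnfun_muleindic_ge0.
apply: eq_fsbigr => r; rewrite inE => -[t _ rE].
have r0 : (0 <= r)%R by rewrite -rE.
rewrite (integralZl_indic _ (fun r => k n @^-1` [set r]))//; last first.
  by move=> rneg; move: r0; rewrite leNgt rneg.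
rewrite integral_indic// setIT.
under [RHS]eq_integral do rewrite EFinM -muleA.
rewrite ge0_integralZl//; last 2 first.
- by apply: emeasurable_funM => //; exact/measurable_EFinP.
- by move=> x _; apply: mule_ge0; rewrite ?lee_fin.
congr (_ * _).
rewrite /= /nu0 integral_mkcond; apply: eq_integral => x _.
by rewrite epatch_indic muleC.
Qed.

End density.

Section finite_measures.
Context {R : realType} {d} {Om : measurableType d} (mu : {measure set Om -> \bar R}).
Local Open Scope ereal_scope.

(** The proof is an argument of the alias so that the structure instances below can be attached to
    it. *)
Definition as_finite (fmu : fin_num_fun mu) : set Om -> \bar R := mu.

Definition as_probability (muT : mu setT = 1) : set Om -> \bar R := mu.

Section instances.
Variables (fmu : fin_num_fun mu) (muT : mu setT = 1).
HB.instance Definition _ := Measure.copy (as_finite fmu) mu.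
HB.instance Definition _ := Measure_isFinite.Build _ _ _ (as_finite fmu) fmu.
HB.instance Definition _ := Measure.copy (as_probability muT) mu.
HB.instance Definition _ := Measure_isProbability.Build _ _ _ (as_probability muT) muT.
End instances.

Lemma finite_measureP : fin_num_fun mu ->
  exists nu : {finite_measure set Om -> \bar R}, forall A, nu A = mu A.
Proof. by move=> fmu; exists (as_finite fmu). Qed.

Lemma probabilityP : mu setT = 1 ->
  exists P : probability Om R, forall A, P A = mu A.
Proof. by move=> muT; exists (as_probability muT). Qed.

End finite_measures.

(** * Restriction of measures to a sub-sigma-algebra *)

Section sub_sigma_algebra.
Context {R : realType} {d} {Om : measurableType d}.
Local Open Scope ereal_scope.
Implicit Types (mu nu : {measure set Om -> \bar R}) (f g h : Om -> \bar R).
Implicit Types (G H : set (set Om)).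

(** Stated for a bare family of sets, in the same form as in [adapted] and [cond_prob]; [gmeasE]
    gives access to the measurability of the library. *)
Definition gmeas G f := forall B : set (\bar R), measurable B -> G (f @^-1` B).

Definition sub_algebra G := sigma_algebra setT G /\ G `<=` measurable.

Lemma gmeasE G f : sigma_algebra setT G ->
  gmeas G f <-> measurable_fun setT (f : g_sigma_algebraType G -> \bar R).
Proof.
move=> sG; split => [gf _ B mB|mf B mB].
  by rewrite setTI /measurable /= sigma_algebra_id//; exact: gf.
have := mf measurableT B mB; rewrite setTI /measurable /= sigma_algebra_id//.
Qed.

Lemma gmeasW G f : G `<=` measurable -> gmeas G f -> measurable_fun setT f.
Proof. by move=> sG gf _ B mB; rewrite setTI; apply: sG; exact: gf. Qed.

Lemma gmeas_sub G H f : G `<=` H -> gmeas G f -> gmeas H f.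
Proof. by move=> GH gf B mB; apply: GH; exact: gf. Qed.

(** The identity, retyped: the restriction of a measure to [G] is its pushforward along this map. *)
Definition toG G (x : Om) : g_sigma_algebraType G := x.

Lemma measurable_toG G : sub_algebra G -> measurable_fun setT (toG G).
Proof.
move=> [sG GM] _ B; rewrite setTI /measurable /= sigma_algebra_id// => GB.
exact: GM.
Qed.

Lemma restrict_measure_exists G mu : sub_algebra G ->
  exists m : {measure set (g_sigma_algebraType G) -> \bar R},
    (forall A, m A = mu A) /\
    (forall f, gmeas G f -> (forall x, 0 <= f x) -> \int[m]_x f x = \int[mu]_x f x).
Proof.
move=> sG; have [sG1 sG2] := sG; have mG := measurable_toG sG.
pose m0 (A : set (g_sigma_algebraType G)) := mu A.
have m00 : m0 set0 = 0 by exact: measure0.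
have m0_ge0 A : 0 <= m0 A by exact: measure_ge0.
have GM (A : set (g_sigma_algebraType G)) : measurable A -> @measurable _ Om A.
  by rewrite {1}/measurable /= sigma_algebra_id// => /sG2.
have snu : semi_sigma_additive m0.
  move=> E mE tE mUE; apply: measure_semi_sigma_additive => //.
  - by move=> n; exact: GM.
  - exact: GM.
pose M := isMeasure.Build _ _ _ m0 m00 m0_ge0 snu.
pose m : {measure set (g_sigma_algebraType G) -> \bar R} := HB.pack m0 M.
exists m; split=> // f gf f0.
rewrite -[RHS](@ge0_integral_pushforward _ _ _ _ _ _ mG mu setT f)//; last exact/gmeasE.
Qed.

(** The measures with densities [g] and [h] coincide on [G], hence integrate [G]-measurable
    functions equally. This takes the place of conditional expectations: an equality tested on
    events becomes one with weights. *)
Lemma integral_gmeas_eq G mu nu f g h : sub_algebra G ->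
  measurable_fun setT g -> measurable_fun setT h ->
  (forall x, 0 <= g x) -> (forall x, 0 <= h x) ->
  (forall A, G A -> \int[mu]_(x in A) g x = \int[nu]_(x in A) h x) ->
  gmeas G f -> (forall x, 0 <= f x) ->
  \int[mu]_x (f x * g x) = \int[nu]_x (f x * h x).
Proof.
move=> sG mg mh g0 h0 gh gf f0; have mf := gmeasW (proj2 sG) gf.
have [m1 [m1E <-//]] := density_measure_exists mu mg g0.
have [m2 [m2E <-//]] := density_measure_exists nu mh h0.
have [p1 [p1E <-//]] := restrict_measure_exists m1 sG.
have [p2 [p2E <-//]] := restrict_measure_exists m2 sG.
apply: eq_measure_integral => A mA _.
rewrite p1E p2E m1E m2E; apply: gh.
by move: mA; rewrite /measurable /= sigma_algebra_id//; case: sG.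
Qed.

(** Domination is asked on [G] only and the density is [G]-measurable: the derivative is taken
    between the restrictions. It supplies both the conditional probability for NOD and the densities
    used in pasting. *)
Lemma radon_nikodym_sub G (mu nu : {measure set Om -> \bar R}) : sub_algebra G ->
  mu setT < +oo -> nu setT < +oo ->
  (forall A, G A -> mu A = 0 -> nu A = 0) ->
  exists h, [/\ gmeas G h, forall x, 0 <= h x &
    forall A, G A -> \int[mu]_(x in A) h x = nu A].
Proof.
move=> sG muoo nuoo dom.
have [m1 [m1E m1i]] := restrict_measure_exists mu sG.
have [m2 [m2E m2i]] := restrict_measure_exists nu sG.
have [|n1 n1E] := @finite_measureP _ _ _ m1.
  by apply: lty_fin_num_fun; rewrite /= m1E.
have [|n2 n2E] := @finite_measureP _ _ _ m2.
  by apply: lty_fin_num_fun; rewrite /= m2E.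
have GE A : @measurable _ (g_sigma_algebraType G) A <-> G A.
  by rewrite /measurable /= sigma_algebra_id//; case: sG.
have n12 : n2 `<< n1.
  apply/null_content_dominatesP => A /GE GA; have := dom A GA; rewrite -m1E -m2E -n1E -n2E; exact.
have [h [h0 hi hE]] := radon_nikodym_finite n12.
have gh : gmeas G h.
  apply/gmeasE; first by case: sG.
  by case/integrableP : hi.
exists h; split => // A GA.
rewrite -m2E -n2E hE; last exact/GE.
rewrite (eq_measure_integral m1); last by move=> *; exact: n1E.
rewrite integral_mkcond [RHS]integral_mkcond -m1i//.
  apply/gmeasE; first by case: sG.
  apply/(measurable_restrictT _ _).1 => //; first exact/GE.
  apply: measurable_funTS; apply/gmeasE => //; by case: sG.
by move=> x; apply: erestrict_ge0.
Qed.

End sub_sigma_algebra.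

(** * Stopping times *)

Section sigma_algebra_ops.
Context {Om : Type} (G : set (set Om)) (sG : sigma_algebra setT G).

Lemma sigma_algebra_setC A : G A -> G (~` A).
Proof. by case: sG => _ GC _ GA; rewrite -setTD; exact: GC. Qed.

Lemma sigma_algebra_setT : G setT.
Proof. by rewrite -setC0; apply: sigma_algebra_setC; case: sG. Qed.

Lemma sigma_algebra_setU A B : G A -> G B -> G (A `|` B).
Proof.
move=> GA GB; rewrite -bigcup2E; case: sG => G0 _; apply => -[|[|n]] //=.
Qed.

Lemma sigma_algebra_setI A B : G A -> G B -> G (A `&` B).
Proof.
move=> GA GB; rewrite -[_ `&` _]setCK setCI; apply: sigma_algebra_setC.
by apply: sigma_algebra_setU; exact: sigma_algebra_setC.
Qed.

Lemma sigma_algebra_setD A B : G A -> G B -> G (A `\` B).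
Proof.
by move=> GA GB; rewrite setDE; apply: sigma_algebra_setI => //; exact: sigma_algebra_setC.
Qed.

Lemma sigma_algebra_bigcup_rat (E : rat -> set Om) :
  (forall q, G (E q)) -> G (\bigcup_q E q).
Proof.
move=> GE.
have -> : \bigcup_q E q = \bigcup_n (if unpickle n is Some q then E q else set0).
  apply/seteqP; split => w.
    by move=> [q _ Eq]; exists (pickle q); [exact: I|rewrite pickleK].
  by move=> [n _]; case: unpickle => // q Eq; exists q.
case: sG => G0 _; apply => n; case: unpickle => // q; exact: GE.
Qed.

Lemma sigma_algebra_bigsetU_ord n (E : 'I_n -> set Om) :
  (forall i, G (E i)) -> G [set w | exists i, E i w].
Proof.
move=> GE.
have -> : [set w | exists i, E i w] = \bigcup_k (if insub k is Some i then E i else set0).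
  apply/seteqP; split => w /=.
    by move=> [i Ei]; exists (val i) => //; rewrite valK.
  by move=> [k _]; case: insub => // i Ei; exists i.
case: sG => G0 _; apply => k; case: insub => // i; exact: GE.
Qed.

End sigma_algebra_ops.

Section stopping.
Context {R : realType} {dO} {Om : measurableType dO} (T : R) (F : R -> set (set Om)).
Hypotheses (T0 : 0 < T) (HF : filtration T F) (HR : right_continuous_filtration T F).
Implicit Types (sigma tau rho : Om -> R) (X : R -> Om -> \bar R).

(* Real-valued stopping times: the time T plays the role of infinity. *)
Definition real_stopping_time tau :=
  (forall w, 0 <= tau w <= T) /\
  (forall t, 0 <= t < T -> F t [set w | tau w <= t]).

(** At [t = T] the usual condition reduces to [A] in [F T], which is measurability; hence the first
    clause and the strict bound in the second. *)
Definition F_stop tau : set (set Om) :=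
  [set A | measurable A /\ forall t, 0 <= t < T -> F t (A `&` [set w | tau w <= t])].

Definition right_continuous_paths X := forall w t, 0 <= t < T -> X^~ w @ t^'+ --> X t w.

Lemma filtration_sigma_algebra t : 0 <= t <= T -> sigma_algebra setT (F t).
Proof. by case: HF => + _ _; apply. Qed.

Lemma filtration_mono s t : 0 <= s -> s <= t -> t <= T -> F s `<=` F t.
Proof. by case: HF => _ + _; apply. Qed.

Lemma filtration_measurable t : 0 <= t <= T -> F t `<=` measurable.
Proof. by case: HF => _ FF <- /andP[t0 tT]; apply: FF. Qed.

Lemma filtration_sub_algebra t : 0 <= t <= T -> sub_algebra (F t).
Proof.
by move=> tT; split; [exact: filtration_sigma_algebra|exact: filtration_measurable].
Qed.

Lemma F_stop_sub_algebra tau : real_stopping_time tau -> sub_algebra (F_stop tau).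
Proof.
move=> [tau0T Ftau]; split; last by move=> A [].
split.
- split=> // t tT; rewrite set0I; have tT' : 0 <= t <= T by case/andP: tT => -> /ltW ->.
  by case: (filtration_sigma_algebra tT').
- move=> A [mA FA]; split; first by rewrite setTD; exact: measurableC.
  move=> t tT; have tT' : 0 <= t <= T by case/andP: tT => -> /ltW ->.
  have -> : (setT `\` A) `&` [set w | tau w <= t] =
     [set w | tau w <= t] `\` (A `&` [set w | tau w <= t]).
    apply/seteqP; split => w /=; first by move=> [[_ Aw] tw]; split=> // -[].
    by move=> [tw Aw]; split=> //; split=> // ?; apply: Aw.
  by apply: (sigma_algebra_setD (filtration_sigma_algebra tT')); [exact: Ftau|exact: FA].
- move=> A FA; split; first by apply: bigcup_measurable => n _; case: (FA n).
  move=> t tT; have tT' : 0 <= t <= T by case/andP: tT => -> /ltW ->.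
  rewrite setI_bigcupl; case: (filtration_sigma_algebra tT') => _ _; apply => n.
  by case: (FA n) => _; apply.
Qed.

Lemma real_stopping_time_cst s : 0 <= s <= T -> real_stopping_time (cst s).
Proof.
move=> sT; split => // t tT; have tT' : 0 <= t <= T by case/andP: tT => -> /ltW ->.
have st := filtration_sigma_algebra tT'.
case: (leP s t) => ts.
  by rewrite (_ : [set _ | _] = setT); [exact: sigma_algebra_setT|apply/seteqP; split].
by rewrite (_ : [set _ | _] = set0); [case: st|apply/seteqP; split].
Qed.

Lemma real_stopping_time_min sigma tau : real_stopping_time sigma ->
  real_stopping_time tau -> real_stopping_time (fun w => Num.min (sigma w) (tau w)).
Proof.
move=> [s0T Fs] [t0T Ft]; split.
  move=> w; case/andP: (s0T w) => s0 sT; case/andP: (t0T w) => t0 tT.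
  by rewrite le_min s0 t0 ge_min sT.
move=> t tT; have tT' : 0 <= t <= T by case/andP: tT => -> /ltW ->.
have -> : [set w | Num.min (sigma w) (tau w) <= t] =
  [set w | sigma w <= t] `|` [set w | tau w <= t].
  by apply/seteqP; split => w /=; rewrite ge_min => /orP.
apply: (sigma_algebra_setU (filtration_sigma_algebra tT')); [exact: Fs|exact: Ft].
Qed.

Lemma real_stopping_time_max sigma tau : real_stopping_time sigma ->
  real_stopping_time tau -> real_stopping_time (fun w => Num.max (sigma w) (tau w)).
Proof.
move=> [s0T Fs] [t0T Ft]; split.
  move=> w; case/andP: (s0T w) => s0 sT; case/andP: (t0T w) => t0 tT.
  by rewrite le_max s0 ge_max sT.
move=> t tT; have tT' : 0 <= t <= T by case/andP: tT => -> /ltW ->.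
have -> : [set w | Num.max (sigma w) (tau w) <= t] =
  [set w | sigma w <= t] `&` [set w | tau w <= t].
  by apply/seteqP; split => w /=; rewrite ge_max => /andP.
apply: (sigma_algebra_setI (filtration_sigma_algebra tT')); [exact: Fs|exact: Ft].
Qed.

Lemma F_stop_mono sigma tau : real_stopping_time tau ->
  (forall w, sigma w <= tau w) -> F_stop sigma `<=` F_stop tau.
Proof.
move=> [_ Ft] st A [mA FA]; split => // t tT.
have tT' : 0 <= t <= T by case/andP: tT => -> /ltW ->.
have -> : A `&` [set w | tau w <= t] =
    (A `&` [set w | sigma w <= t]) `&` [set w | tau w <= t].
  apply/seteqP; split => w /= [].
    by move=> Aw tw; split=> //; split=> //; exact: le_trans (st w) tw.
  by move=> [].
apply: (sigma_algebra_setI (filtration_sigma_algebra tT')); [exact: FA|exact: Ft].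
Qed.

(** Inside [sigma <= t], the complement is the event [tau < sigma], and this is a union over
    rationals [q <= t] of the events [tau <= q < sigma]. The value [t = T] is included to obtain
    plain measurability as well. *)
Lemma le_stop_aux sigma tau t : real_stopping_time sigma -> real_stopping_time tau ->
  0 <= t <= T -> F t ([set w | sigma w <= tau w] `&` [set w | sigma w <= t]).
Proof.
move=> [s0T Fs] [t0T Ft] tT; have st := filtration_sigma_algebra tT.
have TT : 0 <= T <= T by rewrite lexx ltW.
have Fs' u : 0 <= u <= T -> F u [set w | sigma w <= u].
  move=> /andP[u0]; rewrite le_eqVlt => /orP[/eqP ->|uT]; last by apply: Fs; rewrite u0.
  rewrite (_ : [set _ | _] = setT).
    exact: sigma_algebra_setT (filtration_sigma_algebra TT).
  by apply/seteqP; split => // w _ /=; case/andP: (s0T w).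
have Ft' u : 0 <= u <= T -> F u [set w | tau w <= u].
  move=> /andP[u0]; rewrite le_eqVlt => /orP[/eqP ->|uT]; last by apply: Ft; rewrite u0.
  rewrite (_ : [set _ | _] = setT).
    exact: sigma_algebra_setT (filtration_sigma_algebra TT).
  by apply/seteqP; split => // w _ /=; case/andP: (t0T w).
have -> : [set w | sigma w <= tau w] `&` [set w | sigma w <= t] =
  [set w | sigma w <= t] `\` \bigcup_(q : rat) (if (0 <= (ratr q : R) <= t) then
     [set w | tau w <= ratr q] `\` [set w | sigma w <= ratr q] else set0).
  apply/seteqP; split => w /=.
    move=> [stw stt]; split => // -[q _]; case: ifP => // _ /= [tq sq]; apply: sq.
    exact: le_trans stw tq.
  move=> [swt nq]; split => //; rewrite leNgt; apply/negP => ts.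
  have [q /[!in_itv]/= /andP[q1 q2]] := rat_in_itvoo ts.
  apply: nq; exists q; first by [].
  rewrite ifT; last first.
    rewrite (le_trans _ (ltW q1)); last by case/andP: (t0T w).
    by rewrite (le_trans (ltW q2)).
  by split; [exact: ltW|apply/negP; rewrite -ltNge].
case/andP: (tT) => t0 tleT.
apply: sigma_algebra_setD => //; first exact: Fs'.
apply: sigma_algebra_bigcup_rat => // q; case: ifP => [/andP[q0 qt]|_]; last by case: st.
apply: (filtration_mono q0 qt) => //.
have qT : 0 <= (ratr q : R) <= T by rewrite q0 (le_trans qt).
apply: (sigma_algebra_setD (filtration_sigma_algebra qT)); [exact: Ft'|exact: Fs'].
Qed.

Lemma real_stopping_time_measurable_le sigma tau : real_stopping_time sigma ->
  real_stopping_time tau -> measurable [set w | sigma w <= tau w].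
Proof.
move=> Hs Ht; have TT : 0 <= T <= T by rewrite lexx ltW.
have := le_stop_aux Hs Ht TT; rewrite (_ : [set w | sigma w <= T] = setT) ?setIT.
  exact: filtration_measurable.
by apply/seteqP; split => // w _ /=; case: Hs => /(_ w) /andP[].
Qed.

Lemma F_stop_le sigma tau : real_stopping_time sigma -> real_stopping_time tau ->
  F_stop sigma [set w | sigma w <= tau w].
Proof.
move=> Hs Ht; split; first exact: real_stopping_time_measurable_le.
by move=> t /andP[t0 tT]; apply: le_stop_aux => //; rewrite t0 ltW.
Qed.

Lemma F_stop_setI_le sigma tau A : real_stopping_time sigma -> real_stopping_time tau ->
  F_stop sigma A ->
  F_stop (fun w => Num.min (sigma w) (tau w)) (A `&` [set w | sigma w <= tau w]).
Proof.
move=> Hs Ht FA; have [mA FA'] := FA.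
have [sa _] := F_stop_sub_algebra Hs.
have [mB FB] := sigma_algebra_setI sa FA (F_stop_le Hs Ht).
split => // t tT.
have -> : A `&` [set w | sigma w <= tau w] `&` [set w | Num.min (sigma w) (tau w) <= t] =
    (A `&` [set w | sigma w <= tau w]) `&` [set w | sigma w <= t].
  by apply/seteqP; split => w /= [[Aw st]]; rewrite min_l.
exact: FB.
Qed.

(** For [t < T] the trace on [tau <= t] is empty. So once a path has reached [T], its whole future
    belongs to the past of [tau]; this makes the limit of the switching measures consistent. *)
Lemma F_stop_eqT tau A : real_stopping_time tau -> measurable A ->
  F_stop tau (A `&` [set w | tau w = T]).
Proof.
move=> Ht mA.
have -> : [set w | tau w = T] = [set w | (cst T) w <= tau w].
  apply/seteqP; split => w /=; first by move=> ->.
  by move=> Tt; apply/eqP; rewrite eq_le Tt; case: Ht => /(_ w)/andP[_ ->].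
split.
  apply: measurableI => //; apply: real_stopping_time_measurable_le => //.
  by apply: real_stopping_time_cst; rewrite lexx ltW.
move=> t /andP[t0 tT]; rewrite (_ : _ `&` _ `&` _ = set0).
  by case: (@filtration_sigma_algebra t) => //; rewrite t0 ltW.
apply/seteqP; split => // w /= [[_ Tt] tt].
by move: tT; rewrite ltNge (le_trans Tt tt).
Qed.

Lemma F_stop_setI_lt sigma A q : real_stopping_time sigma -> F_stop sigma A -> 0 <= q ->
  F (Num.min T q) (A `&` [set w | sigma w < q]).
Proof.
move=> [s0T Fs] [mA FA] q0; case: (ltP T q) => Tq.
  rewrite (_ : [set w | _] = setT) ?setIT.
    by case: HF => _ _ ->.
  by apply/seteqP; split => // w _ /=; rewrite (le_lt_trans _ Tq)//; case/andP: (s0T w).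
rewrite (_ : A `&` _ = \bigcup_n (if 0 <= q - n.+1%:R^-1 :> R then
    A `&` [set w | sigma w <= q - n.+1%:R^-1] else set0)).
  have qT : 0 <= q <= T by rewrite q0.
  case: (filtration_sigma_algebra qT) => G0 _; apply => n; case: ifP => // qn0.
  have n0 : 0 < n.+1%:R^-1 :> R by rewrite invr_gt0.
  have qq : q - n.+1%:R^-1 < q by rewrite ltrBlDr ltrDl.
  apply: (filtration_mono qn0 (ltW qq) Tq).
  by apply: FA; rewrite qn0 (lt_le_trans qq).
apply/seteqP; split => w /=.
  move=> [Aw sq].
  have [k kq] := ltr_add_invr sq; exists k => //.
  have sqk : sigma w <= q - k.+1%:R^-1 by rewrite lerBrDr ltW.
  by rewrite ifT//; apply: le_trans sqk; case/andP: (s0T w).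
move=> [n _]; case: ifP => // _ [Aw sq]; split => //; apply: le_lt_trans sq _.
by rewrite ltrBlDr ltrDl invr_gt0.
Qed.

(** Cells of mesh [1/(m+1)] are closed on the left, so their right end, capped at [T], lies strictly
    after [sigma] whenever [sigma < T]. Right limits along [t^'+] only see strictly later times. *)
Definition stop_cell sigma (m k : nat) : set Om :=
  [set w | k%:R / m.+1%:R <= sigma w] `&` [set w | sigma w < k.+1%:R / m.+1%:R].

Definition stop_grid (m k : nat) : R := Num.min T (k.+1%:R / m.+1%:R).

Definition stop_index sigma (m : nat) (w : Om) : nat := Num.truncn (sigma w * m.+1%:R).

Definition stop_approx sigma (m : nat) (w : Om) : R := stop_grid m (stop_index sigma m w).

Lemma stop_grid_itv m k : 0 <= stop_grid m k <= T.
Proof. by rewrite /stop_grid le_min ge_min lexx (ltW T0)/= divr_ge0. Qed.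

Lemma stop_cellP sigma m k w : 0 <= sigma w ->
  stop_cell sigma m k w <-> stop_index sigma m w = k.
Proof.
move=> s0; have m0 : 0 < m.+1%:R :> R by rewrite ltr0n.
rewrite /stop_cell /stop_index /= ler_pdivrMr// ltr_pdivlMr//.
split => [[k1 k2]|<-].
  by apply: truncn_def; rewrite k1 k2.
by have /andP[] := truncn_itv (mulr_ge0 s0 (ltW m0)).
Qed.

Lemma F_stop_setI_cell sigma A m k : real_stopping_time sigma -> F_stop sigma A ->
  F (stop_grid m k) (A `&` stop_cell sigma m k).
Proof.
move=> Hs FA; have k0 j : 0 <= j%:R / m.+1%:R :> R by rewrite divr_ge0.
have kk : k%:R / m.+1%:R <= k.+1%:R / m.+1%:R :> R by rewrite ler_pM2r ?invr_gt0// ler_nat.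
have -> : A `&` stop_cell sigma m k = (A `&` [set w | sigma w < k.+1%:R / m.+1%:R]) `\`
   (A `&` [set w | sigma w < k%:R / m.+1%:R]).
  apply/seteqP; split => w /=.
    by move=> [Aw [k1 k2]]; split=> // -[_]; rewrite ltNge k1.
  move=> [[Aw k2] k1]; split => //; split => //=.
  by rewrite leNgt; apply/negP => k3; apply: k1.
apply: (sigma_algebra_setD (filtration_sigma_algebra (stop_grid_itv m k))).
  exact: F_stop_setI_lt.
have mm : Num.min T (k%:R / m.+1%:R) <= stop_grid m k.
  by rewrite /stop_grid le_min !ge_min lexx kk/= orbT.
have m0 : 0 <= Num.min T (k%:R / m.+1%:R) by rewrite le_min (ltW T0) k0.
have [_ gT] := andP (stop_grid_itv m k).
by apply: (filtration_mono m0 mm gT); exact: F_stop_setI_lt.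
Qed.

Lemma stop_approx_ge sigma m w : 0 <= sigma w <= T -> sigma w <= stop_approx sigma m w.
Proof.
move=> /andP[s0 sT]; have : stop_cell sigma m (stop_index sigma m w) w by apply/stop_cellP.
by move=> [_ /= h]; rewrite /stop_approx /stop_grid le_min sT ltW.
Qed.

Lemma stop_approx_gt sigma m w : 0 <= sigma w < T -> sigma w < stop_approx sigma m w.
Proof.
move=> /andP[s0 sT]; have : stop_cell sigma m (stop_index sigma m w) w by apply/stop_cellP.
by move=> [_ /= h]; rewrite /stop_approx /stop_grid lt_min sT h.
Qed.

Lemma stop_approx_le sigma m w : 0 <= sigma w ->
  stop_approx sigma m w <= sigma w + m.+1%:R^-1.
Proof.
move=> s0; have : stop_cell sigma m (stop_index sigma m w) w by apply/stop_cellP.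
move=> [/= h _]; rewrite /stop_approx /stop_grid ge_min; apply/orP; right.
by rewrite -natr1 mulrDl mul1r lerD2r.
Qed.

Lemma stop_approx_cvg sigma w : 0 <= sigma w <= T ->
  stop_approx sigma m w @[m --> \oo] --> sigma w.
Proof.
move=> /andP[s0 sT]; apply: (@squeeze_cvgr _ _ _ _ (cst (sigma w)) (fun m => sigma w + m.+1%:R^-1)).
- by apply: nearW => m; rewrite stop_approx_ge ?s0// stop_approx_le.
- exact: cvg_cst.
- rewrite -[X in _ --> X]addr0; apply: cvgD; first exact: cvg_cst.
  exact: cvg_harmonic.
Qed.

Lemma right_continuous_stop_approx X sigma w : right_continuous_paths X -> 0 <= sigma w <= T ->
  X (stop_approx sigma m w) w @[m --> \oo] --> X (sigma w) w.
Proof.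
move=> rX sT; case/andP: (sT) => s0; rewrite le_eqVlt => /orP[/eqP sE|sltT].
  rewrite (_ : (fun m => _) = cst (X (sigma w) w)); first exact: cvg_cst.
  apply/funext => m /=; congr (X _ w).
  apply/eqP; rewrite eq_le stop_approx_ge// andbT sE.
  by case/andP: (stop_grid_itv m (stop_index sigma m w)).
have /rX : 0 <= sigma w < T by rewrite s0.
move=> /(_ w) rXw A /rXw [e /= e0 eA].
have := stop_approx_cvg sT => /cvgrPdist_lt /(_ _ e0) [N _ NA].
exists N => // m /= Nm; apply: eA => /=; first exact: NA.
by apply: stop_approx_gt; rewrite s0.
Qed.

(** The approximations of [sigma] look slightly into the future, and right continuity of the
    filtration absorbs this. *)
Lemma F_stop_gmeas X sigma : adapted T F X -> right_continuous_paths X ->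
  real_stopping_time sigma -> gmeas (F_stop sigma) (fun w => X (sigma w) w).
Proof.
move=> aX rX Hs; have [s0T Fs] := Hs.
(* The event is placed in [F u] for any [u] after [t], leaving room for times rounded up from
   [sigma <= t]. The alternative [u = T] covers [t = T], where the cap of the grid replaces the
   room. *)
have key u t : 0 <= t -> (t < u \/ u = T) -> t <= u <= T ->
   forall B : set (\bar R), measurable B ->
   F u ([set w | sigma w <= t] `&` ((fun w => X (sigma w) w) @^-1` B)).
  move=> t0 tu tuT B mB; have uT : 0 <= u <= T by case/andP: tuT => /(le_trans t0) ->.
  have su := filtration_sigma_algebra uT.
  pose D := [set w | sigma w <= t].
  have FD : F u D.
    have [tT|tT] := ltP t T.
      case/andP: tuT => t1 t2; apply: (filtration_mono t0 t1 t2).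
      by apply: Fs; rewrite t0.
    rewrite /D (_ : [set _ | _] = setT); first exact: sigma_algebra_setT.
    by apply/seteqP; split => // w _ /=; apply: le_trans tT; case/andP: (s0T w).
  have mE A : @measurable _ (g_sigma_algebraType (F u)) A <-> F u A.
    by rewrite /measurable /= sigma_algebra_id.
  have [M HM] : exists M, forall m w, D w -> stop_approx sigma (m + M)%N w <= u.
    case: tu => [tu|->]; last first.
      by exists 0%N => m w _; case/andP: (stop_grid_itv (m + 0) (stop_index sigma (m + 0) w)).
    have [M Mu] := ltr_add_invr tu; exists M => m w /= Dw.
    apply: (le_trans (stop_approx_le _ _)); first by case/andP: (s0T w).
    apply: le_trans (ltW Mu); apply: lerD => //.
    by rewrite lef_pV2 ?posrE// ler_nat ltnS leq_addl.
  have mD : @measurable _ (g_sigma_algebraType (F u)) D by apply/mE.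
  apply/mE.
  pose h m (w : g_sigma_algebraType (F u)) := X (stop_approx sigma (m + M)%N w) w.
  have mh m : measurable_fun (D : set (g_sigma_algebraType (F u))) (h m).
    move=> _ C mC; apply/mE.
    have -> : D `&` h m @^-1` C = \bigcup_k (if stop_grid (m + M) k <= u then
        D `&` stop_cell sigma (m + M) k `&` (X (stop_grid (m + M) k) @^-1` C) else set0).
      apply/seteqP; split => w.
        move=> [Dw hC]; exists (stop_index sigma (m + M) w) => //.
        rewrite ifT; last exact: HM.
        by split => //; split => //; apply/stop_cellP => //; case/andP: (s0T w).
      move=> [k _]; case: ifP => // ku [[Dw /stop_cellP kE] XC].
      split => //; rewrite /h /preimage /= /stop_approx kE//; by case/andP: (s0T w).
    case: su => G0 _; apply => k; case: ifP => // ku.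
    have [g0 gT] := andP (stop_grid_itv (m + M) k).
    have -> : D `&` stop_cell sigma (m + M) k `&` (X (stop_grid (m + M) k) @^-1` C) =
      D `&` ((setT `&` stop_cell sigma (m + M) k) `&` (X (stop_grid (m + M) k) @^-1` C)).
      by rewrite setTI setIA.
    apply: (sigma_algebra_setI (filtration_sigma_algebra uT)) => //.
    apply: (filtration_mono g0 ku); first by case/andP: uT.
    have sg := filtration_sigma_algebra (stop_grid_itv (m + M) k).
    apply: (sigma_algebra_setI sg).
      apply: F_stop_setI_cell => //.
      by apply: sigma_algebra_setT; case: (F_stop_sub_algebra Hs).
    by apply: aX => //; exact: stop_grid_itv.
  have := @emeasurable_fun_cvg _ (g_sigma_algebraType (F u)) R D h
     (fun w => X (sigma w) w) mh.
  move=> /(_ _ mD B mB); apply => w Dw.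
  rewrite /h; have := right_continuous_stop_approx rX (s0T w).
  by rewrite (cvg_shiftn M (fun m => X (stop_approx sigma m w) w)).
move=> B mB; split.
  have := key T T (ltW T0) (or_intror erefl); rewrite lexx => /(_ erefl B mB).
  rewrite (_ : [set w | sigma w <= T] = setT) ?setTI.
    by apply: filtration_measurable; rewrite lexx ltW.
  by apply/seteqP; split => // w _ /=; case/andP: (s0T w).
move=> t tT; rewrite setIC; rewrite HR//= => u /andP[tu uT].
by apply: key => //; [case/andP: tT|left|rewrite uT ltW].
Qed.

(** The point [T] keeps the set nonempty: a path that never hits gets the value [T], which stands
    for infinity. *)
Definition hitting_time rho (H : R -> Om -> Prop) (w : Om) : R :=
  inf ([set T] `|` [set t | rho w <= t < T /\ H t w]).

Section hitting.
Variables (rho : Om -> R) (H : R -> Om -> Prop).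
Hypotheses (Hrho : real_stopping_time rho)
  (FH : forall t, 0 <= t < T -> F t ([set w | rho w <= t] `&` [set w | H t w]))
  (openH : forall t w, rho w <= t < T -> H t w ->
     exists2 u, t < u & forall q, t < q < u -> H q w).
Let tau := hitting_time rho H.
Let E w := [set T] `|` [set t | rho w <= t < T /\ H t w].

Let E_lb w : lbound (E w) (rho w).
Proof.
by move=> x [->|[/andP[]]//]; case: Hrho => /(_ w)/andP[].
Qed.

Let E_inf w : has_inf (E w).
Proof. by split; [exists T; left|exists (rho w); exact: E_lb]. Qed.

Lemma hitting_time_ge w : rho w <= tau w.
Proof. by apply: lb_le_inf; [exists T; left|exact: E_lb]. Qed.

Lemma hitting_time_leT w : tau w <= T.
Proof. by apply: ge_inf; [exists (rho w); exact: E_lb|left]. Qed.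

Lemma hitting_time_notin w t : rho w <= t < tau w -> ~ H t w.
Proof.
move=> /andP[rt tt] Ht; move: tt; rewrite ltNge => /negP; apply.
have [tT|Tt] := ltP t T; last exact: le_trans (hitting_time_leT w) Tt.
by apply: ge_inf; [exists (rho w); exact: E_lb|right; split; rewrite ?rt].
Qed.

Lemma hitting_time_near w u : tau w < u -> tau w < T ->
  exists2 t, tau w <= t < u & H t w.
Proof.
move=> tu tT; have m : tau w < Num.min u T by rewrite lt_min tu.
have := inf_lt (proj1 (E_inf w)) m.
move=> [x Ex]; rewrite lt_min => /andP[xu xT].
case: Ex => [xE|[/andP[rx _] Hx]]; first by rewrite xE ltxx in xT.
exists x => //; rewrite xu andbT; apply: ge_inf; first by case: (E_inf w).
by right; split; rewrite ?rx.
Qed.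

(** By [openH] a hit lasts on an interval to its right, hence occurs at a rational time, and
    [tau < v] is a countable union. Right continuity of the filtration passes from [<] to [<=]. *)
Lemma hitting_time_stop : real_stopping_time tau.
Proof.
have r0T w : 0 <= rho w <= T by case: Hrho.
split=> [w|t tT].
  by rewrite hitting_time_leT andbT (le_trans _ (hitting_time_ge w))//; case/andP: (r0T w).
rewrite HR//= => u /andP[tu uT].
have u0 : 0 <= u <= T by rewrite uT andbT (le_trans _ (ltW tu))//; case/andP: tT.
have su := filtration_sigma_algebra u0.
have key v : t < v -> v <= u -> F u [set w | tau w < v].
  move=> tv vu.
  have -> : [set w | tau w < v] = \bigcup_(q : rat) (if (0 <= (ratr q : R) < v) then
     [set w | rho w <= ratr q] `&` [set w | H (ratr q) w] else set0).
    apply/seteqP; split => w /=.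
      move=> tauv; have tauT : tau w < T by rewrite (lt_le_trans tauv)// (le_trans vu).
      have [x /andP[taux xv] Hx] := hitting_time_near tauv tauT.
      have rx : rho w <= x < T.
        by rewrite (le_trans (hitting_time_ge w))//= (lt_le_trans xv)// (le_trans vu).
      have [y xy Hy] := openH rx Hx.
      have m : x < Num.min y v by rewrite lt_min xy.
      have [q /[!in_itv]/= /andP[q1]] := rat_in_itvoo m.
      rewrite lt_min => /andP[qy qv]; exists q => //.
      rewrite ifT; last first.
        rewrite qv andbT (le_trans _ (ltW q1))// (le_trans _ taux)//.
        by rewrite (le_trans _ (hitting_time_ge w))//; case/andP: (r0T w).
      split; last by apply: Hy; rewrite q1.
      by apply: le_trans (ltW q1); case/andP: rx.
    move=> [q _]; case: ifP => // /andP[q0 qv] [/= rq Hq].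
    apply: (le_lt_trans _ qv); apply: ge_inf; first by case: (E_inf w).
    right; split => //=; rewrite rq (lt_le_trans qv)// (le_trans vu)//.
  apply: sigma_algebra_bigcup_rat => // q; case: ifP => [/andP[q0 qv]|_]; last by case: su.
  have qu : ratr q <= u by rewrite (le_trans (ltW qv)).
  by apply: (filtration_mono q0 qu uT); apply: FH; rewrite q0 (lt_le_trans qv)// (le_trans vu).
have -> : [set w | tau w <= t] =
   ~` \bigcup_(q : rat) (if t < (ratr q : R) <= u then ~` [set w | tau w < ratr q] else set0).
  apply/seteqP; split => w /=.
    move=> tt [q _]; case: ifP => // /andP[tq _]; apply => /=; exact: le_lt_trans tq.
  move=> nq; rewrite leNgt; apply/negP => ttau.
  have m : t < Num.min (tau w) u by rewrite lt_min ttau.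
  have [q /[!in_itv]/= /andP[tq]] := rat_in_itvoo m.
  rewrite lt_min => /andP[q1 q2]; apply: nq; exists q => //.
  by rewrite tq (ltW q2) /= => /(lt_trans q1); rewrite ltxx.
apply: (sigma_algebra_setC su); apply: (sigma_algebra_bigcup_rat su) => q.
case: ifP => [/andP[tq qu]|_]; last by case: su.
by apply: (sigma_algebra_setC su); apply: key.
Qed.

End hitting.

Lemma right_continuous_open X w t (U : set (\bar R)) : right_continuous_paths X -> 0 <= t < T ->
  open U -> U (X t w) -> exists2 u, t < u & forall q, t < q < u -> U (X q w).
Proof.
move=> rX tT oU UX; have /(_ U) := rX w t tT.
have nU : nbhs (X t w) U by exact: open_nbhs_nbhs.
move=> /(_ nU) [e /= e0 eH]; exists (t + e); first by rewrite ltrDl.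
move=> q /andP[tq qe]; apply: eH => //=.
by rewrite distrC ger0_norm ?subr_ge0 ?ltW// ltrBlDl.
Qed.

Section first_passage.
Variables (n : nat) (rho : Om -> R) (E : 'I_n -> set Om) (Y : 'I_n -> R -> Om -> \bar R)
  (c : \bar R).
Hypotheses (Hrho : real_stopping_time rho) (FE : forall j, F_stop rho (E j))
  (aY : forall j, adapted T F (Y j)) (rY : forall j, right_continuous_paths (Y j)).

(** With [E j] the event that currency [j] is chosen at [rho], only the row total in use is watched.
    The strict inequality makes the condition open, as [hitting_time_stop] requires. *)
Definition first_passage := hitting_time rho (fun t w => exists j, E j w /\ (c < Y j t w)%E).

Lemma first_passage_ge w : rho w <= first_passage w.
Proof. exact: hitting_time_ge. Qed.

Lemma first_passage_stop : real_stopping_time first_passage.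
Proof.
apply: hitting_time_stop => // [t tT|t w tT [j [Ej cY]]].
- have tT' : 0 <= t <= T by case/andP: tT => -> /ltW ->.
  rewrite (_ : _ `&` _ = [set w | exists j,
     (E j `&` [set w | rho w <= t] `&` [set w | (c < Y j t w)%E]) w]); last first.
    apply/seteqP; split => w /=; first by move=> [rt [j [Ej cY]]]; exists j.
    by move=> [j [[Ej rt] cY]]; split=> //; exists j.
  apply: (sigma_algebra_bigsetU_ord (filtration_sigma_algebra tT')) => j.
  apply: (sigma_algebra_setI (filtration_sigma_algebra tT')).
    by case: (FE j) => _; apply.
  have -> : [set w | (c < Y j t w)%E] = Y j t @^-1` [set y | (c < y)%E] by [].
  apply: aY => //; rewrite -set_itvoy; exact: emeasurable_itv.
- have tT' : 0 <= t < T.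
    case/andP: tT => rt ->; rewrite (le_trans _ rt)//; by case: Hrho => /(_ w)/andP[].
  have [u tu Hu] := right_continuous_open (@rY j) tT' (@open_ereal_gt_ereal _ c) cY.
  by exists u => // q /Hu cq; exists j.
Qed.

Lemma first_passage_before j w t : E j w -> rho w <= t < first_passage w ->
  (Y j t w <= c)%E.
Proof.
move=> Ej /(hitting_time_notin Hrho) H; rewrite leNgt; apply/negP => cY.
by apply: H; exists j.
Qed.

(** Only a weak inequality survives at the infimum, since hits may accumulate from the right. If all
    watched totals were below [c] there, right continuity would keep them below [c] for a while, and
    the infimum would be larger. *)
Lemma first_passage_at w : first_passage w < T ->
  exists2 j, E j w & (c <= Y j (first_passage w) w)%E.
Proof.
move=> tT; apply: contrapT => nE.
have nE' j : E j w -> (Y j (first_passage w) w < c)%E.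
  by move=> Ej; rewrite ltNge; apply/negP => cY; apply: nE; exists j.
have tau0 : 0 <= first_passage w < T.
  by rewrite tT andbT; case: first_passage_stop => /(_ w)/andP[].
have [u tu Hu] : exists2 u, first_passage w < u &
    forall q, first_passage w <= q < u -> forall j, E j w -> (Y j q w < c)%E.
  have H j : exists u, first_passage w < u /\
      forall q, first_passage w <= q < u -> E j w -> (Y j q w < c)%E.
    have [Ej|nEj] := pselect (E j w); last by exists (first_passage w + 1); rewrite ltrDl.
    have [u tu Hu] := right_continuous_open (@rY j) tau0 (@open_ereal_lt_ereal _ c) (nE' j Ej).
    exists u; split => // q /andP[]; rewrite le_eqVlt => /orP[/eqP <- _ _|tq qu _].
      exact: nE'.
    by apply: Hu; rewrite tq.
  have [f Hf] := choice H.
  exists (\big[Num.min/(first_passage w + 1)]_j f j).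
    by apply: (big_ind (fun x => first_passage w < x)) => [|x y|j _]; [rewrite ltrDl|rewrite lt_min => -> ->|case: (Hf j)].
  move=> q /andP[tq qf] j; case: (Hf j) => _; apply; rewrite tq /= (lt_le_trans qf)//.
  exact: bigmin_le.
have [t /andP[t1 t2] [j [Ej cY]]] := hitting_time_near Hrho tu tT.
by have := Hu t; rewrite t1 t2 => /(_ erefl j Ej); rewrite ltNge (ltW cY).
Qed.

End first_passage.

End stopping.

(** * Optional stopping *)

Section integral_facts.
Context {R : realType} {d} {Om : measurableType d} (P : probability Om R).
Local Open Scope ereal_scope.

Lemma integral_small (X : Om -> \bar R) (e : R) : P.-integrable setT X ->
  (forall w, 0 <= X w) -> (0 < e)%R ->
  exists2 del : R, (0 < del)%R & forall A, measurable A -> P A < del%:E ->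
    \int[P]_(w in A) X w <= e%:E.
Proof.
move=> iX X0 e0; pose f w := fine (X w).
have mX : measurable_fun setT X by exact: measurable_int iX.
have mf : measurable_fun setT f by exact: measurableT_comp.
have Xf : ae_eq P setT X (EFin \o f).
  have := integrable_ae measurableT iX; apply: filterS => w /(_ I) Xw _.
  by rewrite /= fineK.
have iF : P.-integrable setT (EFin \o f).
  apply: le_integrable iX => //; first exact/measurable_EFinP.
  move=> w _ /=; rewrite (gee0_abs (X0 w)).
  rewrite /f; move: (X0 w); case: (X w) => [r|_|//]; last by rewrite leey.
  by rewrite lee_fin => r0 /=; rewrite lee_fin ger0_norm.
have [del [d0 Hd]] := integral_normr_continuous iF e0.
exists del => // A mA /(Hd A mA); rewrite /Rintegral => lt_e.
have fA : \int[P]_(w in A) X w = \int[P]_(w in A) `|f w|%:E.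
  have XfA : ae_eq P A X (EFin \o f) by apply: filterS Xf => w + _; exact.
  rewrite (ge0_ae_eq_integral mA _ _ _ _ XfA)//=.
  - by apply: eq_integral => w _; rewrite ger0_norm// fine_ge0.
  - exact: measurable_funTS.
  - by apply: measurable_funTS; exact/measurable_EFinP.
  - by move=> w _; rewrite lee_fin fine_ge0.
rewrite fA -[X in X <= _]fineK; first by rewrite lee_fin ltW.
rewrite -fA; apply: integrable_fin_num => //; exact: integrableS iX.
Qed.

Lemma cvg_mine (u : nat -> \bar R) (l K : \bar R) : u @ \oo --> l ->
  (fun n => mine (u n) K) @ \oo --> mine l K.
Proof.
move=> ul.
have minK := @min_continuous _ (\bar R) (l, K).
have uK : (fun n => (u n, K)) @ \oo --> (l, K) by apply: cvg_pair => //=; exact: cvg_cst.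
exact: cvg_comp uK minK.
Qed.

Lemma mine_cvg_integral (u : nat -> Om -> \bar R) (f : Om -> \bar R) (K : R) (A : set Om) :
  (0 <= K)%R -> measurable A ->
  (forall n, measurable_fun setT (u n)) -> (forall n w, 0 <= u n w) ->
  measurable_fun setT f -> (forall w, u ^~ w @ \oo --> f w) ->
  (fun n => \int[P]_(w in A) mine (u n w) K%:E) @ \oo --> \int[P]_(w in A) mine (f w) K%:E.
Proof.
move=> K0 mA mu u0 mf uf.
have mm (g : Om -> \bar R) : measurable_fun setT g -> measurable_fun A (fun w => mine (g w) K%:E).
  by move=> mg; apply: measurable_funTS; apply: measurable_mine.
apply: (@dominated_cvg _ _ _ P A mA _ _ (cst K%:E)).
- by move=> n; exact: (mm (u n)).
- by move=> w _; exact: cvg_mine.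
- by [].
- exact: finite_measure_integrable_cst.
- move=> n w _ /=; rewrite gee0_abs ?ge_min ?lexx ?orbT//.
  by rewrite le_min u0 lee_fin.
Qed.

End integral_facts.

Section increasing_sets.
Context {R : realType} {d} {Om : measurableType d} (mu : {measure set Om -> \bar R}).
Local Open Scope ereal_scope.

(** Continuity from below of the measure with density [f]. *)
Lemma cvg_integral_increasing_sets (f : Om -> \bar R) (A : set Om) (B : nat -> set Om) :
  measurable_fun setT f -> (forall w, 0 <= f w) -> measurable A ->
  (forall k, measurable (B k)) -> (forall k, B k `<=` A) ->
  (forall k, B k `<=` B k.+1) -> {ae mu, forall w, A w -> exists k, B k w} ->
  (fun k => \int[mu]_(w in B k) f w) @ \oo --> \int[mu]_(w in A) f w.
Proof.
move=> mf f0 mA mB BA BS ae.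
have [nu [nuE _]] := density_measure_exists mu mf f0.
have mU : measurable (\bigcup_k B k) by exact: bigcup_measurable.
have -> : \int[mu]_(w in A) f w = nu (\bigcup_k B k).
  rewrite nuE; apply/eqP; rewrite eq_le; apply/andP; split; last first.
    by apply: ge0_subset_integral => //; [exact: measurable_funTS|move=> w [k _ /BA]].
  have AU : A = (\bigcup_k B k) `|` (A `\` \bigcup_k B k).
    by rewrite setDUK// => w [k _ /BA].
  rewrite [in leLHS]AU ge0_integral_setU//; last 3 first.
  - exact: measurableD.
  - exact: measurable_funTS.
  - by rewrite disj_set2E setDIK.
  rewrite [X in _ + X]null_set_integral ?adde0//.
  - exact: measurableD.
  - exact: measurable_funTS.
  - have [N [mN N0 sN]] := ae.
    apply: (subset_measure0 _ mN) => //; first exact: measurableD.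
    move=> w [Aw nU]; apply: sN => /= /(_ Aw)[k Bk]; apply: nU; exists k => //.
under eq_fun do rewrite -nuE.
apply: nondecreasing_cvg_mu => //.
apply/nondecreasing_seqP => k; exact/subsetPset.
Qed.

End increasing_sets.

Section optional_stopping.
Context {R : realType} {dO} {Om : measurableType dO} (T : R) (F : R -> set (set Om)).
Hypotheses (T0 : 0 < T) (HF : filtration T F) (HR : right_continuous_filtration T F).
Variable P : probability Om R.
Implicit Types (sigma tau rho : Om -> R) (X M : R -> Om -> \bar R).
Local Open Scope ereal_scope.

Lemma integrable_lty_ge0 (X : Om -> \bar R) : P.-integrable setT X -> (forall w, 0 <= X w) ->
  \int[P]_w X w < +oo.
Proof.
move=> /integrableP[_] + X0; under eq_integral do rewrite gee0_abs//.
by [].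
Qed.

Section martingale.
Variables (M : R -> Om -> \bar R) (sigma : Om -> R).
Hypotheses (HM : martingale T F P M) (M0 : forall t w, (0 <= t <= T)%R -> 0 <= M t w)
  (rM : right_continuous_paths T M) (Hs : real_stopping_time T F sigma).

Let TT : (0 <= T <= T)%R. Proof. by rewrite lexx ltW. Qed.

Let aM : adapted T F M. Proof. by case: HM. Qed.

Let s0T w : (0 <= sigma w <= T)%R. Proof. by case: Hs. Qed.

Let mMt t : (0 <= t <= T)%R -> measurable_fun setT (M t).
Proof. by move=> tT; case: HM => _ /(_ t tT)/measurable_int. Qed.

Let cells m (A : set Om) : A = \bigcup_k (A `&` stop_cell sigma m k).
Proof.
apply/seteqP; split => w; last by move=> [k _ []].
move=> Aw; exists (stop_index sigma m w) => //; split => //.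
by apply/stop_cellP => //; case/andP: (s0T w).
Qed.

Let mcell m k : measurable (stop_cell sigma m k).
Proof.
rewrite -[stop_cell _ _ _]setTI.
apply: (filtration_measurable HF (stop_grid_itv T0 m k)).
apply: F_stop_setI_cell => //; apply: sigma_algebra_setT.
by case: (F_stop_sub_algebra HF Hs).
Qed.

Let triv_cells m (A : set Om) : trivIset setT (fun k => A `&` stop_cell sigma m k).
Proof.
apply/trivIsetP => i j _ _ ij; apply/seteqP; split => // w /= [[_ wi] [_ wj]].
have w0 : (0 <= sigma w)%R by case/andP: (s0T w).
move: ij; move/(stop_cellP _ _ w0) : wi => <-; move/(stop_cellP _ _ w0) : wj => <-.
by rewrite eqxx.
Qed.

Let Ms m w := M (stop_approx T sigma m w) w.

Let MT0 w : 0 <= M T w. Proof. exact: M0. Qed.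

Let Msig0 w : 0 <= M (sigma w) w. Proof. exact: M0. Qed.

Let Ms0 m w : 0 <= Ms m w. Proof. by apply: M0; exact: stop_grid_itv. Qed.

Let mMs m : measurable_fun setT (Ms m).
Proof.
rewrite (cells m setT); apply/measurable_fun_bigcup.
  by move=> k; rewrite setTI.
move=> k; rewrite setTI.
apply: (eq_measurable_fun (M (stop_grid T m k))).
  move=> w /[1!inE] /stop_cellP; case/andP: (s0T w) => w0 _ /(_ w0) kE.
  by rewrite /Ms /stop_approx kE.
by apply: measurable_funTS; apply: mMt; exact: stop_grid_itv.
Qed.

(** On each cell the approximating time is a constant grid time, so the martingale identity applies
    cell by cell. *)
Let approx_eq m A : measurable A -> (forall k, F (stop_grid T m k) (A `&` stop_cell sigma m k)) ->
  \int[P]_(w in A) Ms m w = \int[P]_(w in A) M T w.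
Proof.
move=> mA FA; rewrite (cells m A).
have mC k : measurable (A `&` stop_cell sigma m k) by apply: measurableI.
rewrite ge0_integral_bigcup//; last first.
- exact: measurable_funTS.
rewrite ge0_integral_bigcup//; last first.
- by apply: measurable_funTS; exact: mMt.
apply: eq_eseriesr => k _.
transitivity (\int[P]_(w in A `&` stop_cell sigma m k) M (stop_grid T m k) w).
  apply: eq_integral => w /[1!inE] -[_ /stop_cellP]; case/andP: (s0T w) => w0 _ /(_ w0) kE.
  by rewrite /Ms /stop_approx kE.
have [g0 gT] := andP (stop_grid_itv T0 m k).
by case: HM => _ _ /(_ _ _ g0 gT (lexx _) _ (FA k)) ->.
Qed.

(* [sigma] is approximated from above by the grid times [stop_approx]; the values of [M] there are
uniformly integrable because [M] at such a time has the same integral as [M T] on events of its past. *)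
Lemma martingale_optional_stopping A : F_stop T F sigma A ->
  \int[P]_(w in A) M (sigma w) w = \int[P]_(w in A) M T w.
Proof.
move=> FA; have [mA _] := FA.
have FAm m : forall k, F (stop_grid T m k) (A `&` stop_cell sigma m k).
  by move=> k; exact: F_stop_setI_cell.
have iMT : P.-integrable setT (M T) by case: HM => _ /(_ T TT).
have mMsig : measurable_fun setT (fun w => M (sigma w) w).
  apply: gmeasW; last exact: (F_stop_gmeas T0 HF HR aM rM Hs).
  by case: (F_stop_sub_algebra HF Hs).
have cvgM w : Ms ^~ w @ \oo --> M (sigma w) w by exact: right_continuous_stop_approx.
have mS m : measurable_fun A (fun w => Ms m w) by exact: measurable_funTS.
apply/eqP; rewrite eq_le; apply/andP; split.
  have -> : \int[P]_(w in A) M (sigma w) w = \int[P]_(w in A) limn_einf (Ms ^~ w).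
    by apply: eq_integral => w _; have [-> _] := cvg_limn_einf_sup (cvgM w).
  apply: le_trans (fatou P mA mS (fun m w _ => Ms0 m w)) _.
  rewrite (_ : (fun n => _) = cst (\int[P]_(w in A) M T w)).
    have /cvg_limn_einf_sup[-> _//] : cst (\int[P]_(w in A) M T w) @ \oo --> \int[P]_(w in A) M T w.
    exact: cvg_cst.
  by apply/funext => m; exact: approx_eq.
apply/lee_addgt0Pr => e e0.
have [del d0 Hdel] := integral_small iMT MT0 e0.
have I0 : 0 <= \int[P]_w M T w by apply: integral_ge0.
have Ioo : \int[P]_w M T w < +oo by exact: integrable_lty_ge0.
pose I := fine (\int[P]_w M T w).
have IE : \int[P]_w M T w = I%:E by rewrite fineK// ge0_fin_numE.
have I0' : (0 <= I)%R by rewrite -lee_fin -IE.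
(* By Markov's inequality the event [Ms m > K] has probability below [del], uniformly in [m], since
   [K * del = I + 1] exceeds the expectation [I]. *)
pose K : R := ((I + 1) / del)%R.
have K0 : (0 < K)%R by rewrite divr_gt0// ltr_wpDl.
pose B m := [set w | K%:E < Ms m w].
have mB m : measurable (B m).
  by rewrite -[B m]setTI; exact: emeasurable_fun_o_infty.
have FB m A' k : F (stop_grid T m k) (A' `&` stop_cell sigma m k) ->
   F (stop_grid T m k) ((A' `&` B m) `&` stop_cell sigma m k).
  move=> FA'.
  have -> : (A' `&` B m) `&` stop_cell sigma m k = (A' `&` stop_cell sigma m k) `&`
      (M (stop_grid T m k) @^-1` [set y | K%:E < y]).
    rewrite setIAC; apply/seteqP; split => w [[Aw wk]].
      move=> BB; split => //; move: BB; rewrite /B /preimage /=.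
      move/stop_cellP: wk; case/andP: (s0T w) => w0 _ /(_ w0) kE.
      by rewrite /Ms /stop_approx kE.
    move=> BB; split => //; move: BB; rewrite /B /preimage /=.
    move/stop_cellP: wk; case/andP: (s0T w) => w0 _ /(_ w0) kE.
    by rewrite /Ms /stop_approx kE.
  have sg := filtration_sigma_algebra HF (stop_grid_itv T0 m k).
  apply: (sigma_algebra_setI sg) => //.
  apply: aM; first exact: stop_grid_itv.
  by rewrite -set_itvoy; exact: emeasurable_itv.
have FT m k : F (stop_grid T m k) (setT `&` stop_cell sigma m k).
  apply: F_stop_setI_cell => //; apply: sigma_algebra_setT.
  by case: (F_stop_sub_algebra HF Hs).
have PB m : P (B m) < del%:E.
  have h : K%:E * P (B m) <= I%:E.
    rewrite -integral_cst// -IE.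
    apply: (@le_trans _ _ (\int[P]_(w in B m) Ms m w)).
      apply: ge0_le_integral => //.
      - by move=> w _; rewrite lee_fin ltW.
      - exact: measurable_funTS.
      - by move=> w /ltW.
    rewrite -[B m]setTI approx_eq//; last 2 first.
      exact: measurableI.
      by move=> k; exact: FB.
    by apply: ge0_subset_integral => //; [exact: measurableI|exact: mMt].
  rewrite ltNge; apply/negP => dP.
  have : K%:E * del%:E <= I%:E by apply: le_trans h; rewrite lee_pmul2l.
  by rewrite -EFinM lee_fin /K -mulrA mulVf ?gt_eqF// mulr1 leNgt ltrDl ltr01.
(* [Ms m] is at most its truncation at [K] plus its restriction to [B m], and the latter integrates
   like [M T] over a set of probability below [del], hence to at most [e]. *)
have bound m : \int[P]_(w in A) M T w <= \int[P]_(w in A) mine (Ms m w) K%:E + e%:E.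
  rewrite -(approx_eq mA (FAm m)).
  apply: (@le_trans _ _ (\int[P]_(w in A) (mine (Ms m w) K%:E + (Ms m \_ (B m)) w))).
    apply: ge0_le_integral => //.
    - apply: measurable_funTS; apply: emeasurable_funD; first exact: measurable_mine.
      by apply/(measurable_restrictT _ (mB m)).1; exact: measurable_funTS.
    - move=> w _; have [wB|wB] := pselect (B m w).
        by rewrite patchT ?inE// leeDr// le_min Ms0 lee_fin ltW.
      rewrite patchN ?notin_setE// adde0 le_min lexx /= leNgt; exact/negP.
  rewrite ge0_integralD//; last 4 first.
  - by move=> w _; rewrite le_min Ms0 lee_fin ltW.
  - by apply: measurable_funTS; exact: measurable_mine.
  - by move=> w _; apply: erestrict_ge0.
  - apply: measurable_funTS; apply/(measurable_restrictT _ (mB m)).1; exact: measurable_funTS.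
  apply: leeD => //; rewrite -integral_mkcondr.
  rewrite (approx_eq (measurableI _ _ mA (mB m)) (fun k => FB m A k (FAm m k))).
  apply: Hdel; first exact: measurableI.
  by apply: le_lt_trans (PB m); apply: le_measure; rewrite ?inE//; exact: measurableI.
apply: (@le_trans _ _ (\int[P]_(w in A) mine (M (sigma w) w) K%:E + e%:E)).
  have cv : (fun m => \int[P]_(w in A) mine (Ms m w) K%:E + e%:E) @ \oo -->
      \int[P]_(w in A) mine (M (sigma w) w) K%:E + e%:E.
    apply: cvgeD; first by rewrite fin_num_adde_defl.
      by apply: mine_cvg_integral => //; exact: ltW.
    exact: cvg_cst.
  rewrite -(cvg_lim (@ereal_hausdorff R) cv); apply: lime_ge.
    by apply/cvg_ex; eexists; exact: cv.
  exact: nearW.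
rewrite leeD2r//; apply: ge0_le_integral => //.
- by move=> w _; rewrite le_min Msig0 lee_fin ltW.
- by apply: measurable_funTS; exact: measurable_mine.
- exact: measurable_funTS.
- by move=> w _; rewrite ge_min lexx.
Qed.

End martingale.

Lemma stopped_right_continuous X (tau : Om -> \bar R) : right_continuous_paths T X ->
  right_continuous_paths T (stopped tau X).
Proof.
move=> rX w t tT; rewrite /stopped /tmin; case: (tau w) => [r| |]; try exact: rX.
have [rt|tr] := leP r t.
  apply: cvg_near_cst.
  near=> u; rewrite min_l// (le_trans rt)//.
apply: cvg_trans (rX w t tT).
apply: near_eq_cvg; near=> u.
by rewrite min_r// ltW.
Unshelve. all: by end_near. Qed.

Definition real_time (tau : Om -> \bar R) (w : Om) : R := tmin tau w T.

Lemma real_time_stop (tau : Om -> \bar R) : stopping_time T F tau ->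
  real_stopping_time T F (real_time tau).
Proof.
move=> [tau0 Ftau]; split=> [w|t /andP[t0 tT]]; rewrite /real_time /tmin.
  move: (tau0 w); case: (tau w) => [r| |]//= r0; rewrite ?(ltW T0) ?lexx//.
  by rewrite le_min ge_min lexx orbT (ltW T0) !andbT -lee_fin.
have := Ftau t t0; rewrite /Fx min_l ?(ltW tT)//.
congr (F t _); apply/seteqP; split => w /=; move: (tau0 w); case: (tau w) => [r| |]//= _.
- by rewrite lee_fin ge_min => ->.
- by rewrite lee_fin ge_min => /orP[//|]; rewrite leNgt tT.
- by rewrite leNgt tT.
Qed.

Lemma stoppedE (tau : Om -> \bar R) X w t : (t <= T)%R ->
  stopped tau X t w = X (Num.min (real_time tau w) t) w.
Proof.
rewrite /stopped /real_time /tmin => tT; case: (tau w) => [r| |]; rewrite ?(min_r tT)//.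
by rewrite -minA (min_r tT).
Qed.

(** * Nonnegative local martingales bounded before a passage time *)

Section local_martingale.
Variables (X : R -> Om -> \bar R) (sigma rho : Om -> R) (c : R).
Hypotheses (HX : local_martingale T F P X) (X0 : forall t w, (0 <= t <= T)%R -> 0 <= X t w)
  (aX : adapted T F X)
  (rX : right_continuous_paths T X) (Hs : real_stopping_time T F sigma)
  (Hr : real_stopping_time T F rho) (sr : forall w, (sigma w <= rho w)%R).

(** Stop at [tau_k]. Where [rho <= tau_k] the value at [rho] is recovered and the integrals increase
    to the full one; where [sigma <= tau_k < rho] the process is still at most [c], so the error is
    at most [c] times the probability of [tau_k < rho], which tends to 0. No bound on the jump at
    [rho] enters. *)
Lemma local_martingale_optional_stopping A : F_stop T F sigma A -> (0 <= c)%R ->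
  (forall w t, A w -> (sigma w <= t < rho w)%R -> X t w <= c%:E) ->
  \int[P]_(w in A) X (rho w) w = \int[P]_(w in A) X (sigma w) w.
Proof.
move=> FA c0 Xc; have [mA _] := FA.
have [tau [Ht tauS tau_oo Hm]] := HX.
pose tk k := real_time (tau k).
have Htk k : real_stopping_time T F (tk k) by exact: real_time_stop.
have tkT k w : (tk k w <= T)%R by case: (Htk k) => /(_ w)/andP[].
have mX tt : real_stopping_time T F tt -> measurable_fun setT (fun w => X (tt w) w).
  move=> Htt; apply: gmeasW; last exact: (F_stop_gmeas T0 HF HR aX rX Htt).
  by case: (F_stop_sub_algebra HF Htt).
have tkS k w : (tk k w <= tk k.+1 w)%R.
  move: (tauS k w); have [p _] := Ht k; have [q _] := Ht k.+1; move: (p w) (q w).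
  rewrite /tk /real_time /tmin.
  case: (tau k w) => [r| |]; case: (tau k.+1 w) => [r'| |]//= _ _.
    by rewrite lee_fin => rr; rewrite le_min !ge_min rr lexx orbT.
  by rewrite ge_min lexx orbT.
have Xs0 w : 0 <= X (sigma w) w by apply: X0; case: Hs.
have Xr0 w : 0 <= X (rho w) w by apply: X0; case: Hr.
have Xm0 k w : 0 <= X (Num.min (rho w) (tk k w)) w.
  by apply: X0; have [] := real_stopping_time_min HF Hr (Htk k).
(* Once [tau_k] exceeds [T], its capped version equals [T] exactly. *)
have ae_tk : {ae P, forall w, exists k, tk k w = T}.
  apply: filterS tau_oo => w /cvgeyPgt /(_ T) [k _ /(_ k (leqnn k))].
  rewrite /= => Tt; exists k; rewrite /tk /real_time /tmin.
  move: Tt; case: (tau k w) => [r| |]//; rewrite lte_fin => Tr.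
  by rewrite min_r// ltW.
have mle s1 s2 : real_stopping_time T F s1 -> real_stopping_time T F s2 ->
    measurable [set w | (s1 w <= s2 w)%R].
  exact: (real_stopping_time_measurable_le T0 HF).
pose A_ k := A `&` [set w | (sigma w <= tk k w)%R].
pose B_ k := A `&` [set w | (rho w <= tk k w)%R].
have mA_ k : measurable (A_ k) by apply: measurableI => //; exact: mle.
have mB_ k : measurable (B_ k) by apply: measurableI => //; exact: mle.
have BA k : B_ k `<=` A_ k by move=> w [Aw /= rt]; split => //=; exact: le_trans (sr w) rt.
have cvgA : (fun k => \int[P]_(w in A_ k) X (sigma w) w) @ \oo --> \int[P]_(w in A) X (sigma w) w.
  apply: cvg_integral_increasing_sets => //.
  - exact: mX.
  - by move=> k w [].
  - by move=> k w [Aw /= st]; split => //=; apply: le_trans (tkS k w).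
  - apply: filterS ae_tk => w [k kT] Aw; exists k; split => //=; rewrite kT.
    by case: Hs => /(_ w)/andP[].
have cvgB : (fun k => \int[P]_(w in B_ k) X (rho w) w) @ \oo --> \int[P]_(w in A) X (rho w) w.
  apply: cvg_integral_increasing_sets => //.
  - exact: mX.
  - by move=> k w [].
  - by move=> k w [Aw /= st]; split => //=; apply: le_trans (tkS k w).
  - apply: filterS ae_tk => w [k kT] Aw; exists k; split => //=; rewrite kT.
    by case: Hr => /(_ w)/andP[].
pose p k := P (~` [set w | (rho w <= tk k w)%R]).
have cvgp : p @ \oo --> 0.
  have c1 : (fun k => P [set w | (rho w <= tk k w)%R]) @ \oo --> (1 : \bar R).
    rewrite -(probability_setT P).
    have PE (A' : set Om) : measurable A' -> P A' = \int[P]_(w in A') (cst 1) w.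
      by move=> mA'; rewrite integral_cst// mul1e.
    rewrite (_ : (fun k => _) = fun k => \int[P]_(w in [set w | (rho w <= tk k w)%R]) (cst 1) w); last first.
      by apply/funext => k; rewrite PE//; exact: mle.
    rewrite PE//; apply: cvg_integral_increasing_sets => //.
    - by move=> k; exact: mle.
    - by move=> k w /= /le_trans; apply.
    - apply: filterS ae_tk => w [k kT] _; exists k => /=; rewrite kT.
      by case: Hr => /(_ w)/andP[].
  rewrite (_ : p = (fun k => 1 - P [set w | (rho w <= tk k w)%R])); last first.
    by apply/funext => k; rewrite /p probability_setC//; exact: mle.
  rewrite -[X in _ --> X](@subee _ (1 : \bar R))//; apply: cvgeB => //; exact: cvg_cst.
have E k : \int[P]_(w in A_ k) X (sigma w) w =
    \int[P]_(w in A_ k) X (Num.min (rho w) (tk k w)) w.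
  pose M := stopped (tau k) X.
  have M0 t w : (0 <= t <= T)%R -> 0 <= M t w.
    move=> /andP[t0 tT]; rewrite /M stoppedE//; apply: X0.
    by have [/(_ w)/andP[r0 _] _] := Htk k; rewrite le_min r0 t0 ge_min tT orbT.
  have rM : right_continuous_paths T M by exact: stopped_right_continuous.
  have Hs' := real_stopping_time_min HF Hs (Htk k).
  have Hr' := real_stopping_time_min HF Hr (Htk k).
  have FAk := F_stop_setI_le T0 HF Hs (Htk k) FA.
  have FAk' : F_stop T F (fun w => Num.min (rho w) (tk k w)) (A_ k).
    apply: (F_stop_mono HF Hr' _ FAk) => w.
    by rewrite le_min !ge_min sr lexx orbT.
  have h1 := martingale_optional_stopping (Hm k) M0 rM Hs' FAk.
  have h2 := martingale_optional_stopping (Hm k) M0 rM Hr' FAk'.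
  transitivity (\int[P]_(w in A_ k) M T w).
    rewrite -h1; apply: eq_integral => w /[1!inE] -[_ /= st].
    by rewrite /M min_l// stoppedE ?min_r//; case: Hs => /(_ w)/andP[].
  rewrite -h2; apply: eq_integral => w _.
  rewrite /M stoppedE ?(@min_r _ _ (real_time (tau k) w)) ?ge_min ?lexx ?orbT//.
  by rewrite tkT orbT.
have lo k : \int[P]_(w in B_ k) X (rho w) w <= \int[P]_(w in A_ k) X (sigma w) w.
  rewrite E.
  have -> : \int[P]_(w in B_ k) X (rho w) w = \int[P]_(w in B_ k) X (Num.min (rho w) (tk k w)) w.
    by apply: eq_integral => w /[1!inE] -[_ /= rt]; rewrite min_l.
  apply: ge0_subset_integral => //.
  apply: measurable_funTS; apply: mX; exact: real_stopping_time_min.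
have hi k : \int[P]_(w in A_ k) X (sigma w) w <=
    \int[P]_(w in B_ k) X (rho w) w + c%:E * p k.
  rewrite E -(setDUK (BA k)) ge0_integral_setU//; last 3 first.
  - exact: measurableD.
  - apply: measurable_funTS; apply: mX; exact: real_stopping_time_min.
  - by rewrite disj_set2E setDIK.
  apply: leeD.
    by rewrite le_eqVlt; apply/orP; left; apply/eqP; apply: eq_integral => w /[1!inE] -[_ /= rt]; rewrite min_l.
  apply: (@le_trans _ _ (\int[P]_(w in A_ k `\` B_ k) c%:E)).
    apply: ge0_le_integral => //.
    - exact: measurableD.
    - apply: measurable_funTS; apply: mX; exact: real_stopping_time_min.
    - move=> w [[Aw /= st] nB].
      have tr : (tk k w < rho w)%R by rewrite ltNge; apply/negP => rt; apply: nB.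
      by rewrite min_r ?(ltW tr)//; apply: Xc => //; rewrite st.
  rewrite integral_cst; last exact: measurableD.
  rewrite lee_wpmul2l//; apply: le_measure; rewrite ?inE.
  - exact: measurableD.
  - by apply: measurableC; exact: mle.
  - by move=> w [[Aw _] nB] /= rt; apply: nB.
apply: (cvg_unique (@ereal_hausdorff R) _ cvgA).
apply: (squeeze_cvge _ cvgB).
  by apply: nearW => k; apply/andP; split; [exact: lo|exact: hi].
rewrite -[X in _ --> X]adde0; apply: cvgeD => //.
  by rewrite fin_num_adde_defl.
rewrite -(mule0 c%:E); apply: cvgeZl => //.
Qed.

End local_martingale.
End optional_stopping.

(** * Exchange matrices and basket prices *)

Section exchange_matrices.
Context {R : realType} {d : nat} (s : 'I_d -> 'I_d -> \bar R).
Hypothesis Hs : exchange_matrix s.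
Local Open Scope ereal_scope.

(** The conventions [fine +oo = 0] and [0^-1 = 0] let one formula cover inactive currencies. *)
Lemma basketE i : basket s i = ((fine (row_sum s i))^-1)%:E.
Proof. by rewrite /basket; case: (row_sum s i) => [r| |]//=; rewrite invr0. Qed.

Lemma exchange_ge0 i j : 0 <= s i j. Proof. by case: Hs. Qed.

Lemma exchange_le_row_sum i j : s i j <= row_sum s i.
Proof.
rewrite /row_sum (bigD1 j)//=; apply: leeDl; apply: sume_ge0 => k _; exact: exchange_ge0.
Qed.

Lemma row_sum_ge1 i : 1 <= row_sum s i.
Proof. by case: Hs => _ /(_ i) <- _; exact: exchange_le_row_sum. Qed.

Lemma row_sum_ge0 i : 0 <= row_sum s i.
Proof. exact: le_trans (row_sum_ge1 i). Qed.

Lemma basket_ge0 i : 0 <= basket s i.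
Proof. by rewrite basketE lee_fin invr_ge0 fine_ge0// row_sum_ge0. Qed.

Lemma fine_row_sum_ge1 i : row_sum s i < +oo -> (1 <= fine (row_sum s i))%R.
Proof.
by move=> oo; rewrite -lee_fin fineK ?row_sum_ge1// ge0_fin_numE// row_sum_ge0.
Qed.

Lemma basket_le1 i : basket s i <= 1.
Proof.
rewrite basketE lee_fin; have [oo|] := ltP (row_sum s i) +oo.
  by rewrite invf_le1 ?fine_row_sum_ge1// (lt_le_trans ltr01)// fine_row_sum_ge1.
by rewrite leye_eq => /eqP ->/=; rewrite invr0.
Qed.

(** If [s j i] were finite, the product [s i j * s j i] would be defined and equal to 0 instead of
    [s i i = 1]. *)
Lemma exchange_0y i j : s i j = 0 -> s j i = +oo.
Proof.
move=> ij0; case: Hs => s0 s1 sm; apply: contrapT => jiy.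
have pd : prod_defined (s i j) (s j i).
  by rewrite ij0; split => -[].
by have := sm i j i pd; rewrite s1 ij0 mul0e => /eqP; rewrite eq_sym onee_eq0.
Qed.

(** The identity [Z_k Y_j = S_(j,k)]. If [s j k = 0] then [s k j] is infinite, so [k] is inactive
    and both sides vanish; otherwise multiplying row [k] by [s j k] gives row [j], and one divides
    by the row sum of [k]. *)
Lemma basket_mul_row_sum j k : row_sum s j < +oo -> basket s k * row_sum s j = s j k.
Proof.
move=> jy; have [s0 s1 sm] := Hs.
have sjk_fin : s j k \is a fin_num.
  by rewrite ge0_fin_numE// (le_lt_trans (exchange_le_row_sum _ _)).
have [/eqP jk0|jk0] := boolP (s j k == 0).
  have kjy := exchange_0y jk0.
  have ky : row_sum s k = +oo.
    by apply/eqP; rewrite -leye_eq -kjy exchange_le_row_sum.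
  by rewrite basketE ky /= invr0 mul0e jk0.
have E : s j k * row_sum s k = row_sum s j.
  rewrite /row_sum ge0_sume_distrr//; apply: eq_bigr => l _; apply: sm.
  split => -[]; first by move=> jk00; rewrite jk00 eqxx in jk0.
  by move=> jky; rewrite jky in sjk_fin.
have jk_gt0 : 0 < s j k by rewrite lt_neqAle eq_sym jk0 s0.
have ky : row_sum s k < +oo.
  rewrite ltey; apply/eqP => ky; move: jy; rewrite -E ky gt0_muley//.
have kf : row_sum s k \is a fin_num by rewrite ge0_fin_numE// row_sum_ge0.
rewrite basketE -E muleCA -{2}(fineK kf) -EFinM mulVf ?mule1//.
by rewrite gt_eqF// (lt_le_trans ltr01)// fine_row_sum_ge1.
Qed.

Lemma mul_basket_exchange j k : row_sum s j < +oo -> basket s j * s j k = basket s k.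
Proof.
move=> jy; have jf : row_sum s j \is a fin_num by rewrite ge0_fin_numE// row_sum_ge0.
rewrite -(basket_mul_row_sum k jy) muleCA (basketE j) -{2}(fineK jf) -EFinM mulVf ?mule1//.
by rewrite gt_eqF// (lt_le_trans ltr01)// fine_row_sum_ge1.
Qed.

Lemma basket_gt0 j : row_sum s j < +oo -> 0 < basket s j.
Proof.
by move=> jy; rewrite basketE lte_fin invr_gt0 (lt_le_trans ltr01)// fine_row_sum_ge1.
Qed.

Lemma le_basket j (c : R) : row_sum s j <= c%:E -> (c^-1)%:E <= basket s j.
Proof.
move=> jc; have jy : row_sum s j < +oo by rewrite (le_lt_trans jc)// ltry.
have f1 := fine_row_sum_ge1 jy.
have fc : (fine (row_sum s j) <= c)%R.
  by rewrite -lee_fin fineK// ge0_fin_numE// row_sum_ge0.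
by rewrite basketE lee_fin lef_pV2// posrE; lra.
Qed.

Lemma basket_le j (c : R) : (0 < c)%R -> c%:E <= row_sum s j -> basket s j <= (c^-1)%:E.
Proof.
move=> c0 jc; rewrite basketE lee_fin; have [oo|] := ltP (row_sum s j) +oo.
  have fc : (c <= fine (row_sum s j))%R.
    by rewrite -lee_fin fineK// ge0_fin_numE// row_sum_ge0.
  by rewrite lef_pV2// posrE; lra.
by rewrite leye_eq => /eqP ->/=; rewrite invr0 invr_ge0 ltW.
Qed.

(** With [exchange_le1_trans], the relation [s i j <= 1] is a total preorder; a currency related to
    all others is a strongest one, and its row sum is at most [d]. *)
Lemma exchange_le1_total i j : s i j <= 1 \/ s j i <= 1.
Proof.
have [//|ij1] := leP (s i j) 1; [by left|right].
have [s0 s1 sm] := Hs.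
have [/eqP ji0|ji0] := boolP (s j i == 0); first by rewrite ji0.
rewrite leNgt; apply/negP => ji1.
have pd : prod_defined (s i j) (s j i).
  split=> -[]; first by move=> ij0; rewrite ij0 ltNge lee01 in ij1.
  by move=> _ ji00; rewrite ji00 eqxx in ji0.
have := sm i j i pd; rewrite s1 => e.
have : 1 < s i j * s j i.
  apply: (lt_le_trans ij1); rewrite -[leLHS]mule1; apply: lee_wpmul2l => //; exact: ltW.
by rewrite e ltxx.
Qed.

Lemma exchange_le1_trans i j k : s i j <= 1 -> s j k <= 1 -> s i k <= 1.
Proof.
move=> ij jk; have [s0 s1 sm] := Hs; rewrite -(sm i j k).
  by rewrite -(mule1 1); apply: lee_pmul.
split=> -[]; first by move=> _ jky; rewrite jky in jk.
by move=> ijy; rewrite ijy in ij.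
Qed.

End exchange_matrices.

Section exchange_strongest.
Context {R : realType} {d : nat} (s : 'I_d -> 'I_d -> \bar R).
Hypothesis Hs : exchange_matrix s.
Local Open Scope ereal_scope.

Lemma exchange_strongest_seq (r : seq 'I_d) (i : 'I_d) :
  exists j, forall k, k \in i :: r -> s j k <= 1.
Proof.
elim: r => [|l r [j IH]].
  by exists i => k; rewrite inE => /eqP ->; case: Hs => _ -> _.
have [jl|lj] := exchange_le1_total Hs j l.
  exists j => k; rewrite !inE => /or3P[/eqP->|/eqP->//|kr]; apply: IH; rewrite inE ?eqxx// kr orbT//.
exists l => k; rewrite !inE => /or3P[/eqP->|/eqP->|kr].
- by apply: (exchange_le1_trans Hs lj); apply: IH; rewrite inE eqxx.
- by case: Hs => _ -> _.
- by apply: (exchange_le1_trans Hs lj); apply: IH; rewrite inE kr orbT.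
Qed.

Lemma exists_row_sum_le : (0 < d)%N -> exists j, row_sum s j <= d%:R%:E.
Proof.
move=> d0; have [j Hj] := exchange_strongest_seq (enum 'I_d) (Ordinal d0).
exists j; rewrite /row_sum.
apply: (@le_trans _ _ (\sum_(k < d) 1)).
  by apply: lee_sum => k _; apply: Hj; rewrite inE mem_enum orbT.
by rewrite sumEFin sumr_const card_ord.
Qed.

Lemma sum_basket : (0 < d)%N -> \sum_(k < d) basket s k = 1.
Proof.
move=> d0; have [j jd] := exists_row_sum_le d0.
have jy : row_sum s j < +oo by rewrite (le_lt_trans jd)// ltry.
have jf : row_sum s j \is a fin_num by rewrite ge0_fin_numE// row_sum_ge0.
have : basket s j * \sum_(k < d) s j k = \sum_(k < d) basket s k.
  rewrite ge0_sume_distrr; last by move=> k _; exact: exchange_ge0.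
  by apply: eq_bigr => k _; exact: mul_basket_exchange.
move=> <-; rewrite -/(row_sum s j) basketE -{2}(fineK jf) -EFinM mulVf//.
by rewrite gt_eqF// (lt_le_trans ltr01)// fine_row_sum_ge1.
Qed.

End exchange_strongest.

Lemma measurable_fine_inv {R : realType} d (U : measurableType d) (f : U -> \bar R) :
  measurable_fun setT f -> (forall x, (0 <= f x)%E) ->
  measurable_fun setT (fun x => ((fine (f x))^-1)%:E).
Proof.
move=> mf f0.
rewrite (_ : (fun x => _) = (fun x => (fine (f x) `^ (-1))%:E)); last first.
  by apply/funext => x; rewrite powR_inv1// fine_ge0.
apply/measurable_EFinP.
apply: (measurableT_comp (@measurable_powR R (-1))).
exact: measurableT_comp.
Qed.

Section exchange_process.
Context {R : realType} {dO} {Om : measurableType dO} (T : R) (F : R -> set (set Om)).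
Hypotheses (T0 : 0 < T) (HF : filtration T F) (HR : right_continuous_filtration T F).
Context (d : nat) (S : R -> Om -> 'I_d -> 'I_d -> \bar R).
Hypothesis HS : exchange_process T F S.
Local Open Scope ereal_scope.

(** In the notation of the overview, [rate j k], [row_total j] and [price k] are [S_(j,k)], [Y_j]
    and [Z_k]. *)
Definition rate j k : R -> Om -> \bar R := fun t w => S t w j k.
Definition row_total j : R -> Om -> \bar R := fun t w => row_sum (S t w) j.
Definition price k : R -> Om -> \bar R := fun t w => basket (S t w) k.

Lemma process_matrix t w : (0 <= t <= T)%R -> exchange_matrix (S t w).
Proof. by case: HS => _ _ + _ tT; apply. Qed.

Lemma rate_ge0 j k t w : (0 <= t <= T)%R -> 0 <= rate j k t w.
Proof. by move=> tT; exact: (exchange_ge0 (process_matrix w tT)). Qed.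

Lemma total_ge0 j t w : (0 <= t <= T)%R -> 0 <= row_total j t w.
Proof. by move=> tT; exact: (row_sum_ge0 (process_matrix w tT)). Qed.

Lemma price_ge0 j t w : (0 <= t <= T)%R -> 0 <= price j t w.
Proof. by move=> tT; exact: (basket_ge0 (process_matrix w tT)). Qed.

Lemma price_le1 j t w : (0 <= t <= T)%R -> price j t w <= 1.
Proof. by move=> tT; exact: (basket_le1 (process_matrix w tT)). Qed.

Lemma rate_adapted j k : adapted T F (rate j k).
Proof. by case: HS => + _ _ _; apply. Qed.

Lemma rate_right_continuous j k : right_continuous_paths T (rate j k).
Proof. by case: HS => _ rS _ _ w t tT; exact: rS. Qed.

Lemma total_adapted j : adapted T F (row_total j).
Proof.
move=> t tT; apply/(gmeasE _ (filtration_sigma_algebra HF tT)).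
apply: emeasurable_sum => k.
by apply/(gmeasE _ (filtration_sigma_algebra HF tT)); exact: rate_adapted.
Qed.

Lemma total_right_continuous j : right_continuous_paths T (row_total j).
Proof.
move=> w t tT; have tT' : (0 <= t <= T)%R by case/andP: tT => -> /ltW ->.
rewrite /row_total /row_sum.
have H (r : seq 'I_d) :
    (fun u => \sum_(k <- r) S u w j k) @ t^'+ --> \sum_(k <- r) S t w j k.
  elim: r => [|k r IH].
    rewrite big_nil; apply: cvg_near_cst; apply: nearW => u; by rewrite big_nil.
  rewrite big_cons; under eq_fun do rewrite big_cons.
  apply: cvgeD => //; last exact: rate_right_continuous.
  apply: ge0_adde_def; rewrite inE; first exact: rate_ge0.
  by apply: sume_ge0 => l _; exact: rate_ge0.
exact: H.
Qed.

Section at_stopping_time.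
Variables (sigma : Om -> R).
Hypothesis Hs : real_stopping_time T F sigma.

Let s0T w : (0 <= sigma w <= T)%R. Proof. by case: Hs. Qed.

Let sa := F_stop_sub_algebra HF Hs.

Lemma rate_gmeas j k : gmeas (F_stop T F sigma) (fun w => rate j k (sigma w) w).
Proof. exact: (F_stop_gmeas T0 HF HR (rate_adapted j k) (@rate_right_continuous j k) Hs). Qed.

Lemma total_gmeas j : gmeas (F_stop T F sigma) (fun w => row_total j (sigma w) w).
Proof. exact: (F_stop_gmeas T0 HF HR (@total_adapted j) (@total_right_continuous j) Hs). Qed.

Lemma price_gmeas k : gmeas (F_stop T F sigma) (fun w => price k (sigma w) w).
Proof.
apply/(gmeasE _ (proj1 sa)).
rewrite (_ : (fun w => _) = (fun w => ((fine (row_total k (sigma w) w))^-1)%:E)); last first.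
  by apply/funext => w; rewrite /price basketE.
apply: (@measurable_fine_inv _ _ (g_sigma_algebraType (F_stop T F sigma))).
  by apply/(gmeasE _ (proj1 sa)); exact: total_gmeas.
by move=> w; exact: total_ge0.
Qed.

End at_stopping_time.

End exchange_process.

(** * Pasting along a switch of currency *)

Section gmeas_ops.
Context {R : realType} {d} {Om : measurableType d} (G : set (set Om)).
Hypothesis sG : sigma_algebra setT G.
Local Open Scope ereal_scope.
Implicit Types (f g : Om -> \bar R).

Lemma gmeasM f g : gmeas G f -> gmeas G g -> gmeas G (fun w => f w * g w).
Proof.
move=> /(gmeasE _ sG) mf /(gmeasE _ sG) mg; apply/(gmeasE _ sG).
exact: emeasurable_funM.
Qed.

Lemma gmeas_ind A : G A -> gmeas G (fun w => (\1_A w)%:E : \bar R).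
Proof.
move=> GA; apply/(gmeasE _ sG); apply/measurable_EFinP.
apply: (@measurable_indic _ (g_sigma_algebraType G)).
by rewrite /measurable /= sigma_algebra_id.
Qed.

Lemma gmeas_cst (r : \bar R) : gmeas G (cst r).
Proof. by apply/(gmeasE _ sG); exact: measurable_cst. Qed.

End gmeas_ops.

Section measure_sums.
Context {R : realType} {d} {Om : measurableType d}.
Local Open Scope ereal_scope.

Lemma measure_sum_exists n (m : 'I_n -> {measure set Om -> \bar R}) :
  exists nu : {measure set Om -> \bar R},
    (forall A, nu A = \sum_(j < n) m j A) /\
    (forall f, measurable_fun setT f -> (forall w, 0 <= f w) ->
       \int[nu]_w f w = \sum_(j < n) \int[m j]_w f w).
Proof.
pose ms (k : nat) : {measure set Om -> \bar R} :=
  if insub k is Some i then m i else (@mzero _ Om R : {measure set Om -> \bar R}).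
have msE (i : 'I_n) : ms i = m i by rewrite /ms valK.
exists (msum ms n); split.
  by move=> A; rewrite /msum /=; apply: eq_bigr => i _; rewrite msE.
move=> f mf f0; rewrite ge0_integral_measure_sum//.
by apply: eq_bigr => i _; rewrite msE.
Qed.

Lemma QsumE n (Q : 'I_n -> probability Om R) A : Qsum Q A = \sum_(j < n) Q j A.
Proof. by rewrite /Qsum /msum /=; apply: eq_bigr => i _; rewrite /Qseq valK. Qed.

Lemma integral_ind (mu : {measure set Om -> \bar R}) (A B : set Om) (f : Om -> \bar R) :
  \int[mu]_(w in A) (f w * (\1_B w)%:E) = \int[mu]_(w in A `&` B) f w.
Proof.
by rewrite integral_mkcondr; apply: eq_integral => w _; rewrite epatch_indic.
Qed.

End measure_sums.

Section step.
Context {R : realType} {dO} {Om : measurableType dO} (T : R) (F : R -> set (set Om)).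
Hypotheses (T0 : 0 < T) (HF : filtration T F) (HR : right_continuous_filtration T F).
Context (d : nat) (S : R -> Om -> 'I_d -> 'I_d -> \bar R).
Hypothesis HS : exchange_process T F S.
Variable Q : 'I_d -> probability Om R.
Hypothesis HQ : forall j k, local_martingale T F (Q j) (fun t w => S t w j k).
Variables (rho : Om -> R) (J : Om -> 'I_d) (c : R).
Hypotheses (Hrho : real_stopping_time T F rho) (c0 : 0 <= c)
  (FJ : forall j, F_stop T F rho [set w | J w = j])
  (HJ : forall w, (row_total S (J w) (rho w) w < +oo)%E).
Local Open Scope ereal_scope.

Let E j : set Om := [set w | J w = j].
Let ind j (w : Om) : \bar R := (\1_(E j) w)%:E.

Definition switch_time := first_passage T rho E (row_total S) c%:E.
Let tau := switch_time.

Lemma switch_time_stop : real_stopping_time T F tau.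
Proof.
apply: (first_passage_stop HF HR c%:E Hrho FJ (total_adapted HF HS)) => j.
exact: (total_right_continuous HS).
Qed.

Let itv s : real_stopping_time T F s -> forall w, (0 <= s w <= T)%R. Proof. by case. Qed.

Let ind0 j w : 0 <= ind j w. Proof. by rewrite lee_fin. Qed.

Let ind1 j w : E j w -> ind j w = 1.
Proof. by move=> Ew; rewrite /ind indicE mem_set. Qed.

Let indN j w : ~ E j w -> ind j w = 0.
Proof. by move=> Ew; rewrite /ind indicE memNset. Qed.

Let sa s : real_stopping_time T F s -> sub_algebra (F_stop T F s).
Proof. exact: F_stop_sub_algebra. Qed.

Let FE s : real_stopping_time T F s -> (forall w, (rho w <= s w)%R) ->
  forall j, F_stop T F s (E j).
Proof. by move=> Hs rs j; apply: (F_stop_mono HF Hs rs); exact: FJ. Qed.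

Let ind_gmeas s : real_stopping_time T F s -> (forall w, (rho w <= s w)%R) ->
  forall j, gmeas (F_stop T F s) (ind j).
Proof. by move=> Hs rs j; apply: gmeas_ind; [exact: (sa Hs).1|exact: FE]. Qed.

Let gW s (f : Om -> \bar R) : real_stopping_time T F s -> gmeas (F_stop T F s) f -> measurable_fun setT f.
Proof. by move=> Hs; apply: gmeasW; exact: (sa Hs).2. Qed.

(** On [J = j] and before [tau], the row total is at most [c], hence so is each of its entries;
    optional stopping applies on events, and [integral_gmeas_eq] adds the weight. *)
Lemma rate_weighted j k s1 s2 (v : Om -> \bar R) :
  real_stopping_time T F s1 -> real_stopping_time T F s2 ->
  (forall w, (rho w <= s1 w)%R) -> (forall w, (s1 w <= s2 w)%R) ->
  (forall w, (s2 w <= tau w)%R) ->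
  gmeas (F_stop T F s1) v -> (forall w, 0 <= v w) ->
  \int[Q j]_w (v w * (rate S j k (s2 w) w * ind j w)) =
  \int[Q j]_w (v w * (rate S j k (s1 w) w * ind j w)).
Proof.
move=> H1 H2 r1 s12 s2t gv v0.
have r2 w : (rho w <= s2 w)%R by exact: le_trans (r1 w) (s12 w).
have m s : real_stopping_time T F s -> (forall w, (rho w <= s w)%R) ->
    measurable_fun setT (fun w => rate S j k (s w) w * ind j w).
  move=> Hs rs; apply: (gW Hs); apply: gmeasM; [exact: (sa Hs).1| |exact: ind_gmeas].
  exact: rate_gmeas.
have p s : real_stopping_time T F s -> forall w, 0 <= rate S j k (s w) w * ind j w.
  by move=> Hs w; rewrite mule_ge0// (rate_ge0 HS)// itv.
apply: (integral_gmeas_eq (sa H1)) => //; [exact: m|exact: m|exact: p|exact: p|].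
move=> A FA; rewrite !integral_ind.
have FAE : F_stop T F s1 (A `&` E j).
  by apply: (sigma_algebra_setI (sa H1).1) => //; exact: FE.
apply: (local_martingale_optional_stopping T0 HF HR (HQ j k) _ _ _ H1 H2 s12 FAE c0).
- by move=> t w; exact: (rate_ge0 HS).
- exact: rate_adapted.
- exact: (rate_right_continuous HS).
move=> w t [Aw Ew] /andP[s1t ts2].
have t0T : (0 <= t <= T)%R.
  have /andP[a _] := itv H1 w; have /andP[_ b] := itv H2 w.
  by rewrite (le_trans a s1t) (ltW (lt_le_trans ts2 b)).
apply: le_trans (exchange_le_row_sum (process_matrix HS w t0T) j k) _.
apply: (first_passage_before (E := E) (Y := row_total S) Hrho Ew).
by rewrite (le_trans (r1 w) s1t) (lt_le_trans ts2 (s2t w)).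
Qed.

Lemma mule_total j s (v : \bar R) : real_stopping_time T F s ->
  forall w, v * (row_total S j (s w) w * ind j w) = \sum_(k < d) v * (rate S j k (s w) w * ind j w).
Proof.
move=> Hs w; have r0 k : 0 <= rate S j k (s w) w by apply: (rate_ge0 HS); exact: itv.
rewrite /row_total /row_sum ge0_sume_distrl; last by move=> k _; exact: r0.
rewrite ge0_sume_distrr//.
by move=> k _; apply: mule_ge0; [exact: r0|exact: ind0].
Qed.

Lemma integral_mule_total j s (v : Om -> \bar R) : real_stopping_time T F s -> (forall w, (rho w <= s w)%R) ->
  measurable_fun setT v -> (forall w, 0 <= v w) ->
  \int[Q j]_w (v w * (row_total S j (s w) w * ind j w)) =
  \sum_(k < d) \int[Q j]_w (v w * (rate S j k (s w) w * ind j w)).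
Proof.
move=> Hs rs mv v0.
under eq_integral do rewrite mule_total//.
rewrite ge0_integral_sum//.
- move=> k; apply: emeasurable_funM => //.
  apply: (gW Hs); apply: gmeasM; [exact: (sa Hs).1| |exact: ind_gmeas].
  exact: rate_gmeas.
- move=> k w _; rewrite mule_ge0// mule_ge0// (rate_ge0 HS)//; exact: itv.
Qed.

Lemma total_weighted j s1 s2 (v : Om -> \bar R) :
  real_stopping_time T F s1 -> real_stopping_time T F s2 ->
  (forall w, (rho w <= s1 w)%R) -> (forall w, (s1 w <= s2 w)%R) ->
  (forall w, (s2 w <= tau w)%R) ->
  gmeas (F_stop T F s1) v -> (forall w, 0 <= v w) ->
  \int[Q j]_w (v w * (row_total S j (s2 w) w * ind j w)) =
  \int[Q j]_w (v w * (row_total S j (s1 w) w * ind j w)).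
Proof.
move=> H1 H2 r1 s12 s2t gv v0.
have r2 w : (rho w <= s2 w)%R by exact: le_trans (r1 w) (s12 w).
have mv := gW H1 gv.
rewrite (integral_mule_total j H2 r2 mv v0) (integral_mule_total j H1 r1 mv v0).
by apply: eq_bigr => k _; exact: rate_weighted.
Qed.

(** [Y_j] at [rho] need not be integrable, but after multiplication by the price at [rho] it equals
    1 on [J = j]. The weighted total at [s] is therefore integrable, and the weight is positive. *)
Lemma total_finite_ae j s : real_stopping_time T F s ->
  (forall w, (rho w <= s w)%R) -> (forall w, (s w <= tau w)%R) ->
  {ae Q j, forall w, E j w -> row_total S j (s w) w < +oo}.
Proof.
move=> Hs rs st.
have gz : gmeas (F_stop T F rho) (fun w => price S j (rho w) w) by exact: price_gmeas.
have z0 w : 0 <= price S j (rho w) w by apply: (price_ge0 HS); exact: itv.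
pose X w := price S j (rho w) w * (row_total S j (s w) w * ind j w).
have X0 w : 0 <= X w.
  by rewrite mule_ge0// mule_ge0// (total_ge0 HS)//; exact: itv.
have mX : measurable_fun setT X.
  apply: (gW Hs); apply: gmeasM; [exact: (sa Hs).1| |].
    apply: gmeas_sub gz; exact: F_stop_mono.
  apply: gmeasM; [exact: (sa Hs).1|exact: total_gmeas|exact: ind_gmeas].
have iX : (Q j).-integrable setT X.
  apply/integrableP; split => //.
  under eq_integral do rewrite gee0_abs//.
  rewrite (total_weighted j Hrho Hs _ rs st)//.
  apply: (@le_lt_trans _ _ (\int[Q j]_w 1)).
    apply: ge0_le_integral => //.
    - move=> w _; rewrite mule_ge0// mule_ge0// (total_ge0 HS)//; exact: itv.
    - apply: (gW Hrho); apply: gmeasM; [exact: (sa Hrho).1|exact: price_gmeas|].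
      apply: gmeasM; [exact: (sa Hrho).1|exact: total_gmeas|exact: ind_gmeas].
    - move=> w _; have [Ew|nE] := pselect (E j w); last by rewrite (indN nE) !mule0.
      rewrite ind1// mule1 /row_total /price.
      have HM := process_matrix HS w (itv Hrho w).
      have jy : row_sum (S (rho w) w) j < +oo by have := HJ w; rewrite Ew.
      by rewrite basket_mul_row_sum//; case: HM => _ -> _.
  rewrite integral_cst// mul1e -ge0_fin_numE//; exact: fin_num_measure.
have := integrable_ae measurableT iX; apply: filterS => w /(_ I) Xw Ew.
have jy : row_sum (S (rho w) w) j < +oo by have := HJ w; rewrite Ew.
have pj := basket_gt0 (process_matrix HS w (itv Hrho w)) jy.
rewrite ltey; apply/eqP => ty; move: Xw; rewrite /X ind1// mule1 ty gt0_muley//.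
Qed.

Section pasting.
Variables (mu : {measure set Om -> \bar R}) (D : 'I_d -> Om -> \bar R).
Hypotheses (gD : forall j, gmeas (F_stop T F rho) (D j)) (D0 : forall j w, 0 <= D j w)
  (DE : forall j A, F_stop T F rho A -> \int[Q j]_(w in A) D j w = mu (A `&` [set w | J w = j])).

(** [D j] carries [mu] on [J = j], seen from the past of [rho], over to [Q j]. The remaining factor
    is [Y_j(tau) / Y_j(rho)], as the price at [rho] is the inverse of the row total there. *)
Definition pasting_density j w :=
  D j w * (price S j (rho w) w * (row_total S j (tau w) w * (\1_[set w | J w = j] w)%:E)).

Let Htau : real_stopping_time T F tau := switch_time_stop.

Let rtau w : (rho w <= tau w)%R. Proof. by apply: first_passage_ge; exact: Hrho. Qed.

Let z0 k s : real_stopping_time T F s -> forall w, 0 <= price S k (s w) w.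
Proof. by move=> Hs w; apply: (price_ge0 HS); exact: itv. Qed.

Let t0 k s : real_stopping_time T F s -> forall w, 0 <= row_total S k (s w) w.
Proof. by move=> Hs w; apply: (total_ge0 HS); exact: itv. Qed.

Let up s (f : Om -> \bar R) : real_stopping_time T F s -> (forall w, (rho w <= s w)%R) ->
  gmeas (F_stop T F rho) f -> gmeas (F_stop T F s) f.
Proof. by move=> Hs rs; apply: gmeas_sub; exact: F_stop_mono. Qed.

Let gM s (f g : Om -> \bar R) : real_stopping_time T F s ->
  gmeas (F_stop T F s) f -> gmeas (F_stop T F s) g -> gmeas (F_stop T F s) (fun w => f w * g w).
Proof. by move=> Hs; apply: gmeasM; exact: (sa Hs).1. Qed.

Let gz k s : real_stopping_time T F s -> gmeas (F_stop T F s) (fun w => price S k (s w) w).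
Proof. by move=> Hs; exact: price_gmeas. Qed.

Lemma pasting_density_ge0 j w : 0 <= pasting_density j w.
Proof.
by apply: mule_ge0 => //; apply: mule_ge0; [exact: z0|apply: mule_ge0; [exact: t0|exact: ind0]].
Qed.

Lemma pasting_density_measurable j : measurable_fun setT (pasting_density j).
Proof.
apply: (gW Htau); apply: (gM Htau); first exact: up.
apply: (gM Htau); first by apply: up => //; exact: gz.
by apply: (gM Htau); [exact: total_gmeas|exact: ind_gmeas].
Qed.

(** Optional stopping moves [Y_j] from [tau] back to [s], where [Z_k Y_j = S_(j,k)]; the rate is
    then moved back to [rho], where [Z_j S_(j,k) = Z_k]; finally [D j] turns [Q j] into [mu]. *)
Lemma pasting_cell j s f k : real_stopping_time T F s -> (forall w, (rho w <= s w)%R) ->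
  (forall w, (s w <= tau w)%R) -> gmeas (F_stop T F rho) f -> (forall w, 0 <= f w) ->
  \int[Q j]_w (f w * price S k (s w) w * pasting_density j w) =
  \int[mu]_w (f w * price S k (rho w) w * ind j w).
Proof.
move=> Hs rs st gf f0.
pose w1 w := f w * (D j w * price S j (rho w) w).
have w10 w : 0 <= w1 w by rewrite mule_ge0// mule_ge0// z0.
have gw1 : gmeas (F_stop T F rho) w1 by apply: (gM Hrho) => //; apply: (gM Hrho) => //; exact: gz.
have gw1s : gmeas (F_stop T F s) w1 by exact: up.
have rr w : (rho w <= rho w)%R by [].
transitivity (\int[Q j]_w ((w1 w * price S k (s w) w) * (row_total S j (tau w) w * ind j w))).
  apply: eq_integral => w _; rewrite /pasting_density -/(ind j w) /w1 !muleA.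
  congr (_ * _ * _).
  by rewrite [f w * _ * D j w]muleAC [f w * _ * _ * price S j _ _]muleAC.
have gzs : gmeas (F_stop T F s) (fun w => w1 w * price S k (s w) w) by apply: (gM Hs) => //; exact: gz.
rewrite (total_weighted j Hs Htau rs st _ gzs)//; last first.
  by move=> w; rewrite mule_ge0// z0.
transitivity (\int[Q j]_w (w1 w * (rate S j k (s w) w * ind j w))).
  apply: ge0_ae_eq_integral => //.
  - by apply: (gW Hs); apply: (gM Hs) => //; apply: (gM Hs); [exact: total_gmeas|exact: ind_gmeas].
  - by apply: (gW Hs); apply: (gM Hs) => //; apply: (gM Hs); [exact: rate_gmeas|exact: ind_gmeas].
  - by move=> w _; rewrite mule_ge0// mule_ge0 ?z0// t0.
  - by move=> w _; rewrite mule_ge0// mule_ge0// (rate_ge0 HS)// itv.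
  apply: filterS (total_finite_ae j Hs rs st) => w Ew _.
  have [Ejw|nE] := pselect (E j w); last by rewrite (indN nE) !mule0.
  rewrite ind1// !mule1 -muleA; congr (_ * _).
  by apply: (basket_mul_row_sum (process_matrix HS w (itv Hs w))); exact: Ew.
rewrite (rate_weighted j k Hrho Hs rr rs st gw1 w10).
pose w2 w := f w * price S k (rho w) w * ind j w.
have gw2 : gmeas (F_stop T F rho) w2.
  by apply: (gM Hrho); [apply: (gM Hrho) => //; exact: gz|exact: ind_gmeas].
have w20 w : 0 <= w2 w by rewrite mule_ge0// mule_ge0// z0.
transitivity (\int[Q j]_w (w2 w * D j w)).
  apply: eq_integral => w _; rewrite /w1 /w2.
  have [Ejw|nE] := pselect (E j w); last by rewrite (indN nE) !mule0 mul0e.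
  rewrite ind1// !mule1 -!muleA; congr (_ * _).
  have jy : row_sum (S (rho w) w) j < +oo by have := HJ w; rewrite Ejw.
  have := mul_basket_exchange (process_matrix HS w (itv Hrho w)) k jy.
  by rewrite /price /rate => ->; rewrite muleC.
transitivity (\int[mu]_w (w2 w * ind j w)).
  apply: (integral_gmeas_eq (sa Hrho)) => //; [exact: (gW Hrho)| |].
    by apply: (gW Hrho); exact: ind_gmeas.
  move=> A FA; rewrite DE//.
  have mA : measurable A by case: FA.
  have mE : measurable (E j) by case: (FJ j).
  by rewrite integral_indic// setIC.
apply: eq_integral => w _; rewrite /w2.
have [Ejw|nE] := pselect (E j w); last by rewrite (indN nE) !mule0.
by rewrite ind1// !mule1.
Qed.

(** The cells [J = j] partition the space, so the identities of [pasting_cell] add up. The weight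
    [f] makes the result a conditional martingale property from [rho] to [tau]. *)
Lemma pasting_exists : exists mu' : {measure set Om -> \bar R},
  (forall A, mu' A = \sum_(j < d) \int[Q j]_(w in A) pasting_density j w) /\
  (forall s f k, real_stopping_time T F s -> (forall w, (rho w <= s w)%R) ->
    (forall w, (s w <= tau w)%R) -> gmeas (F_stop T F rho) f -> (forall w, 0 <= f w) ->
    \int[mu']_w (f w * price S k (s w) w) = \int[mu]_w (f w * price S k (rho w) w)).
Proof.
have [m Hm] := choice (fun j => density_measure_exists (Q j)
   (@pasting_density_measurable j) (pasting_density_ge0 j)).
have [mu' [mu'E mu'i]] := measure_sum_exists m.
exists mu'; split.
  by move=> A; rewrite mu'E; apply: eq_bigr => j _; exact: (Hm j).1.
move=> s f k Hs rs st gf f0.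
have mfz s' : real_stopping_time T F s' -> (forall w, (rho w <= s' w)%R) ->
    measurable_fun setT (fun w => f w * price S k (s' w) w).
  by move=> Hs' rs'; apply: (gW Hs'); apply: (gM Hs'); [exact: up|exact: gz].
have fz0 s' : real_stopping_time T F s' -> forall w, 0 <= f w * price S k (s' w) w.
  by move=> Hs' w; rewrite mule_ge0// z0.
rewrite mu'i; [|exact: mfz|exact: fz0].
transitivity (\sum_(j < d) \int[mu]_w (f w * price S k (rho w) w * ind j w)).
  apply: eq_bigr => j _; rewrite (Hm j).2; [|exact: mfz|exact: fz0].
  exact: pasting_cell.
have mind j : measurable_fun setT (ind j) by apply: (gW Hrho); exact: ind_gmeas.
have mf0 := mfz rho Hrho (fun w => lexx _).
rewrite -ge0_integral_sum//; last 2 first.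
- by move=> j; exact: emeasurable_funM.
- by move=> j w _; rewrite mule_ge0// fz0.
apply: eq_integral => w _; rewrite (bigD1 (J w))//= ind1// mule1 big1 ?adde0// => j jJ.
rewrite indN ?mule0// /E /= => JE.
by rewrite JE eqxx in jJ.
Qed.

End pasting.
End step.

(** * Consequences of NOD *)

Section null_sets.
Context {R : realType} {dO} {Om : measurableType dO} (d : nat).
Variable Q : 'I_d -> probability Om R.
Local Open Scope ereal_scope.

Lemma Qsum_eq0 A : Qsum Q A = 0 <-> forall i, Q i A = 0.
Proof.
rewrite QsumE; split => [Q0 i|Q0]; last by rewrite big1.
apply/eqP; rewrite eq_le measure_ge0 andbT -Q0 (bigD1 i)//= leeDl//.
by apply: sume_ge0 => k _; exact: measure_ge0.
Qed.

Lemma Pmix_eq0 A : (0 < d)%N -> Pmix Q A = 0 <-> forall i, Q i A = 0.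
Proof.
have PE : Pmix Q A = (d%:R^-1)%:E * Qsum Q A by [].
move=> d0; rewrite -Qsum_eq0 PE; split => [/eqP|->]; last by rewrite mule0.
by rewrite mule_eq0 eqe invr_eq0 pnatr_eq0 gtn_eqF//= => /eqP.
Qed.

Lemma Pmix_lty : Pmix Q setT < +oo.
Proof.
have -> : Pmix Q setT = (d%:R^-1)%:E * Qsum Q setT by [].
rewrite lte_mul_pinfty ?lee_fin ?invr_ge0// QsumE; apply/lte_sum_pinfty => i _.
by rewrite -ge0_fin_numE//; exact: fin_num_measure.
Qed.

End null_sets.

Section domination.
Context {R : realType} {dO} {Om : measurableType dO} (T : R) (F : R -> set (set Om)).
Hypotheses (T0 : 0 < T) (HF : filtration T F) (HR : right_continuous_filtration T F).
Context (d : nat) (S : R -> Om -> 'I_d -> 'I_d -> \bar R).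
Hypotheses (d0 : (0 < d)%N) (HS : exchange_process T F S).
Variable Q : 'I_d -> probability Om R.
Local Open Scope ereal_scope.

Lemma real_stopping_time_ereal rho : real_stopping_time T F rho ->
  stopping_time T F (EFin \o rho).
Proof.
move=> [r0T Fr]; split => [w|t t0]; first by rewrite lee_fin; case/andP: (r0T w).
rewrite /Fx; case: (leP T t) => [Tt|tT] /=.
- rewrite (_ : [set w | _] = setT); last first.
    apply/seteqP; split => // w _ /=; rewrite lee_fin (le_trans _ Tt)//.
    by case/andP: (r0T w).
  by apply: sigma_algebra_setT; apply: (filtration_sigma_algebra HF); rewrite lexx ltW.
- by apply: Fr; rewrite t0.
Qed.

(** For [t >= T] the condition in [F_at] is measurability again, because [rho <= T] and
    [F(t) = F(T)]. *)
Lemma F_atE rho : real_stopping_time T F rho -> F_at T F (EFin \o rho) = F_stop T F rho.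
Proof.
move=> [r0T Fr]; apply/seteqP; split => A [mA FA]; split => // t.
  move=> /andP[t0 tT]; have := FA t t0; rewrite /Fx min_l ?(ltW tT)//.
move=> t0; rewrite /Fx; case: (leP T t) => [Tt|tT] /=; last by apply: FA; rewrite t0.
rewrite (_ : [set w | _] = setT) ?setIT; last first.
  apply/seteqP; split => // w _ /=; rewrite lee_fin (le_trans _ Tt)//.
  by case/andP: (r0T w).
by case: HF => _ _ ->.
Qed.

Hypothesis Hnod : NOD T F S (Pmix Q).
Hypothesis Hequiv : forall i A, measurable A ->
  (Q i (A `&` [set w | active (S T w) i]) = 0 <->
   Qsum Q (A `&` [set w | active (S T w) i]) = 0).

(** Let [C] be the event that [j] is active at [T] and [h] the conditional probability of [C] at
    [rho]. From [Q j A = 0] and (iii), all the measures vanish on the intersection of [A] and [C],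
    so [h] integrates to 0 over [A]; NOD makes [h] positive there, hence [A] is null. *)
Lemma active_domination rho j A : real_stopping_time T F rho -> F_stop T F rho A ->
  (forall w, A w -> row_total S j (rho w) w < +oo) ->
  Q j A = 0 -> forall i, Q i A = 0.
Proof.
move=> Hrho FA actA QA0; apply/Pmix_eq0 => //.
have [mA _] := FA; have sa := F_stop_sub_algebra HF Hrho.
pose C := [set w | active (S T w) j].
have TT : (0 <= T <= T)%R by rewrite lexx ltW.
have mC : measurable C.
  apply: (filtration_measurable HF TT).
  have -> : C = row_total S j T @^-1` [set y | y < +oo] by [].
  by apply: (total_adapted HF HS) => //; rewrite -set_itvNyo; exact: emeasurable_itv.
have Poo := Pmix_lty Q.
have [h [gh h0 hE]] : exists h, [/\ gmeas (F_stop T F rho) h, forall x, 0 <= h x &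
    forall B, F_stop T F rho B -> \int[Pmix Q]_(x in B) h x = mrestr (Pmix Q) mC B].
  apply: radon_nikodym_sub => //.
    by rewrite /mrestr /=; apply: le_lt_trans Poo; apply: le_measure; rewrite ?inE//; exact: measurableI.
  move=> B FB PB0; have [mB _] := FB; rewrite /= /mrestr.
  by apply: (@subset_measure0 _ _ _ (Pmix Q) (B `&` C) B) => //; exact: measurableI.
have mh : measurable_fun setT h by apply: gmeasW gh; exact: sa.2.
have cp : cond_prob (Pmix Q) (F_at T F (EFin \o rho)) C h.
  rewrite F_atE//; split => //.
  apply/integrableP; split => //; under eq_integral do rewrite gee0_abs//.
  rewrite hE; last by apply: sigma_algebra_setT; exact: sa.1.
  apply: le_lt_trans Poo; apply: le_measure; rewrite ?inE//; exact: measurableI.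
have hpos := Hnod (real_stopping_time_ereal Hrho) cp.
have hA0 : \int[Pmix Q]_(x in A) h x = 0.
  rewrite hE// /mrestr; apply/Pmix_eq0 => //; apply/Qsum_eq0; apply/Hequiv => //.
  by apply: (subset_measure0 _ mA) => //; exact: measurableI.
have hae : ae_eq (Pmix Q) A h (cst 0).
  apply/ae_eq_integral_abs => //; first exact: measurable_funTS.
  by under eq_integral do rewrite gee0_abs//.
apply: measure_negligible => //.
have : {ae Pmix Q, forall w, ~ A w}.
  apply: filterS2 hpos hae => w hw hA Aw; have := hw (ltry _).
  rewrite /S_at /= min_l; last by case: Hrho => /(_ w)/andP[].
  by move=> /(_ (actA w Aw)); rewrite (hA Aw) ltxx.
rewrite /almost_everywhere /prop_near1 /nbhs /=; congr (_.-negligible _).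
by apply/seteqP; split => w /=; [rewrite notE|move=> Aw /(_ Aw)].
Qed.

End domination.

Section strongest.
Context {R : realType} {dO} {Om : measurableType dO} (T : R) (F : R -> set (set Om)).
Hypotheses (T0 : 0 < T) (HF : filtration T F) (HR : right_continuous_filtration T F).
Context (d : nat) (S : R -> Om -> 'I_d -> 'I_d -> \bar R).
Hypotheses (d0 : (0 < d)%N) (HS : exchange_process T F S).
Local Open Scope ereal_scope.

(** Taking the least index with row total at most [d] makes the choice depend only on the past of
    [rho]. *)
Lemma strongest_exists rho : real_stopping_time T F rho -> exists J : Om -> 'I_d,
  (forall w, row_total S (J w) (rho w) w <= d%:R%:E) /\
  (forall j, F_stop T F rho [set w | J w = j]).
Proof.
move=> Hrho; have [r0T _] := Hrho; have [sa _] := F_stop_sub_algebra HF Hrho.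
pose b (w : Om) j := row_total S j (rho w) w <= d%:R%:E.
have H w : exists j, b w j /\ forall i, b w i -> (j <= i)%N.
  have [j0 bj0] := exists_row_sum_le (process_matrix HS w (r0T w)) d0.
  by have [j bj jmin] := @arg_minnP _ j0 (b w) (fun i => val i) bj0; exists j.
have [J HJ] := choice H.
exists J; split; first by move=> w; case: (HJ w).
move=> j.
have gb i : F_stop T F rho [set w | b w i].
  have -> : [set w | b w i] = (fun w => row_total S i (rho w) w) @^-1` [set y | y <= d%:R%:E] by [].
  apply: (total_gmeas T0 HF HR HS Hrho).
  by rewrite -set_itvNyc; exact: emeasurable_itv.
have -> : [set w | J w = j] = [set w | b w j] `\`
    [set w | exists i : 'I_d, (if (i < j)%N then [set w | b w i] else set0) w].
  apply/seteqP; split => w /=.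
    move=> <-; case: (HJ w) => bJ Jmin; split => // -[i]; case: ifP => // iJ /Jmin.
    by rewrite leqNgt iJ.
  move=> [bj nb]; case: (HJ w) => bJ Jmin; apply/eqP; rewrite -val_eqE eqn_leq Jmin//=.
  rewrite leqNgt; apply/negP => Jj; apply: nb; exists (J w); by rewrite Jj.
apply: (sigma_algebra_setD sa) => //.
apply: (sigma_algebra_bigsetU_ord sa) => i; case: ifP => // _; by case: sa.
Qed.

End strongest.

(** * Iterated switching *)

Section switching.
Context {R : realType} {dO} {Om : measurableType dO} (T : R) (F : R -> set (set Om)).
Hypotheses (T0 : 0 < T) (HF : filtration T F) (HR : right_continuous_filtration T F).
Context (d : nat) (S : R -> Om -> 'I_d -> 'I_d -> \bar R).
Hypotheses (d0 : (0 < d)%N) (HS : exchange_process T F S).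
Variable Q : 'I_d -> probability Om R.
Local Open Scope ereal_scope.
Implicit Types (rho sigma tau : Om -> R) (mu nu : {measure set Om -> \bar R}).

Definition dominated mu := forall A, measurable A -> (forall j, Q j A = 0) -> mu A = 0.

(** The martingale property of the prices stopped at [rho], expressed by equal expectations [a k] at
    all stopping times; this form survives pasting and limits. *)
Definition stopped_martingale_measure (a : 'I_d -> \bar R) rho mu :=
  [/\ real_stopping_time T F rho, dominated mu, mu setT = 1 &
      forall tau k, real_stopping_time T F tau ->
        \int[mu]_w price S k (Num.min (tau w) (rho w)) w = a k].

(** The conditional martingale property between [rho] and [rho']. Agreement of the two measures on
    the past of [rho] is not stated: it follows by taking [sigma = rho] and summing over [k]. *)
Definition martingale_extension rho mu rho' mu' :=
  (forall w, (rho w <= rho' w)%R) /\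
  forall sigma f k, real_stopping_time T F sigma ->
    (forall w, (rho w <= sigma w)%R) -> (forall w, (sigma w <= rho' w)%R) ->
    gmeas (F_stop T F rho) f -> (forall w, 0 <= f w) ->
    \int[mu']_w (f w * price S k (sigma w) w) = \int[mu]_w (f w * price S k (rho w) w).

Let sa rho : real_stopping_time T F rho -> sub_algebra (F_stop T F rho).
Proof. exact: F_stop_sub_algebra. Qed.

Let z0 k rho : real_stopping_time T F rho -> forall w, 0 <= price S k (rho w) w.
Proof. by move=> [r0T _] w; exact: (price_ge0 HS). Qed.

Let gz k rho : real_stopping_time T F rho ->
  gmeas (F_stop T F rho) (fun w => price S k (rho w) w).
Proof. by move=> Hrho; exact: price_gmeas. Qed.

Let mz k rho : real_stopping_time T F rho -> measurable_fun setT (fun w => price S k (rho w) w).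
Proof. by move=> Hrho; apply: (gmeasW (sa Hrho).2); exact: gz. Qed.

Lemma sum_price rho w : real_stopping_time T F rho ->
  \sum_(k < d) price S k (rho w) w = 1.
Proof. by move=> [r0T _]; exact: (sum_basket (process_matrix HS w (r0T w))). Qed.

Lemma integral_sum_price mu rho (f : Om -> \bar R) : real_stopping_time T F rho ->
  measurable_fun setT f -> (forall w, 0 <= f w) ->
  \int[mu]_w f w = \sum_(k < d) \int[mu]_w (f w * price S k (rho w) w).
Proof.
move=> Hrho mf f0; rewrite -ge0_integral_sum//; last 2 first.
- by move=> k; apply: emeasurable_funM => //; exact: mz.
- by move=> k w _; rewrite mule_ge0// z0.
apply: eq_integral => w _; rewrite -ge0_sume_distrr; last by move=> k _; exact: z0.
by rewrite sum_price// mule1.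
Qed.

Section extension.
Variables (rho rho' : Om -> R) (mu mu' : {measure set Om -> \bar R}).
Hypotheses (Hrho : real_stopping_time T F rho) (Hrho' : real_stopping_time T F rho')
  (Hext : martingale_extension rho mu rho' mu').

Lemma extension_integral f : gmeas (F_stop T F rho) f -> (forall w, 0 <= f w) ->
  \int[mu']_w f w = \int[mu]_w f w.
Proof.
move=> gf f0; have mf : measurable_fun setT f by exact: gmeasW (sa Hrho).2 gf.
rewrite (integral_sum_price mu' Hrho mf f0) (integral_sum_price mu Hrho mf f0).
by apply: eq_bigr => k _; case: Hext => rr; apply.
Qed.

Lemma extension_measure A : F_stop T F rho A -> mu' A = mu A.
Proof.
move=> FA; have [mA _] := FA.
have := @extension_integral (fun w => (\1_A w)%:E).
rewrite !integral_indic// !setIT; apply.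
  by apply: (gmeas_ind (sa Hrho).1).
by move=> w; rewrite lee_fin.
Qed.

(** Where [tau < rho], the stopped price is known at [rho] and its integral does not change. Where
    [rho <= tau], it is the price at [max rho (min tau rho')], a time between [rho] and [rho'], to
    which the extension property applies. *)
Lemma extension_stopped_martingale a : stopped_martingale_measure a rho mu ->
  dominated mu' -> stopped_martingale_measure a rho' mu'.
Proof.
move=> [_ _ mu1 Ha] ac'; have [rr Hx] := Hext; split => //.
  by rewrite extension_measure//; apply: sigma_algebra_setT; exact: (sa Hrho).1.
move=> tau k Htau; rewrite -(Ha tau k Htau).
pose B := [set w | (rho w <= tau w)%R].
have FB : F_stop T F rho B by exact: F_stop_le.
have FBc : F_stop T F rho (~` B) by apply: sigma_algebra_setC => //; exact: (sa Hrho).1.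
have mB : measurable B by case: FB.
have Hm := real_stopping_time_min HF Htau Hrho.
have Hm' := real_stopping_time_min HF Htau Hrho'.
have Hs := real_stopping_time_max HF Hrho Hm'.
pose s w := Num.max (rho w) (Num.min (tau w) (rho' w)).
pose f1 w := (\1_(~` B) w)%:E * price S k (Num.min (tau w) (rho w)) w.
pose f2 w : \bar R := (\1_B w)%:E.
have gf1 : gmeas (F_stop T F rho) f1.
  apply: (gmeasM (sa Hrho).1); first exact: (gmeas_ind (sa Hrho).1).
  apply: gmeas_sub (gz k Hm); apply: F_stop_mono => // w.
  by rewrite ge_min lexx orbT.
have gf2 : gmeas (F_stop T F rho) f2 by exact: (gmeas_ind (sa Hrho).1).
have f10 w : 0 <= f1 w by apply: mule_ge0; [rewrite lee_fin|exact: (z0 k Hm)].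
have f20 w : 0 <= f2 w by rewrite lee_fin.
have mf1 := gmeasW (sa Hrho).2 gf1.
have mf2 := gmeasW (sa Hrho).2 gf2.
transitivity (\int[mu']_w (f1 w + f2 w * price S k (s w) w)).
  apply: eq_integral => w _; rewrite /f1 /f2 !indicE.
  have [rt|tr] := leP (rho w) (tau w).
    rewrite memNset ?mul0e ?add0e; last by move=> /= /(_ rt).
    rewrite mem_set// mul1e /s max_r//.
    by rewrite le_min rt rr.
  have nB : ~ B w by rewrite /B /= => /(lt_le_trans tr); rewrite ltxx.
  rewrite mem_set// mul1e memNset// mul0e adde0 !min_l// ?(ltW tr)//.
  by rewrite (le_trans (ltW tr)).
rewrite ge0_integralD//; last 2 first.
- by move=> w _; rewrite mule_ge0// z0.
- by apply: emeasurable_funM => //; exact: mz.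
rewrite extension_integral// Hx//; last 2 first.
- by move=> w; rewrite /s le_max lexx.
- by move=> w; rewrite /s ge_max rr ge_min lexx orbT.
rewrite -ge0_integralD//; last 2 first.
- by move=> w _; rewrite mule_ge0// z0.
- by apply: emeasurable_funM => //; exact: mz.
apply: eq_integral => w _; rewrite /f1 /f2 !indicE.
have [rt|tr] := leP (rho w) (tau w).
  rewrite memNset ?mul0e ?add0e; last by move=> /= /(_ rt).
  by rewrite mem_set// mul1e.
have nB : ~ B w by rewrite /B /= => /(lt_le_trans tr); rewrite ltxx.
by rewrite mem_set// mul1e memNset// mul0e adde0.
Qed.

End extension.

Lemma initial_stopped_martingale i : stopped_martingale_measure
  (fun k => \int[Q i]_w price S k 0 w) (cst 0%R) (Q i).
Proof.
have H0 : real_stopping_time T F (cst 0%R).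
  by apply: real_stopping_time_cst; rewrite ?lexx ?ltW.
split => //.
- by move=> A _ QA; exact: QA.
- exact: probability_setT.
- move=> tau k [t0T _]; apply: eq_integral => w _; congr (price S k _ w).
  by rewrite min_r//; case/andP: (t0T w).
Qed.

Section next_switch.
Hypothesis HQ : forall j k, local_martingale T F (Q j) (fun t w => S t w j k).
Hypothesis Hdom : forall rho j A, real_stopping_time T F rho -> F_stop T F rho A ->
  (forall w, A w -> row_total S j (rho w) w < +oo) -> Q j A = 0 -> forall i, Q i A = 0.

(** The bounds translate [Y_j <= d] at the choice of [j] and [Y_j >= 2d] at its passage time; no
    passage has occurred if [rho' = T]. *)
Definition price_gap rho rho' := forall w, (rho' w < T)%R -> exists j,
  (d%:R^-1)%:E <= price S j (rho w) w /\
  price S j (rho' w) w <= ((2 * d%:R)^-1)%:E.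

Lemma next_switch a rho mu : stopped_martingale_measure a rho mu -> exists rho' mu',
  [/\ stopped_martingale_measure a rho' mu', martingale_extension rho mu rho' mu' &
      price_gap rho rho'].
Proof.
move=> Hmu; have [Hrho ac mu1 Ha] := Hmu; have [r0T _] := Hrho.
have [J [Jd FJ]] := strongest_exists T0 HF HR d0 HS Hrho.
have Joo w : row_total S (J w) (rho w) w < +oo by apply: le_lt_trans (Jd w) _; exact: ltry.
have c0 : (0 <= 2 * d%:R :> R)%R by rewrite mulr_ge0.
(* Currency [j] is active at [rho] on [J = j], so there [Q j] dominates every [Q i] on the past of
   [rho], and hence dominates [mu]. *)
have HD j : exists h, [/\ gmeas (F_stop T F rho) h, forall w, 0 <= h w &
    forall A, F_stop T F rho A -> \int[Q j]_(w in A) h w = mu (A `&` [set w | J w = j])].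
  have mE : measurable [set w | J w = j] by case: (FJ j).
  have [h [h1 h2 h3]] : exists h, [/\ gmeas (F_stop T F rho) h, forall w, 0 <= h w &
      forall A, F_stop T F rho A -> \int[Q j]_(w in A) h w = mrestr mu mE A].
    apply: radon_nikodym_sub.
    - exact: sa.
    - by rewrite -ge0_fin_numE//; exact: fin_num_measure.
    - rewrite /= /mrestr; apply: (@le_lt_trans _ _ (mu setT)); last by rewrite mu1 ltry.
      by apply: le_measure; rewrite ?inE//; exact: measurableI.
    - move=> A FA QA; have [mA _] := FA; rewrite /= /mrestr; apply: ac.
        exact: measurableI.
      apply: (Hdom (rho := rho) (j := j)) => //.
      + by apply: (sigma_algebra_setI (sa Hrho).1).
      + by move=> w [_ /= <-].
      + by apply: (@subset_measure0 _ _ _ (Q j) (A `&` [set w | J w = j]) A) => //; exact: measurableI.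
  by exists h.
have [D HD'] := choice HD.
have gD j : gmeas (F_stop T F rho) (D j) by case: (HD' j).
have D0 j w : 0 <= D j w by case: (HD' j).
have DE j A : F_stop T F rho A -> \int[Q j]_(w in A) D j w = mu (A `&` [set w | J w = j]).
  by case: (HD' j) => _ _; apply.
have [mu' [mu'E Hx]] := pasting_exists T0 HF HR HS HQ Hrho c0 FJ Joo gD D0 DE.
pose rho' := switch_time T S rho J (2 * d%:R).
have Hrho' : real_stopping_time T F rho' by exact: (switch_time_stop HF HR HS _ Hrho FJ).
have rr w : (rho w <= rho' w)%R by apply: first_passage_ge; exact: Hrho.
exists rho', mu'.
have Hext : martingale_extension rho mu rho' mu' by split.
split => //.
- apply: (extension_stopped_martingale Hrho Hrho' Hext) => //.
  move=> A mA QA; rewrite mu'E big1// => j _; apply: null_set_integral => //; last exact: QA.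
  apply: measurable_funTS.
  exact: (pasting_density_measurable T0 HF HR HS _ Hrho FJ gD).
- move=> w rT.
  have rY j : right_continuous_paths T (row_total S j) by exact: (total_right_continuous HS).
  have [j Jj cY] := first_passage_at HF HR Hrho FJ (total_adapted HF HS) rY rT.
  have HM := process_matrix HS w (r0T w).
  exists j; split.
    by apply: (le_basket HM); have := Jd w; rewrite Jj.
  apply: (basket_le (process_matrix HS w _)) cY; last by rewrite mulr_gt0// ltr0n.
  by case: Hrho' => /(_ w).
Qed.

End next_switch.

End switching.

(** * Energy estimate and limit measure *)

Section limit_measure.
Context {R : realType} {dO} {Om : measurableType dO} (T : R) (F : R -> set (set Om)).
Hypotheses (T0 : 0 < T) (HF : filtration T F) (HR : right_continuous_filtration T F).
Context (d : nat) (S : R -> Om -> 'I_d -> 'I_d -> \bar R).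
Hypotheses (d0 : (0 < d)%N) (HS : exchange_process T F S).
Variable Q : 'I_d -> probability Om R.
Local Open Scope ereal_scope.
Implicit Types (rho sigma tau : Om -> R) (mu nu : {measure set Om -> \bar R}).

Let sa rho : real_stopping_time T F rho -> sub_algebra (F_stop T F rho).
Proof. exact: F_stop_sub_algebra. Qed.

Let z0 k rho : real_stopping_time T F rho -> forall w, 0 <= price S k (rho w) w.
Proof. by move=> [r0T _] w; exact: (price_ge0 HS). Qed.

Let gz k rho : real_stopping_time T F rho ->
  gmeas (F_stop T F rho) (fun w => price S k (rho w) w).
Proof. by move=> Hrho; exact: price_gmeas. Qed.

Let mz k rho : real_stopping_time T F rho -> measurable_fun setT (fun w => price S k (rho w) w).
Proof. by move=> Hrho; apply: (gmeasW (sa Hrho).2); exact: gz. Qed.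

Let gap : R := ((2 * d%:R)^-1)%R.

Let gap_gt0 : (0 < gap)%R. Proof. by rewrite invr_gt0 mulr_gt0// ltr0n. Qed.

(** The squared norm of the price vector. It is at most 1, and its expected growth is the expected
    squared increment of the prices. *)
Definition energy rho w := \sum_(k < d) price S k (rho w) w * price S k (rho w) w.

Lemma energy_ge0 rho w : real_stopping_time T F rho -> 0 <= energy rho w.
Proof. by move=> Hrho; apply: sume_ge0 => k _; rewrite mule_ge0// z0. Qed.

Lemma energy_gmeas rho : real_stopping_time T F rho -> gmeas (F_stop T F rho) (energy rho).
Proof.
move=> Hrho; apply/(gmeasE _ (sa Hrho).1); apply: emeasurable_sum => k.
by apply: emeasurable_funM; apply/(gmeasE _ (sa Hrho).1); exact: gz.
Qed.

Lemma energy_measurable rho : real_stopping_time T F rho -> measurable_fun setT (energy rho).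
Proof. by move=> Hrho; exact: gmeasW (sa Hrho).2 (energy_gmeas Hrho). Qed.

Lemma energy_le1 rho w : real_stopping_time T F rho -> energy rho w <= 1.
Proof.
move=> Hrho; rewrite -(sum_price d0 HS w Hrho); apply: lee_sum => k _.
rewrite -[leRHS]mule1; apply: lee_wpmul2l; first exact: z0.
by apply: (price_le1 HS); case: Hrho.
Qed.

Lemma measurable_before rho : real_stopping_time T F rho -> measurable [set w | (rho w < T)%R].
Proof.
move=> Hrho; have := F_stop_eqT T0 HF Hrho measurableT; rewrite setTI => -[mT _].
rewrite (_ : [set w | _] = ~` [set w | rho w = T]); first exact: measurableC.
apply/seteqP; split => w /=; first by move=> /[swap] ->; rewrite ltxx.
by move=> /eqP rT; rewrite lt_neqAle rT; case: Hrho => /(_ w)/andP[].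
Qed.

(* [b^2 + a^2 = 2ab + (b - a)^2], and one of the prices moves by at least [1/d - 1/(2d)]. *)
Lemma energy_pointwise rho rho' w : real_stopping_time T F rho ->
  real_stopping_time T F rho' -> price_gap T S rho rho' ->
  \sum_(k < d) 2%:E * price S k (rho w) w * price S k (rho' w) w +
    (gap ^+ 2)%:E * (\1_[set w | (rho' w < T)%R] w)%:E <= energy rho' w + energy rho w.
Proof.
move=> Hrho Hrho' Hgap.
pose p k : R := ((fine (row_total S k (rho w) w))^-1)%R.
pose q k : R := ((fine (row_total S k (rho' w) w))^-1)%R.
have pE k : price S k (rho w) w = (p k)%:E by rewrite /price basketE.
have qE k : price S k (rho' w) w = (q k)%:E by rewrite /price basketE.
rewrite /energy.
under eq_bigr do rewrite pE qE -!EFinM.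
under [X in _ <= X + _]eq_bigr do rewrite qE -EFinM.
under [X in _ <= _ + X]eq_bigr do rewrite pE -EFinM.
rewrite !sumEFin -EFinM -!EFinD lee_fin.
rewrite -lerBrDl -big_split/= -sumrB.
rewrite (eq_bigr (fun k => (q k - p k) ^+ 2)%R); last by move=> k _; ring.
have [rT|rT] := ltP (rho' w) T; last first.
  rewrite indicE memNset ?mulr0; last by move=> /=; rewrite ltNge rT.
  by apply: sumr_ge0 => k _; exact: sqr_ge0.
rewrite indicE mem_set// mulr1.
have [j [pj qj]] := Hgap w rT.
rewrite (bigD1 j)//=; apply: (@le_trans _ _ ((q j - p j) ^+ 2)%R); last first.
  by rewrite lerDl; apply: sumr_ge0 => k _; exact: sqr_ge0.
move: pj qj; rewrite pE qE !lee_fin => pj qj.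
rewrite -(sqrrN (q j - p j)%R) opprB ler_pXn2r ?nnegrE ?(ltW gap_gt0)//.
  apply: (@le_trans _ _ (d%:R^-1 - (2 * d%:R)^-1)%R); last by apply: lerB.
  by rewrite /gap invfM; have : (0 <= d%:R^-1 :> R)%R by []; lra.
rewrite subr_ge0; apply: (le_trans qj); apply: le_trans pj.
by rewrite lef_pV2 ?posrE ?mulr_gt0 ?ltr0n//; have : (0 <= d%:R :> R)%R by []; lra.
Qed.

(** Integrate [energy_pointwise]: by the extension property with weight [2 * Z_k(rho)], the cross
    terms integrate to twice the energy at [rho]. *)
Lemma energy_increase rho rho' mu mu' : real_stopping_time T F rho ->
  real_stopping_time T F rho' -> mu setT = 1 -> mu' setT = 1 ->
  martingale_extension T F S rho mu rho' mu' -> price_gap T S rho rho' ->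
  \int[mu]_w energy rho w + (gap ^+ 2)%:E * mu' [set w | (rho' w < T)%R] <=
  \int[mu']_w energy rho' w.
Proof.
move=> Hrho Hrho' mu1 mu1' Hext Hgap.
have mB := measurable_before Hrho'.
have bnd nu r : real_stopping_time T F r -> nu setT = 1 -> \int[nu]_w energy r w <= 1.
  move=> Hr nu1; rewrite -nu1 -[leRHS]mul1e -integral_cst//.
  apply: ge0_le_integral => //.
  - by move=> w _; exact: energy_ge0.
  - exact: energy_measurable.
  - by move=> w _; exact: energy_le1.
have fin nu r : real_stopping_time T F r -> nu setT = 1 -> \int[nu]_w energy r w \is a fin_num.
  move=> Hr nu1; rewrite ge0_fin_numE; last by apply: integral_ge0 => w _; exact: energy_ge0.
  by rewrite (le_lt_trans (bnd nu r Hr nu1))// ltry.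
have Bfin : mu' [set w | (rho' w < T)%R] \is a fin_num.
  rewrite ge0_fin_numE//; apply: (@le_lt_trans _ _ (mu' setT)); last by rewrite mu1' ltry.
  by apply: le_measure; rewrite ?inE.
have main : 2%:E * \int[mu]_w energy rho w + (gap ^+ 2)%:E * mu' [set w | (rho' w < T)%R] <=
    \int[mu']_w energy rho' w + \int[mu]_w energy rho w.
  rewrite -(extension_integral T0 HF HR d0 HS Hrho Hext (energy_gmeas Hrho)); last first.
    by move=> w; exact: energy_ge0.
  rewrite -ge0_integralD//; [|by move=> w _; exact: energy_ge0|exact: energy_measurable|by move=> w _; exact: energy_ge0|exact: energy_measurable].
  have m2 k : measurable_fun setT (fun w => 2%:E * price S k (rho w) w * price S k (rho' w) w).
    by apply: emeasurable_funM; [apply: emeasurable_funM => //|]; exact: mz.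
  have p2 k w : 0 <= 2%:E * price S k (rho w) w * price S k (rho' w) w.
    by rewrite mule_ge0// ?z0// mule_ge0// z0.
  have -> : 2%:E * \int[mu']_w energy rho w =
      \int[mu']_w (\sum_(k < d) 2%:E * price S k (rho w) w * price S k (rho' w) w).
    rewrite (extension_integral T0 HF HR d0 HS Hrho Hext (energy_gmeas Hrho)); last first.
      by move=> w; exact: energy_ge0.
    rewrite [RHS]ge0_integral_sum//.
    transitivity (\sum_(k < d) \int[mu]_w (2%:E * price S k (rho w) w * price S k (rho w) w)).
      rewrite -ge0_integralZl//; [|exact: energy_measurable|by move=> w _; exact: energy_ge0].
      rewrite -ge0_integral_sum//; last 2 first.
      - by move=> k; apply: emeasurable_funM; [apply: emeasurable_funM => //|]; exact: mz.
      - by move=> k w _; rewrite mule_ge0// ?z0// mule_ge0// z0.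
      apply: eq_integral => w _; rewrite /energy ge0_sume_distrr.
        by apply: eq_bigr => k _; rewrite muleA.
      by move=> k _; rewrite mule_ge0// z0.
    apply: eq_bigr => k _; case: Hext => rr Hx; rewrite Hx//.
      apply: (gmeasM (sa Hrho).1); last exact: gz.
      exact: (gmeas_cst (sa Hrho).1).
    by move=> w; rewrite mule_ge0// z0.
  have -> : mu' [set w | (rho' w < T)%R] = \int[mu']_w (\1_[set w | (rho' w < T)%R] w)%:E.
    by rewrite integral_indic// setIT.
  have mI : measurable_fun setT (fun w => (\1_[set w | (rho' w < T)%R] w)%:E : \bar R).
    by apply/measurable_EFinP; exact: measurable_indic.
  rewrite -ge0_integralZl//; last by rewrite lee_fin sqr_ge0.
  have mg : measurable_fun setT (fun w => (gap ^+ 2)%:E * (\1_[set w | (rho' w < T)%R] w)%:E).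
    exact: emeasurable_funM.
  have mS : measurable_fun setT (fun w =>
      \sum_(k < d) 2%:E * price S k (rho w) w * price S k (rho' w) w).
    exact: emeasurable_sum.
  have pS w : 0 <= \sum_(k < d) 2%:E * price S k (rho w) w * price S k (rho' w) w.
    by apply: sume_ge0 => k _.
  have pI w : 0 <= (gap ^+ 2)%:E * (\1_[set w | (rho' w < T)%R] w)%:E.
    by rewrite mule_ge0// lee_fin sqr_ge0.
  rewrite -ge0_integralD//; apply: ge0_le_integral => //.
  - by move=> w _; rewrite adde_ge0.
  - exact: emeasurable_funD.
  - by apply: emeasurable_funD; exact: energy_measurable.
  by move=> w _; exact: energy_pointwise.
move: main.
rewrite -(fineK (fin mu rho Hrho mu1)) -(fineK (fin mu' rho' Hrho' mu1')) -(fineK Bfin).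
by rewrite -!EFinM -!EFinD !lee_fin; lra.
Qed.

End limit_measure.

(** * Vanishing of the mass that switches forever, and the limit probability *)

Section limit_measure.
Context {R : realType} {dO} {Om : measurableType dO} (T : R) (F : R -> set (set Om)).
Hypotheses (T0 : 0 < T) (HF : filtration T F) (HR : right_continuous_filtration T F).
Context (d : nat) (S : R -> Om -> 'I_d -> 'I_d -> \bar R).
Hypotheses (d0 : (0 < d)%N) (HS : exchange_process T F S).
Variable Q : 'I_d -> probability Om R.
Local Open Scope ereal_scope.

Definition at_end (rho : Om -> R) (w : Om) : \bar R := (\1_[set w | rho w = T] w)%:E.

Lemma at_end_ge0 rho w : 0 <= at_end rho w. Proof. by rewrite lee_fin. Qed.

(** On [rho = T] every measurable event lies in the past of [rho]; elsewhere the product is 0, which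
    is why the preimage depends on whether [B] contains 0. *)
Lemma gmeas_at_end rho (f : Om -> \bar R) : real_stopping_time T F rho ->
  measurable_fun setT f -> gmeas (F_stop T F rho) (fun w => f w * at_end rho w).
Proof.
move=> Hrho mf B mB; pose C := [set w | rho w = T].
have sa := (F_stop_sub_algebra HF Hrho).1.
have FC : F_stop T F rho C by rewrite -[C]setTI; exact: F_stop_eqT.
have -> : (fun w => f w * at_end rho w) @^-1` B = ((f @^-1` B) `&` C) `|`
    (if 0 \in B then ~` C else set0).
  apply/seteqP; split => w; rewrite /preimage /= /at_end.
    have [Cw|nC] := pselect (C w).
      by rewrite indicE mem_set// mule1 => fB; left.
    rewrite indicE memNset// mule0 => B0; right; rewrite ifT//; exact: mem_set.
  case=> [[fB Cw]|]; first by rewrite indicE mem_set// mule1.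
  by case: ifPn => // /set_mem B0 nC; rewrite indicE memNset// mule0.
apply: (sigma_algebra_setU sa).
  by apply: F_stop_eqT => //; rewrite -[X in measurable X]setTI; exact: mf.
case: ifP => _; last by case: sa.
exact: sigma_algebra_setC.
Qed.

Variables (a : 'I_d -> \bar R) (rho_ : nat -> Om -> R) (mu_ : nat -> {measure set Om -> \bar R}).
Hypotheses (Hinv : forall n, stopped_martingale_measure T F S Q a (rho_ n) (mu_ n))
  (Hext : forall n, martingale_extension T F S (rho_ n) (mu_ n) (rho_ n.+1) (mu_ n.+1))
  (Hgap : forall n, price_gap T S (rho_ n) (rho_ n.+1)).

Let Hrho n : real_stopping_time T F (rho_ n). Proof. by case: (Hinv n). Qed.

Let mu1 n : mu_ n setT = 1. Proof. by case: (Hinv n). Qed.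

Let before n := [set w | (rho_ n w < T)%R].

Let mbefore n : measurable (before n). Proof. by apply: (measurable_before T0 HF); exact: Hrho. Qed.

Let mu_le1 n A : measurable A -> mu_ n A <= 1.
Proof. by move=> mA; rewrite -(mu1 n); apply: le_measure; rewrite ?inE. Qed.

Let mu_fin n A : measurable A -> mu_ n A \is a fin_num.
Proof. by move=> mA; rewrite ge0_fin_numE// (le_lt_trans (mu_le1 n mA))// ltry. Qed.

Let e2 : R := ((2 * d%:R)^-1 ^+ 2)%R.

Let e2_gt0 : (0 < e2)%R. Proof. by rewrite exprn_gt0// invr_gt0 mulr_gt0// ltr0n. Qed.

Let F_before n : F_stop T F (rho_ n) (before n).
Proof.
have sa := (F_stop_sub_algebra HF (Hrho n)).1.
have FC : F_stop T F (rho_ n) [set w | rho_ n w = T].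
  by rewrite -[X in F_stop _ _ _ X]setTI; exact: F_stop_eqT.
rewrite (_ : before n = ~` [set w | rho_ n w = T]); first exact: sigma_algebra_setC.
apply/seteqP; split => w; rewrite /before /=; first by move=> /[swap] ->; rewrite ltxx.
by move=> /eqP rT; rewrite lt_neqAle rT; case: (Hrho n) => /(_ w)/andP[].
Qed.

Let escape_le n : mu_ n.+1 (before n.+1) <= mu_ n (before n).
Proof.
rewrite -(extension_measure T0 HF HR d0 HS (Hrho n) (Hext n) (F_before n)).
apply: le_measure; rewrite ?inE// => w; rewrite /before /=.
by apply: le_lt_trans; case: (Hext n).
Qed.

(** The masses still before [T] decrease with [n], so each of the [n] energy increments is at least
    [e2] times the last of them. As energy is at most 1, that mass is of order [1/n]. *)
Let escape_energy n : (n%:R * e2)%:E * mu_ n (before n) <= \int[mu_ n]_w energy S (rho_ n) w.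
Proof.
elim: n => [|n IH].
  by rewrite mul0r mul0e; apply: integral_ge0 => w _; apply: (energy_ge0 HS); exact: (Hrho 0).
apply: (le_trans _ (energy_increase T0 HF HR d0 HS (Hrho n) (Hrho n.+1) (mu1 n) (mu1 n.+1) (Hext n) (@Hgap n))).
apply: (@le_trans _ _ ((n%:R * e2)%:E * mu_ n (before n) + e2%:E * mu_ n.+1 (before n.+1))); last first.
  by apply: leeD.
apply: (@le_trans _ _ ((n%:R * e2)%:E * mu_ n.+1 (before n.+1) + e2%:E * mu_ n.+1 (before n.+1))).
  rewrite -(fineK (mu_fin n.+1 (mbefore n.+1))) -!EFinM -EFinD lee_fin -natr1; lra.
apply: leeD => //; apply: lee_wpmul2l => //.
by rewrite lee_fin mulr_ge0// ltW.
Qed.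

Let energy_int_le1 n : \int[mu_ n]_w energy S (rho_ n) w <= 1.
Proof.
rewrite -(mu1 n) -[leRHS]mul1e -integral_cst//; apply: ge0_le_integral => //.
- by move=> w _; apply: (energy_ge0 HS); exact: (Hrho n).
- by apply: (energy_measurable T0 HF HR HS); exact: (Hrho n).
- by move=> w _; apply: (energy_le1 d0 HS); exact: (Hrho n).
Qed.

Lemma escape_cvg0 : (fun n => mu_ n (before n)) @ \oo --> 0.
Proof.
have H : \forall n \near \oo, (cst 0 : nat -> \bar R) n <= mu_ n.+1 (before n.+1) <=
    (e2^-1 * n.+1%:R^-1)%:E.
  apply: nearW => n; rewrite measure_ge0 /=.
  have := le_trans (escape_energy n.+1) (energy_int_le1 n.+1).
  have p : (0 < e2 * n.+1%:R)%R by exact: mulr_gt0.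
  rewrite -(fineK (mu_fin n.+1 (mbefore n.+1))) -EFinM !lee_fin => h.
  by rewrite -invfM -div1r ler_pdivlMr// mulrC (mulrC e2).
have h0 : (fun n => (e2^-1 * n.+1%:R^-1)%:E) @ \oo --> (0 : \bar R).
  apply: cvg_EFin; first exact: nearW.
  by rewrite -(mulr0 e2^-1%R); apply: cvgM; [exact: cvg_cst|exact: cvg_harmonic].
have c0 : (cst 0 : nat -> \bar R) @ \oo --> (0 : \bar R) by exact: cvg_cst.
have := squeeze_cvge H c0 h0.
by rewrite (cvg_shiftS (fun n => mu_ n (before n))); apply.
Qed.

(* The limit measure is the sum over [n] of [mu_ n] restricted to the event that [rho_ n] is the first
switching time equal to [T]. *)
Let piece n w : \bar R := if n is n'.+1 then at_end (rho_ n) w * (\1_(before n') w)%:E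
  else at_end (rho_ n) w.

Let at_end_split n w : at_end (rho_ n.+1) w = at_end (rho_ n) w + piece n.+1 w.
Proof.
rewrite /piece /at_end !indicE.
have rr : (rho_ n w <= rho_ n.+1 w)%R by case: (Hext n).
have r1 : (rho_ n.+1 w <= T)%R by case: (Hrho n.+1) => /(_ w)/andP[].
have [rT|rT] := pselect (rho_ n w = T).
  rewrite mem_set; last by apply/eqP; rewrite eq_le r1 /= -{1}rT.
  by rewrite mem_set// memNset ?mule0 ?adde0// /before /= rT ltxx.
have nT : ~ [set w | rho_ n w = T] w by [].
have bT : before n w.
  by rewrite /before /= lt_neqAle (le_trans rr r1) andbT; exact/eqP.
by rewrite (memNset nT) add0e (mem_set bT) mule1.
Qed.

Let mat n : measurable_fun setT (at_end (rho_ n)).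
Proof.
apply/measurable_EFinP; apply: measurable_indic.
have := F_stop_eqT T0 HF (Hrho n) measurableT; rewrite setTI => -[]//.
Qed.

Let mpiece n : measurable_fun setT (piece n).
Proof.
case: n => [|n]; first exact: mat.
apply: emeasurable_funM; first exact: (mat n.+1).
by apply/measurable_EFinP; exact: measurable_indic.
Qed.

Let piece0 n w : 0 <= piece n w.
Proof. by case: n => [|n]; rewrite /piece ?mule_ge0 ?at_end_ge0// lee_fin. Qed.

Lemma limit_exists : exists mu : {measure set Om -> \bar R},
  [/\ dominated Q mu, mu setT = 1,
      forall tau k, real_stopping_time T F tau -> \int[mu]_w price S k (tau w) w = a k &
      forall A, measurable A -> mu_ 0 (A `&` [set w | rho_ 0 w = T]) <= mu A].
Proof.
have [nu Hnu] := choice (fun n => density_measure_exists (mu_ n) (@mpiece n) (@piece0 n)).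
pose mu : {measure set Om -> \bar R} := mseries nu 0.
have muE f : measurable_fun setT f -> (forall w, 0 <= f w) ->
    \int[mu]_w f w = \sum_(n <oo) \int[mu_ n]_w (f w * piece n w).
  move=> mf f0; rewrite ge0_integral_measure_series//; apply: eq_eseriesr => n _.
  by rewrite (Hnu n).2.
(* The sum telescopes: the part settled by time [rho_N] is measurable in its past, so [mu_N] and
   [mu_(N+1)] integrate it equally, and [at_end_split] adds the new piece. *)
have partial f N : measurable_fun setT f -> (forall w, 0 <= f w) ->
    \sum_(0 <= n < N.+1) \int[mu_ n]_w (f w * piece n w) =
    \int[mu_ N]_w (f w * at_end (rho_ N) w).
  move=> mf f0; elim: N => [|N IH]; first by rewrite big_nat1.
  rewrite big_nat_recr//= IH.
  rewrite -(extension_integral T0 HF HR d0 HS (Hrho N) (Hext N)); last 2 first.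
  - exact: gmeas_at_end.
  - by move=> w; rewrite mule_ge0// at_end_ge0.
  rewrite -ge0_integralD//; last 4 first.
  - by move=> w _; rewrite mule_ge0// at_end_ge0.
  - exact: emeasurable_funM.
  - by move=> w _; apply: mule_ge0 => //; exact: (piece0 N.+1).
  - by apply: emeasurable_funM => //; exact: (mpiece N.+1).
  apply: eq_integral => w _; rewrite [X in _ = _ * X]at_end_split ge0_muleDr ?at_end_ge0//; exact: (piece0 N.+1).
have cvgmu f : measurable_fun setT f -> (forall w, 0 <= f w) ->
    (fun N => \int[mu_ N]_w (f w * at_end (rho_ N) w)) @ \oo --> \int[mu]_w f w.
  move=> mf f0; rewrite muE//.
  rewrite (_ : (fun N => _) = (fun N => \sum_(0 <= n < N.+1) \int[mu_ n]_w (f w * piece n w))); last first.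
    by apply/funext => N; rewrite partial.
  rewrite (cvg_shiftS (fun N => \sum_(0 <= n < N) \int[mu_ n]_w (f w * piece n w))).
  apply: is_cvg_ereal_nneg_natsum => n _; apply: integral_ge0 => w _.
  by rewrite mule_ge0.
have price_mu tau k : real_stopping_time T F tau -> \int[mu]_w price S k (tau w) w = a k.
  move=> Htau; have [t0T _] := Htau.
  have mz : measurable_fun setT (fun w => price S k (tau w) w).
    by apply: (gmeasW (F_stop_sub_algebra HF Htau).2); exact: (price_gmeas T0 HF HR HS Htau).
  have z0 w : 0 <= price S k (tau w) w by exact: (price_ge0 HS).
  have z1 w : price S k (tau w) w <= 1 by exact: (price_le1 HS).
  have cv := cvgmu _ mz z0.
  pose x N := \int[mu_ N]_w (price S k (tau w) w * at_end (rho_ N) w).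
  (* Where [rho_N = T] the stopped price is the price at [tau]; the other part lies between 0 and
     the mass before [T], which tends to 0. *)
  have E N : a k = x N + \int[mu_ N]_w (price S k (Num.min (tau w) (rho_ N w)) w * (\1_(before N) w)%:E).
    have Hm := real_stopping_time_min HF Htau (Hrho N).
    have mzm : measurable_fun setT (fun w => price S k (Num.min (tau w) (rho_ N w)) w).
      by apply: (gmeasW (F_stop_sub_algebra HF Hm).2); exact: (price_gmeas T0 HF HR HS Hm).
    have z0m w : 0 <= price S k (Num.min (tau w) (rho_ N w)) w.
      by apply: (price_ge0 HS); case: Hm.
    have mI : measurable_fun setT (fun w => (\1_(before N) w)%:E : \bar R).
      by apply/measurable_EFinP; exact: measurable_indic.
    have [_ _ _ /(_ tau k Htau) Ha] := Hinv N; rewrite -Ha.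
    rewrite /x -ge0_integralD//; last 4 first.
    - by move=> w _; rewrite mule_ge0// at_end_ge0.
    - exact: emeasurable_funM.
    - by move=> w _; rewrite mule_ge0// lee_fin.
    - exact: emeasurable_funM.
    apply: eq_integral => w _; rewrite /at_end !indicE.
    have rT : (rho_ N w <= T)%R by case: (Hrho N) => /(_ w)/andP[].
    have [e|ne] := pselect (rho_ N w = T).
      rewrite mem_set// mule1 memNset ?mule0 ?adde0; last by rewrite /before /= e ltxx.
      by rewrite min_l// e; case/andP: (t0T w).
    rewrite memNset// mule0 add0e mem_set ?mule1//.
    by rewrite /before /= lt_neqAle rT andbT; exact/eqP.
  have lo N : x N <= a k.
    rewrite (E N); apply: leeDl; apply: integral_ge0 => w _.
    rewrite mule_ge0// ?lee_fin//; apply: (price_ge0 HS).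
    by case: (real_stopping_time_min HF Htau (Hrho N)).
  have hi N : a k <= x N + mu_ N (before N).
    rewrite (E N); apply: leeD => //.
    have mI : measurable_fun setT (fun w => (\1_(before N) w)%:E : \bar R).
      by apply/measurable_EFinP; exact: measurable_indic.
    have Hm := real_stopping_time_min HF Htau (Hrho N).
    have mzm : measurable_fun setT (fun w => price S k (Num.min (tau w) (rho_ N w)) w).
      by apply: (gmeasW (F_stop_sub_algebra HF Hm).2); exact: (price_gmeas T0 HF HR HS Hm).
    have -> : mu_ N (before N) = \int[mu_ N]_w (\1_(before N) w)%:E.
      by rewrite integral_indic// setIT.
    apply: ge0_le_integral => //.
    - move=> w _; rewrite mule_ge0// ?lee_fin//; apply: (price_ge0 HS).
      by case: Hm.
    - exact: emeasurable_funM.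
    - move=> w _; rewrite -[leRHS]mul1e; apply: lee_wpmul2r; first by rewrite lee_fin.
      by apply: (price_le1 HS); case: Hm.
  have cx : cvgn x by apply/cvg_ex; eexists; exact: cv.
  have xlim : limn x = \int[mu]_w price S k (tau w) w by exact: cvg_lim cv.
  apply/eqP; rewrite eq_le -xlim; apply/andP; split.
    by apply: lime_le => //; exact: nearW.
  have cs : (fun N => x N + mu_ N (before N)) @ \oo --> limn x + 0.
    apply: cvgeD; [by rewrite fin_num_adde_defl|exact: cx|exact: escape_cvg0].
  rewrite -[leRHS]adde0 -(cvg_lim _ cs)//; apply: lime_ge; last exact: nearW.
  by apply/cvg_ex; eexists; exact: cs.
have Hcst : real_stopping_time T F (cst T) by apply: real_stopping_time_cst; rewrite ?lexx ?ltW.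
exists mu; split => //.
- move=> A mA QA; rewrite /mu /= /mseries; apply: eseries0 => n _ _.
  rewrite (Hnu n).1; apply: null_set_integral => //; first exact: measurable_funTS.
  by case: (Hinv n) => _ ac _ _; exact: ac.
(* Since prices sum to 1, the total mass is the sum of the [a k], for the limit as for [mu_ 0]. *)
- have sumE (m : {measure set Om -> \bar R}) r : real_stopping_time T F r ->
      m setT = \sum_(k < d) \int[m]_w (price S k (r w) w).
    move=> Hr; rewrite -[LHS]mul1e -integral_cst//.
    rewrite (integral_sum_price T0 HF HR d0 HS m Hr); [|exact: measurable_cst|by []].
    by apply: eq_bigr => k _; apply: eq_integral => w _; rewrite mul1e.
  rewrite (sumE mu _ Hcst) -(mu1 0) (sumE (mu_ 0%N) _ (Hrho 0)).
  apply: eq_bigr => k _; rewrite price_mu//.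
  case: (Hinv 0) => _ _ _ /(_ (cst T) k Hcst) <-.
  by apply: eq_integral => w _; rewrite min_r//; case: (Hrho 0) => /(_ w)/andP[].
- move=> A mA.
  have mI : measurable_fun setT (fun w => (\1_A w)%:E : \bar R).
    by apply/measurable_EFinP; exact: measurable_indic.
  have -> : mu A = \int[mu]_w (\1_A w)%:E by rewrite integral_indic// setIT.
  rewrite muE//.
  have -> : mu_ 0 (A `&` [set w | rho_ 0 w = T]) = \int[mu_ 0]_w ((\1_A w)%:E * piece 0 w).
    rewrite /piece /at_end integral_ind setTI integral_indic//.
    by have := F_stop_eqT T0 HF (Hrho 0) measurableT; rewrite setTI => -[].
  apply: le_trans (nneseries_lim_ge 1 _) => /=; first by rewrite big_nat1.
  by move=> n _ _; apply: integral_ge0 => w _; rewrite mule_ge0// lee_fin.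
Qed.

End limit_measure.

(** * Mixtures *)

Section positivity.
Context {R : realType} {dO} {Om : measurableType dO} (mu : {measure set Om -> \bar R}).
Local Open Scope ereal_scope.

Lemma integral_gt0_null (f : Om -> \bar R) (A : set Om) : measurable_fun setT f ->
  measurable A -> (forall w, A w -> 0 < f w) -> \int[mu]_(w in A) f w = 0 -> mu A = 0.
Proof.
move=> mf mA fpos fA0; have mfA : measurable_fun A f by exact: measurable_funTS.
have hae : ae_eq mu A f (cst 0).
  apply/ae_eq_integral_abs => //.
  rewrite -[RHS]fA0; apply: eq_integral => w /[1!inE] /fpos /ltW; exact: gee0_abs.
apply: measure_negligible => //.
have : {ae mu, forall w, ~ A w}.
  by apply: filterS hae => w hw Aw; have := fpos w Aw; rewrite (hw Aw) ltxx.
rewrite /almost_everywhere /prop_near1 /nbhs /=; congr (_.-negligible _).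
by apply/seteqP; split => w /=; [rewrite notE|move=> Aw /(_ Aw)].
Qed.

End positivity.

Section assembly.
Context {R : realType} {dO} {Om : measurableType dO} (T : R) (F : R -> set (set Om)).
Hypotheses (T0 : 0 < T) (HF : filtration T F) (HR : right_continuous_filtration T F).
Context (d : nat) (S : R -> Om -> 'I_d -> 'I_d -> \bar R).
Hypotheses (d0 : (0 < d)%N) (HS : exchange_process T F S).
Variable Q : 'I_d -> probability Om R.
Local Open Scope ereal_scope.

Definition valuation_like (mu : {measure set Om -> \bar R}) :=
  [/\ dominated Q mu, mu setT = 1 &
      forall k s t A, (0 <= s)%R -> (s <= t)%R -> (t <= T)%R -> F s A ->
        \int[mu]_(w in A) price S k t w = \int[mu]_(w in A) price S k s w].

Lemma price_adapted k : adapted T F (price S k).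
Proof.
move=> t tT; apply/(gmeasE _ (filtration_sigma_algebra HF tT)).
rewrite (_ : price S k t = (fun w => ((fine (row_total S k t w))^-1)%:E)); last first.
  by apply/funext => w; rewrite /price basketE.
apply: (@measurable_fine_inv _ _ (g_sigma_algebraType (F t))).
  by apply/(gmeasE _ (filtration_sigma_algebra HF tT)); exact: (total_adapted HF HS).
by move=> w; exact: (total_ge0 HS).
Qed.

Lemma price_measurable k t : (0 <= t <= T)%R -> measurable_fun setT (price S k t).
Proof.
by move=> tT; apply: (gmeasW (filtration_measurable HF tT)); exact: price_adapted.
Qed.

(** Compare the constant time [t] with the time equal to [s] on [A] and to [t] off [A]: both
    expectations are [a k], and the common finite part over the complement of [A] cancels. *)
Lemma stopping_valuation_like (a : 'I_d -> \bar R) mu : dominated Q mu -> mu setT = 1 ->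
  (forall tau k, real_stopping_time T F tau -> \int[mu]_w price S k (tau w) w = a k) ->
  valuation_like mu.
Proof.
move=> ac mu1 Ha; split => // k s t A s0 st tT FA.
have sT : (0 <= s <= T)%R by rewrite s0 (le_trans st).
have t0T : (0 <= t <= T)%R by rewrite (le_trans s0 st).
have mA := filtration_measurable HF sT FA.
have mAc : measurable (~` A) by exact: measurableC.
pose tau w := if w \in A then s else t.
have Htau : real_stopping_time T F tau.
  split=> [w|u /andP[u0 uT]]; first by rewrite /tau; case: ifP.
  have uT' : (0 <= u <= T)%R by rewrite u0 ltW.
  have su := filtration_sigma_algebra HF uT'.
  have [tu|ut] := leP t u.
    rewrite (_ : [set w | _] = setT); first exact: sigma_algebra_setT.
    by apply/seteqP; split => // w _ /=; rewrite /tau; case: ifP => // _; rewrite (le_trans st).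
  have [su'|us] := leP s u.
    rewrite (_ : [set w | _] = A).
      by apply: (filtration_mono HF s0 su' (ltW uT)).
    apply/seteqP; split => w /=; rewrite /tau; first by case: ifPn => [/set_mem//|_]; rewrite leNgt ut.
    by move=> Aw; rewrite mem_set.
  rewrite (_ : [set w | _] = set0); first by case: su.
  apply/seteqP; split => w //=; rewrite /tau; case: ifP => _; rewrite leNgt ?us//.
  by rewrite (lt_le_trans us st).
have mt := price_measurable k t0T.
have ms := price_measurable k sT.
have pt w : 0 <= price S k t w by exact: (price_ge0 HS).
have ps w : 0 <= price S k s w by exact: (price_ge0 HS).
have split_int f : measurable_fun setT f -> (forall w, 0 <= f w) ->
   \int[mu]_w f w = \int[mu]_(w in A) f w + \int[mu]_(w in ~` A) f w.
  move=> mf f0; rewrite -(setUv A) ge0_integral_setU//.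
    by rewrite setUv.
  by rewrite disj_set2E setICr.
have Et : \int[mu]_(w in A) price S k t w + \int[mu]_(w in ~` A) price S k t w = a k.
  by rewrite -split_int// -(Ha (cst t) k)//; exact: real_stopping_time_cst.
have Es : \int[mu]_(w in A) price S k s w + \int[mu]_(w in ~` A) price S k t w = a k.
  rewrite -(Ha tau k Htau) (split_int (fun w => price S k (tau w) w)).
  - congr (_ + _); apply: eq_integral => w /[1!inE] Aw; rewrite /tau; first by rewrite mem_set.
    by rewrite memNset.
  - apply: (gmeasW (F_stop_sub_algebra HF Htau).2); exact: (price_gmeas T0 HF HR HS Htau).
  - by move=> w; apply: (price_ge0 HS); case: Htau.
have fin : \int[mu]_(w in ~` A) price S k t w \is a fin_num.
  rewrite ge0_fin_numE; last exact: integral_ge0.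
  apply: (@le_lt_trans _ _ (\int[mu]_(w in ~` A) 1)).
    apply: ge0_le_integral => //; first exact: measurable_funTS.
    by move=> w _; exact: (price_le1 HS).
  rewrite integral_cst// mul1e; apply: (@le_lt_trans _ _ (mu setT)); last by rewrite mu1 ltry.
  by apply: le_measure; rewrite ?inE.
have E : \int[mu]_(w in A) price S k t w + \int[mu]_(w in ~` A) price S k t w =
  \int[mu]_(w in A) price S k s w + \int[mu]_(w in ~` A) price S k t w by rewrite Et Es.
by have := congr1 (fun x => x - \int[mu]_(w in ~` A) price S k t w) E; rewrite !addeK.
Qed.

(** A mixture with weights [2^-(n+1)] along the enumeration of [I]. Codes that decode to nothing
    repeat [i0], so the weights still sum to 1. *)
Lemma valuation_measure_of_family (I : countType) (i0 : I)
    (nu : I -> {measure set Om -> \bar R}) :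
  (forall i, valuation_like (nu i)) ->
  (forall A, measurable A -> (forall i, nu i A = 0) -> forall j, Q j A = 0) ->
  exists Qb : probability Om R, equiv_measures Qb (Qsum Q) /\ valuation_measure T F S Qb.
Proof.
move=> Hnu Htot.
pose nun n := nu (odflt i0 (unpickle n)).
pose c n : \bar R := (2^-1 ^+ n.+1)%:E.
have c0 n : 0 <= c n by rewrite lee_fin exprn_ge0.
have cpos n : 0 < c n by rewrite lte_fin exprn_gt0.
have [m Hm] := choice (fun n => density_measure_exists (nun n)
  (@measurable_cst _ _ Om _ setT (c n)) (fun _ => c0 n)).
pose mu : {measure set Om -> \bar R} := mseries m 0.
have mE n A : measurable A -> m n A = c n * nun n A.
  by move=> mA; rewrite (Hm n).1 integral_cst.
have mui A f : measurable A -> measurable_fun setT f -> (forall w, 0 <= f w) ->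
    \int[mu]_(w in A) f w = \sum_(n <oo) c n * \int[nun n]_(w in A) f w.
  move=> mA mf f0; rewrite ge0_integral_measure_series//; last exact: measurable_funTS.
  apply: eq_eseriesr => n _; rewrite integral_mkcond (Hm n).2.
  - rewrite [in RHS]integral_mkcond -ge0_integralZl//.
    + by apply: eq_integral => w _; rewrite muleC.
    + by apply/(measurable_restrictT _ mA).1; exact: measurable_funTS.
    + by move=> w _; apply: erestrict_ge0.
  - by apply/(measurable_restrictT _ mA).1; exact: measurable_funTS.
  - by move=> w; apply: erestrict_ge0.
have mu1 : mu setT = 1.
  rewrite /mu /= /mseries.
  rewrite (eq_eseriesr (g := c)); last first.
    by move=> n _; rewrite mE//; case: (Hnu (odflt i0 (unpickle n))) => _ -> _; rewrite mule1.
  have := @cvg_geometric_eseries_half R 1 0.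
  rewrite expr0 divr1 => /cvg_lim <-//.
  congr (limn _); apply/funext => N; apply: eq_bigr => n _.
  by rewrite /c addn1 div1r natrX exprVn.
have [Qb QbE] := probabilityP mu1.
have Qbi A f : \int[Qb]_(w in A) f w = \int[mu]_(w in A) f w.
  by apply: eq_measure_integral => B _ _; exact: QbE.
exists Qb; split.
  move=> A mA; rewrite QbE Qsum_eq0; split => [muA|QA].
    apply: Htot => // i; have iE : nun (pickle i) = nu i by rewrite /nun pickleK.
    have : m (pickle i) A <= 0.
      rewrite -muA /mu /= /mseries.
      apply: le_trans (nneseries_lim_ge (pickle i).+1 _) => /=.
        by rewrite big_nat_recr//= leeDr// sume_ge0.
      by move=> n _ _; exact: measure_ge0.
    rewrite mE// iE => le0; apply/eqP; have : c (pickle i) * nu i A == 0.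
      by rewrite eq_le le0 mule_ge0.
    by rewrite mule_eq0 gt_eqF//= .
  rewrite /mu /= /mseries; apply: eseries0 => n _ _; rewrite mE//.
  by case: (Hnu (odflt i0 (unpickle n))) => ac _ _; rewrite /nun ac// mule0.
move=> k; split.
- exact: price_adapted.
- move=> t tT; apply: (@le_integrable _ _ _ _ _ measurableT _ (cst 1)).
  + exact: price_measurable.
  + move=> w _; rewrite /= gee0_abs; last exact: (basket_ge0 (process_matrix HS w tT)).
    by rewrite normr1; exact: (basket_le1 (process_matrix HS w tT)).
  + exact: finite_measure_integrable_cst.
- move=> s t s0 st tT A FA; rewrite !Qbi.
  have sT : (0 <= s <= T)%R by rewrite s0 (le_trans st).
  have t0T : (0 <= t <= T)%R by rewrite (le_trans s0 st).
  have mA := filtration_measurable HF sT FA.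
  rewrite (mui A (price S k t)) ?(mui A (price S k s))//.
  + apply: eq_eseriesr => n _; congr (_ * _).
    by case: (Hnu (odflt i0 (unpickle n))) => _ _; apply.
  + exact: price_measurable.
  + by move=> w; exact: (price_ge0 HS).
  + exact: price_measurable.
  + by move=> w; exact: (price_ge0 HS).
Qed.

End assembly.

(** * The two cases *)

Section two_cases.
Context {R : realType} {dO} {Om : measurableType dO} (T : R) (F : R -> set (set Om)).
Hypotheses (T0 : 0 < T) (HF : filtration T F) (HR : right_continuous_filtration T F).
Context (d : nat) (S : R -> Om -> 'I_d -> 'I_d -> \bar R).
Hypotheses (d0 : (0 < d)%N) (HS : exchange_process T F S).
Variable Q : 'I_d -> probability Om R.
Local Open Scope ereal_scope.

Let O0 : (0 <= (0 : R) <= T)%R. Proof. by rewrite lexx ltW. Qed.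
Let OT : (0 <= T <= T)%R. Proof. by rewrite lexx ltW. Qed.

Let active0 w i : row_total S i 0%R w < +oo. Proof. by case: HS => _ _ _ H; exact: H. Qed.

Let total_gt0 i t w : (0 <= t <= T)%R -> 0 < row_total S i t w.
Proof.
by move=> tT; apply: lt_le_trans (row_sum_ge1 (process_matrix HS w tT) i); rewrite lte01.
Qed.

Let price0_gt0 i w : 0 < price S i 0%R w.
Proof. exact: (basket_gt0 (process_matrix HS w O0) (active0 w i)). Qed.

Let mprice k t : (0 <= t <= T)%R -> measurable_fun setT (price S k t).
Proof. exact: (price_measurable HF HS). Qed.

Let mrate i k t : (0 <= t <= T)%R -> measurable_fun setT (rate S i k t).
Proof.
by move=> tT; apply: (gmeasW (filtration_measurable HF tT)); exact: (rate_adapted HS).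
Qed.

Let mtotal i t : (0 <= t <= T)%R -> measurable_fun setT (row_total S i t).
Proof.
by move=> tT; apply: (gmeasW (filtration_measurable HF tT)); exact: (total_adapted HF HS).
Qed.

(** * Case (a): change of measure by true martingales *)

Section martingale_case.
Hypothesis HQ : condition_a T F S Q.

Lemma total_finite_martingale i t : (0 <= t <= T)%R ->
  {ae Q i, forall w, row_total S i t w < +oo}.
Proof.
move=> tT; have iY : (Q i).-integrable setT (row_total S i t).
  have := @integrable_sum _ _ _ (Q i) setT measurableT _ (index_enum 'I_d) xpredT (fun k => rate S i k t).
  by apply => k _; case: (HQ i k) => _ /(_ t tT).
have := integrable_ae measurableT iY; apply: filterS => w /(_ I).
by rewrite ge0_fin_numE// ltW// total_gt0.
Qed.

(** The weight [v * Z_k(t)] is known at [t], so [Y_i(T)] may be replaced by [Y_i(t)]; this is a.e.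
    finite, and [Z_k(t) Y_i(t) = S_(i,k)(t)]. *)
Lemma martingale_change_of_measure i k t (v : Om -> \bar R) : (0 <= t <= T)%R ->
  gmeas (F t) v -> (forall w, 0 <= v w) ->
  \int[Q i]_w (v w * price S k t w * row_total S i T w) = \int[Q i]_w (v w * rate S i k t w).
Proof.
move=> tT gv v0; have sa := filtration_sub_algebra HF tT.
have mv : measurable_fun setT v by exact: (gmeasW sa.2 gv).
have gz : gmeas (F t) (price S k t) by move=> B; exact: (price_adapted HF HS k tT).
have z0 w : 0 <= price S k t w by exact: (price_ge0 HS).
have gw : gmeas (F t) (fun w => v w * price S k t w) by exact: (gmeasM sa.1 gv gz).
have w0 w : 0 <= v w * price S k t w by rewrite mule_ge0.
have mw : measurable_fun setT (fun w => v w * price S k t w) by exact: (gmeasW sa.2 gw).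
have distr u : (0 <= u <= T)%R ->
    \int[Q i]_w (v w * price S k t w * row_total S i u w) =
    \sum_(l < d) \int[Q i]_w (v w * price S k t w * rate S i l u w).
  move=> uT; rewrite -ge0_integral_sum//; last 2 first.
  - by move=> l; apply: emeasurable_funM => //; exact: mrate.
  - by move=> l w _; rewrite mule_ge0// (rate_ge0 HS).
  apply: eq_integral => w _; rewrite /row_total /row_sum ge0_sume_distrr//.
  by move=> l _; exact: (rate_ge0 HS).
rewrite distr//.
transitivity (\sum_(l < d) \int[Q i]_w (v w * price S k t w * rate S i l t w)).
  apply: eq_bigr => l _; apply: (integral_gmeas_eq sa) => //.
  - exact: mrate.
  - exact: mrate.
  - by move=> w; exact: (rate_ge0 HS).
  - by move=> w; exact: (rate_ge0 HS).
  move=> A FA; case: (HQ i l) => _ _; apply => //; by case/andP: tT.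
rewrite -distr//; apply: ge0_ae_eq_integral => //.
- by apply: emeasurable_funM => //; exact: mtotal.
- by apply: emeasurable_funM => //; exact: mrate.
- by move=> w _; rewrite mule_ge0// (total_ge0 HS).
- by move=> w _; rewrite mule_ge0// (rate_ge0 HS).
apply: filterS (total_finite_martingale i tT) => w Yoo _.
by rewrite -muleA; congr (_ * _); exact: (basket_mul_row_sum (process_matrix HS w tT)).
Qed.

Lemma valuation_measure_martingale_case :
  exists Qb : probability Om R, equiv_measures Qb (Qsum Q) /\ valuation_measure T F S Qb.
Proof.
pose h i w := price S i 0%R w * row_total S i T w.
have mh i : measurable_fun setT (h i).
  by apply: emeasurable_funM; [exact: mprice|exact: mtotal].
(* Strict positivity of the density [Y_i(T) / Y_i(0)] makes null sets of [nu i] null for [Q i], the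
   half of the equivalence that domination does not give. *)
have h0 i w : 0 < h i w by apply: mule_gt0 => //; exact: total_gt0.
have [nu Hnu] := choice (fun i => density_measure_exists (Q i) (mh i) (fun w => ltW (h0 i w))).
apply: (valuation_measure_of_family HF HS (I := 'I_d) (Ordinal d0) (nu := nu)); last first.
  move=> A mA nuA j; apply: (integral_gt0_null (mh j) mA); first by move=> w _; exact: h0.
  by rewrite -(Hnu j).1.
have z00 i w : 0 <= price S i 0%R w by exact: ltW.
have gz0 i t : (0 <= t <= T)%R -> gmeas (F t) (price S i 0%R).
  move=> /andP[t0 tT]; apply: (@gmeas_sub _ _ _ (F 0%R)); last by move=> B; exact: (price_adapted HF HS i O0).
  exact: (filtration_mono HF (lexx _) t0 tT).
have key i k t A : (0 <= t <= T)%R -> F t A ->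
    \int[nu i]_(w in A) price S k t w =
    \int[Q i]_(w in A) (price S i 0%R w * rate S i k t w).
  move=> tT FA; have sa := filtration_sub_algebra HF tT; have mA := sa.2 _ FA.
  have mI : measurable_fun setT (fun w => (\1_A w)%:E : \bar R).
    by apply/measurable_EFinP; exact: measurable_indic.
  have := @martingale_change_of_measure i k t (fun w => (\1_A w)%:E * price S i 0%R w) tT.
  move=> /(_ _ _)E; transitivity (\int[Q i]_w ((\1_A w)%:E * price S i 0%R w * price S k t w * row_total S i T w)).
    rewrite -[A in LHS]setTI -integral_ind (Hnu i).2.
    - apply: eq_integral => w _; rewrite /h !muleA; congr (_ * _).
      by rewrite -muleA muleC.
    - by apply: emeasurable_funM => //; exact: mprice.
    - by move=> w; rewrite mule_ge0// ?lee_fin// (price_ge0 HS).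
  rewrite E; last 2 first.
  - apply: (gmeasM sa.1); [exact: (gmeas_ind sa.1 FA)|exact: gz0].
  - by move=> w; rewrite mule_ge0// lee_fin.
  rewrite -[A in RHS]setTI -integral_ind; apply: eq_integral => w _.
  by rewrite -muleA muleC.
move=> i; split.
- move=> A mA QA; rewrite (Hnu i).1; apply: null_set_integral => //; last exact: QA.
  exact: measurable_funTS.
- have H0 : real_stopping_time T F (cst 0%R) by exact: real_stopping_time_cst.
  rewrite -[LHS]mul1e -integral_cst//.
  rewrite (integral_sum_price T0 HF HR d0 HS (nu i) H0); [|exact: measurable_cst|by []].
  transitivity (\sum_(k < d) \int[Q i]_w price S k 0%R w).
    apply: eq_bigr => k _.
    transitivity (\int[nu i]_w price S k 0%R w); first by apply: eq_integral => w _; rewrite mul1e.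
    rewrite key//; last exact: sigma_algebra_setT (filtration_sigma_algebra HF O0).
    apply: eq_integral => w _.
    exact: (mul_basket_exchange (process_matrix HS w O0) k (active0 w i)).
  rewrite -(probability_setT (Q i)) -[RHS]mul1e -integral_cst//.
  rewrite (integral_sum_price T0 HF HR d0 HS (Q i) H0); [|exact: measurable_cst|by []].
  by apply: eq_bigr => k _; apply: eq_integral => w _; rewrite mul1e.
move=> k s t A s0 st tT FA.
have sT : (0 <= s <= T)%R by rewrite s0 (le_trans st).
have t0T : (0 <= t <= T)%R by rewrite (le_trans s0 st).
have FtA : F t A by exact: (filtration_mono HF s0 st tT).
have mA := filtration_measurable HF sT FA.
rewrite (key i k t A t0T FtA) (key i k s A sT FA).
have sa := filtration_sub_algebra HF sT.
have conv u : \int[Q i]_(w in A) (price S i 0%R w * rate S i k u w) =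
    \int[Q i]_w ((\1_A w)%:E * price S i 0%R w * rate S i k u w).
  rewrite -[A in LHS]setTI -integral_ind; apply: eq_integral => w _.
  by rewrite -[RHS]muleA [RHS]muleC.
rewrite !conv; apply: (integral_gmeas_eq sa).
- exact: mrate.
- exact: mrate.
- by move=> w; exact: (rate_ge0 HS).
- by move=> w; exact: (rate_ge0 HS).
- by move=> B FB; case: (HQ i k) => _ _; apply.
- by apply: (gmeasM sa.1); [exact: (gmeas_ind sa.1 FA)|exact: gz0].
- by move=> w; rewrite mule_ge0// lee_fin.
Qed.

End martingale_case.

(** * Case (b): switching after the row total passes a level [m] *)

Section local_martingale_case.
Hypothesis HQ : forall j k, local_martingale T F (Q j) (fun t w => S t w j k).
Hypothesis Hdom : forall rho j A, real_stopping_time T F rho -> F_stop T F rho A ->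
  (forall w, A w -> row_total S j (rho w) w < +oo) -> Q j A = 0 -> forall i, Q i A = 0.

Let H0 : real_stopping_time T F (cst 0%R).
Proof. exact: real_stopping_time_cst. Qed.

(** An instance of the general switch, from time 0 with constant choice [i], so that the pasting
    lemmas apply to the first step too. *)
Definition first_switch i (m : nat) := switch_time T S (cst 0%R) (cst i) m%:R.

Let FJ (i j : 'I_d) : F_stop T F (cst 0%R) [set w | (cst i : Om -> 'I_d) w = j].
Proof.
have sa := (F_stop_sub_algebra HF H0).1.
have [->|ij] := eqVneq i j.
  rewrite (_ : [set _ | _] = setT); first exact: sigma_algebra_setT.
  by apply/seteqP; split.
rewrite (_ : [set _ | _] = set0); first by case: sa.
by apply/seteqP; split => // w /= e; rewrite e eqxx in ij.
Qed.

Let m0 (m : nat) : (0 <= m%:R :> R)%R. Proof. by []. Qed.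

Let Hfirst i m : real_stopping_time T F (first_switch i m).
Proof. exact: (switch_time_stop HF HR HS _ H0 (FJ i)). Qed.

Let first_ge i m w : (0 <= first_switch i m w)%R.
Proof. by case: (Hfirst i m) => /(_ w)/andP[]. Qed.

(** Paths with [first_switch i m = T] are settled after the first pasting: the limit keeps their
    mass, and the density with respect to [Q i] is positive on them. *)
Lemma switching_measure i m : exists nu : {measure set Om -> \bar R},
  valuation_like T F S Q nu /\
  forall A, measurable A -> nu A = 0 -> Q i (A `&` [set w | first_switch i m w = T]) = 0.
Proof.
(* The starting measure is [Q i] itself and the chosen currency is always [i], so the transfer
   density is 1 for [j = i] and 0 otherwise. *)
pose D j (w : Om) : \bar R := ((i == j)%:R : R)%:E.
have gD j : gmeas (F_stop T F (cst 0%R)) (D j).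
  exact: (gmeas_cst (F_stop_sub_algebra HF H0).1).
have D0 j w : 0 <= D j w by rewrite lee_fin.
have DE j A : F_stop T F (cst 0%R) A ->
    \int[Q j]_(w in A) D j w = Q i (A `&` [set w | (cst i : Om -> 'I_d) w = j]).
  move=> [mA _]; rewrite integral_cst//.
  have [<-|ij] := eqVneq i j.
    by rewrite mul1e (_ : [set _ | _] = setT) ?setIT//; apply/seteqP; split.
  rewrite mul0e (_ : [set _ | _] = set0) ?setI0 ?measure0//.
  by apply/seteqP; split => // w /= e; rewrite e eqxx in ij.
have J0 w : row_total S (cst i w) (cst 0%R w) w < +oo by exact: active0.
have [mu1 [mu1E Hx]] := pasting_exists T0 HF HR HS HQ H0 (m0 m) (FJ i) J0 gD D0 DE.
have Hinit := initial_stopped_martingale T0 HF S Q i.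
have Hext : martingale_extension T F S (cst 0%R) (Q i) (first_switch i m) mu1.
  by split => // w; exact: first_ge.
have mdens j := @pasting_density_measurable _ _ _ _ _ T0 HF HR _ _ HS _ _ m%:R H0 (FJ i) _ gD j.
have dom1 : dominated Q mu1.
  move=> A mA QA; rewrite mu1E big1// => j _; apply: null_set_integral => //; last exact: QA.
  by apply: measurable_funTS; exact: mdens.
have H1 := extension_stopped_martingale T0 HF HR d0 HS H0 (Hfirst i m) Hext Hinit dom1.
set a := (fun k => _) in H1.
(* Pairs carry their invariant, so that a single choice function can be iterated. *)
pose st := {p : (Om -> R) * {measure set Om -> \bar R} |
  stopped_martingale_measure T F S Q a p.1 p.2}.
have Hnext (p : st) : exists q : st,
    martingale_extension T F S (sval p).1 (sval p).2 (sval q).1 (sval q).2 /\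
    price_gap T S (sval p).1 (sval q).1.
  have [r' [mu' [Hi He Hg]]] := next_switch T0 HF HR d0 HS HQ Hdom (svalP p).
  by exists (exist _ (r', mu') Hi).
have [nxt Hnxt] := choice Hnext.
pose p0 : st := exist _ (first_switch i m, mu1) H1.
pose seq n := iter n nxt p0.
have [nu [ac nu1 nuz nuge]] := limit_exists T0 HF HR d0 HS
  (fun n => svalP (seq n)) (fun n => (Hnxt (seq n)).1) (fun n => (Hnxt (seq n)).2).
exists nu; split; first exact: (stopping_valuation_like T0 HF HR HS ac nu1 nuz).
move=> A mA nuA; have := nuge A mA; rewrite nuA /= => le0.
have mB : measurable (A `&` [set w | first_switch i m w = T]).
  by case: (F_stop_eqT T0 HF (Hfirst i m) mA).
have muB0 : mu1 (A `&` [set w | first_switch i m w = T]) = 0.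
  by apply/eqP; rewrite eq_le le0 measure_ge0.
apply: (integral_gt0_null (mdens i) mB).
  move=> w _; rewrite /pasting_density /D eqxx mul1e indicE mem_set// mule1.
  by apply: mule_gt0 => //; apply: total_gt0; have [H _] := Hfirst i m; exact: H.
apply/eqP; rewrite eq_le integral_ge0 ?andbT; last first.
  by move=> w _; exact: (pasting_density_ge0 HF HR HS m%:R H0 (FJ i) D0).
rewrite -muB0 mu1E (bigD1 i)//= leeDl//; apply: sume_ge0 => j _; apply: integral_ge0 => w _.
exact: (pasting_density_ge0 HF HR HS m%:R H0 (FJ i) D0).
Qed.

(** A maximal inequality: [Y_i >= m] at a passage before [T], while [Z_i(0) Y_i] keeps expectation 1
    up to passage. So [m] times the integral of [Z_i(0)] over the event is at most 1 for all [m],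
    and [Z_i(0) > 0]. *)
Lemma first_switch_negligible i :
  Q i (\bigcap_m [set w | (first_switch i m w < T)%R]) = 0.
Proof.
pose N := \bigcap_m [set w | (first_switch i m w < T)%R].
have mN : measurable N.
  by apply: bigcapT_measurable => m; apply: (measurable_before T0 HF); exact: Hfirst.
apply: (@integral_gt0_null _ _ _ _ (price S i 0%R)) => //; first exact: mprice.
have bound (m : nat) : m%:R%:E * \int[Q i]_(w in N) price S i 0%R w <= 1.
  have mpN : measurable_fun N (price S i 0%R) by apply: measurable_funTS; exact: mprice.
  have p0 w : 0 <= price S i 0%R w by exact: ltW.
  have me0 : 0 <= m%:R%:E :> \bar R by rewrite lee_fin.
  rewrite -ge0_integralZl//.
  pose Y w := price S i 0%R w *
    (row_total S i (first_switch i m w) w * (\1_[set w | (cst i : Om -> 'I_d) w = i] w)%:E).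
  have YE w : Y w = price S i 0%R w * row_total S i (first_switch i m w) w.
    by rewrite /Y indicE mem_set// mule1.
  have Y0 w : 0 <= Y w.
    rewrite YE mule_ge0// ?ltW//; apply: total_gt0; by case: (Hfirst i m).
  have mY : measurable_fun setT Y.
    rewrite (_ : Y = fun w => price S i 0%R w * row_total S i (first_switch i m w) w).
      apply: emeasurable_funM; first exact: mprice.
      apply: (gmeasW (F_stop_sub_algebra HF (Hfirst i m)).2).
      exact: (total_gmeas T0 HF HR HS (Hfirst i m)).
    by apply/funext.
  apply: (@le_trans _ _ (\int[Q i]_(w in N) Y w)).
    apply: ge0_le_integral => //.
    - by move=> w _; rewrite mule_ge0// ?lee_fin// ltW.
    - by apply: measurable_funTS; apply: emeasurable_funM => //; exact: mprice.
    - exact: measurable_funTS.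
    move=> w /(_ m I) /= rT; rewrite YE muleC; apply: lee_wpmul2l; first exact: ltW.
    have [j <- cY] := first_passage_at HF HR H0 (FJ i) (total_adapted HF HS)
      (fun j => @total_right_continuous _ _ _ _ _ _ _ HS j) rT.
    exact: cY.
  apply: (@le_trans _ _ (\int[Q i]_w Y w)).
    by apply: ge0_subset_integral.
  have gp : gmeas (F_stop T F (cst 0%R)) (price S i 0%R).
    exact: (price_gmeas T0 HF HR HS H0).
  have -> : \int[Q i]_w Y w = \int[Q i]_w (price S i 0%R w *
      (row_total S i 0%R w * (\1_[set w | (cst i : Om -> 'I_d) w = i] w)%:E)).
    exact: (total_weighted T0 HF HR HS HQ H0 (m0 m) (FJ i) i H0 (Hfirst i m)
      (fun w => lexx _) (first_ge i m) (fun w => lexx _) gp p0).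
  rewrite -(probability_setT (Q i)) -[leRHS]mul1e -integral_cst//.
  apply: ge0_le_integral => //.
  - by move=> w _; rewrite indicE mem_set// mule1 mule_ge0// ltW// total_gt0.
  - apply: emeasurable_funM; first exact: mprice.
    apply: emeasurable_funM; first exact: mtotal.
    apply/measurable_EFinP; apply: measurable_indic.
    by case: (FJ i i).
  - move=> w _; rewrite indicE mem_set// mule1 /=.
    have HM := process_matrix HS w O0.
    rewrite [leLHS](_ : _ = S 0%R w i i); last exact: (basket_mul_row_sum HM i (active0 w i)).
    by case: HM => _ -> _.
apply/eqP; rewrite eq_le; apply/andP; split; last first.
  by apply: integral_ge0 => w _; exact: ltW.
have If : \int[Q i]_(w in N) price S i 0%R w \is a fin_num.
  rewrite ge0_fin_numE; last by apply: integral_ge0 => w _; exact: ltW.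
  by have := bound 1%N; rewrite mul1e => /le_lt_trans; apply; exact: ltry.
rewrite -(fineK If) lee_fin leNgt; apply/negP => I0.
(* Any integer above the inverse of the integral contradicts the bound. *)
have := bound (Num.truncn (fine (\int[Q i]_(w in N) price S i 0%R w))^-1).+1.
rewrite -(fineK If) -EFinM lee_fin leNgt => /negP; apply.
rewrite -ltr_pdivrMr// div1r.
exact: truncnS_gt.
Qed.

(** Up to a [Q j]-null set every path has [first_switch j m = T] for some [m], so the countable
    family indexed by pairs of a currency and a level detects every set charged by some [Q j]. *)
Lemma valuation_measure_local_martingale_case :
  exists Qb : probability Om R, equiv_measures Qb (Qsum Q) /\ valuation_measure T F S Qb.
Proof.
have [nu Hnu] := choice (fun p : 'I_d * nat => switching_measure p.1 p.2).
apply: (valuation_measure_of_family HF HS (I := ('I_d * nat)%type) (Ordinal d0, 0%N) (nu := nu)).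
  by move=> p; exact: (Hnu p).1.
move=> A mA nuA j.
pose N := \bigcap_m [set w | (first_switch j m w < T)%R].
have mN : measurable N.
  by apply: bigcapT_measurable => m; apply: (measurable_before T0 HF); exact: Hfirst.
pose B m := A `&` [set w | first_switch j m w = T].
have mB m : measurable (B m) by case: (F_stop_eqT T0 HF (Hfirst j m) mA).
have QB m : Q j (B m) = 0 by exact: (Hnu (j, m)).2.
apply: (@subset_measure0 _ _ _ (Q j) A (N `|` \bigcup_m B m)) => //.
- by apply: measurableU => //; exact: bigcup_measurable.
- move=> w Aw; have [Nw|nN] := pselect (N w); first by left.
  right; apply: contrapT => nB; apply: nN => m _ /=.
  have /andP[_ fT] := (Hfirst j m).1 w.
  rewrite lt_neqAle fT andbT; apply/eqP => fE; apply: nB; exists m => //.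
- apply: measure_negligible.
    by apply: measurableU => //; exact: bigcup_measurable.
  apply: negligibleU; first by exists N; split => //; exact: first_switch_negligible.
  apply: negligible_bigcup => m; exists (B m); split; [exact: mB|exact: QB|by []].
Qed.

End local_martingale_case.
End two_cases.

Theorem mainTheorem4 (R : realType) (dO : measure_display) (Om : measurableType dO)
  (T : R) (F : R -> set (set Om)) (d : nat)
  (S : R -> Om -> 'I_d -> 'I_d -> \bar R) (Q : 'I_d -> probability Om R) :
  0 < T -> (0 < d)%N ->
  filtration T F -> right_continuous_filtration T F -> trivial_F0 F ->
  exchange_process T F S ->
  condition_a T F S Q \/ condition_b T F S Q ->
  exists Qb : probability Om R,
    equiv_measures Qb (Qsum Q) /\ valuation_measure T F S Qb.
Proof.
move=> T0 d0 HF HR _ HS [Ha|[Hloc Hnod Hequiv _]].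
  exact: (valuation_measure_martingale_case T0 HF HR d0 HS Ha).
apply: (valuation_measure_local_martingale_case T0 HF HR d0 HS Hloc).
exact: (active_domination T0 HF d0 HS Hnod Hequiv).
Qed.
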